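(* Let $1\le q<p\le\infty$, $s\in\{0,1,2,\dots\}$, $\alpha\in[0,\infty)$, and let $\mathcal{X}$ be either $\mathbb{R}^n$ or a cube $Q_0$ of $\mathbb{R}^n$. Then $$\widetilde{JN}_{(p,q,s)_\alpha}(\mathcal{X})=\widetilde{JN}_{(p,1,s)_\alpha}(\mathcal{X})$$ as sets, and there exist positive constants $c_1,c_2$, independent of $f$, such that, for every $f$ in this space, $$c_1\|f\|_{\widetilde{JN}_{(p,1,s)_\alpha}(\mathcal{X})}\le\|f\|_{\widetilde{JN}_{(p,q,s)_\alpha}(\mathcal{X})}\le c_2\|f\|_{\widetilde{JN}_{(p,1,s)_\alpha}(\mathcal{X})}.$$
   Context: A cube in $\mathbb{R}^n$ has finite positive edge length and edges parallel to the coordinate axes; it need not be open or closed. $\mathcal{X}$ denotes either $\mathbb{R}^n$ or a fixed cube $Q_0$ of $\mathbb{R}^n$. Functions are real-valued. $\fint_Q f:=\frac1{|Q|}\int_Q f$. $L^q_{\mathrm{loc}}(\mathcal{X})$ is the set of measurable $f$ on $\mathcal{X}$ with $f\mathbf 1_E\in L^q(\mathcal{X})$ for every bounded $E\subset\mathcal{X}$. For $s\in\{0,1,2,\dots\}$, a cube $Q$ and $f$ integrable on $Q$, $P^{(s)}_Q(f)$ is the unique polynomial of degree at most $s$ such that $\int_Q[f(x)-P^{(s)}_Q(f)(x)]x^\gamma\,dx=0$ for every multi-index $\gamma$ with $|\gamma|\le s$. For $q\in[1,\infty)$, $f\in L^q_{\mathrm{loc}}(\mathcal{X})$ and $p\in[1,\infty)$,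 $$\|f\|_{\widetilde{JN}_{(p,q,s)_\alpha}(\mathcal{X})}:=\sup\left\{\sum_i|Q_i|\left[|Q_i|^{-\alpha}\left\{\fint_{Q_i}\left|f-P^{(s)}_{Q_i}(|f|)\right|^q\right\}^{1/q}\right]^p\right\}^{1/p},$$ the supremum being over all collections $\{Q_i\}_i$ of cubes contained in $\mathcal{X}$ with pairwise disjoint interiors; for $p=\infty$, $\|f\|_{\widetilde{JN}_{(\infty,q,s)_\alpha}(\mathcal{X})}:=\sup_{Q\subset\mathcal{X}}|Q|^{-\alpha}\{\fint_Q|f-P^{(s)}_Q(|f|)|^q\}^{1/q}$ (supremum over all cubes $Q\subset\mathcal{X}$). $\widetilde{JN}_{(p,q,s)_\alpha}(\mathcal{X})$ is the set of $f\in L^q_{\mathrm{loc}}(\mathcal{X})$ for which this quantity is finite. *)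

(* Defs.v *)
From HB Require Import structures.
From mathcomp Require Import all_boot all_order all_algebra.
From mathcomp Require mpoly.
(* The notations of mpoly clash with those of mathcomp-analysis, and its names
   isMeasure, Measure must be shadowed by the latter. *)
Import -(notations) mpoly.
From mathcomp Require Import all_classical all_reals all_analysis.

Set Implicit Arguments.
Unset Strict Implicit.
Unset Printing Implicit Defensive.
Import Order.TTheory GRing.Theory Num.Theory.
Import numFieldNormedType.Exports.

Local Open Scope classical_set_scope.
Local Open Scope ring_scope.

(* Borel sigma-algebra of R^n, generated by the coordinate projections, as the
   library does for [n.-tuple T]. *)
Definition measure_rV_display : measure_display. Proof. exact. Qed.

Section measurable_rV.
Variables (R : realType) (n : nat).

Let coord (i : 'I_n) (x : 'rV[R]_n) : measurableTypeR R := x ord0 i.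

Let rV_set0 : g_sigma_preimage coord set0.
Proof. exact: sigma_algebra0. Qed.

Let rV_setC A : g_sigma_preimage coord A -> g_sigma_preimage coord (~` A).
Proof. exact: sigma_algebraC. Qed.

Let rV_bigcup (F : (set 'rV[R]_n)^nat) :
  (forall i, g_sigma_preimage coord (F i)) ->
  g_sigma_preimage coord (\bigcup_i (F i)).
Proof. exact: sigma_algebra_bigcup. Qed.

HB.instance Definition _ := @isMeasurable.Build measure_rV_display
  'rV[R]_n (g_sigma_preimage coord) rV_set0 rV_setC rV_bigcup.

Lemma measurable_coord (i : 'I_n) :
  measurable_fun [set: 'rV[R]_n] (fun x => x ord0 i : measurableTypeR R).
Proof.
move=> _ B mB; rewrite setTI; apply: sub_sigma_algebra.
rewrite (bigD1 i)//=; left; exists B => //; by rewrite setTI.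
Qed.

Lemma measurable_rVP d (T : measurableType d) (f : T -> 'rV[R]_n) :
  (forall i, measurable_fun [set: T] (fun x => f x ord0 i : measurableTypeR R)) ->
  measurable_fun [set: T] f.
Proof.
move=> mf _ Y; rewrite [measurable Y]/measurable/= => mY.
suff : (image_set_system [set: T] f measurable) Y.
  by rewrite /image_set_system /=.
move: Y mY; apply: smallest_sub; first exact/sigma_algebra_image/sigma_algebra_measurable.
move=> Y; rewrite -bigcup_seq/= => -[i _ [A mA <-]].
by rewrite /image_set_system /= setTI; exact: mf.
Qed.

End measurable_rV.

Section lebesgue_rV.
Variable R : realType.

Definition rV_cons n (xy : R * 'rV[R]_n) : 'rV[R]_n.+1 :=
  \row_i oapp (xy.2 ord0) xy.1 (unlift ord0 i).

Let rV_uncons n (v : 'rV[R]_n.+1) : R * 'rV[R]_n :=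
  (v ord0 ord0, \row_j v ord0 (lift ord0 j)).

Let rV_consK n : cancel (@rV_cons n) (@rV_uncons n).
Proof.
case=> x y; rewrite /rV_uncons /rV_cons; congr pair; first by rewrite mxE unlift_none.
by apply/rowP => j; rewrite !mxE liftK.
Qed.

Lemma measurable_rV_cons n :
  measurable_fun [set: measurableTypeR R * 'rV[R]_n] (@rV_cons n).
Proof.
apply: measurable_rVP => i.
apply: (@eq_measurable_fun _ _ _ _ _
  (fun xy : measurableTypeR R * 'rV[R]_n => oapp (xy.2 ord0) xy.1 (unlift ord0 i)
     : measurableTypeR R)).
  by move=> xy _; rewrite mxE.
case: unliftP => [j _|_] /=; last exact: measurable_fst.
by apply: (measurableT_comp (measurable_coord j)).
Qed.

Let measurable_rV_uncons n : measurable_fun setT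
  (@rV_uncons n : 'rV[R]_n.+1 -> measurableTypeR R * 'rV[R]_n).
Proof.
apply/measurable_fun_pairP; split; first exact: measurable_coord.
apply: measurable_rVP => i.
apply: (@eq_measurable_fun _ _ _ _ _
  (fun x : 'rV[R]_n.+1 => x ord0 (lift ord0 i) : measurableTypeR R)).
  by move=> x _; rewrite /= mxE.
exact: measurable_coord.
Qed.

Section step.
Variables (n : nat) (mu : {sigma_finite_measure set 'rV[R]_n -> \bar R}).

Definition lebesgue_rV_step : set 'rV[R]_n.+1 -> \bar R :=
  pushforward (@lebesgue_measure R \x mu)%E (@rV_cons n).

Let step0 : lebesgue_rV_step set0 = 0%E.
Proof. by rewrite /lebesgue_rV_step /pushforward preimage_set0 measure0. Qed.

Let step_ge0 A : (0 <= lebesgue_rV_step A)%E.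
Proof. by rewrite /lebesgue_rV_step /pushforward; apply: measure_ge0. Qed.

Let step_sigma_additive : semi_sigma_additive lebesgue_rV_step.
Proof.
move=> F mF tF mUF; rewrite /lebesgue_rV_step /pushforward preimage_bigcup.
have mcons A : measurable A -> measurable (@rV_cons n @^-1` A).
  by move=> mA; rewrite -[X in measurable X]setTI; exact: measurable_rV_cons.
apply: measure_semi_sigma_additive.
- by move=> k; exact: mcons.
- apply/trivIsetP => /= i j _ _ ij; rewrite -preimage_setI.
  by move/trivIsetP : tF => /(_ _ _ _ _ ij) ->//; rewrite preimage_set0.
- by rewrite -preimage_bigcup; exact: mcons.
Qed.

HB.instance Definition _ := isMeasure.Build _ _ _ lebesgue_rV_step
  step0 step_ge0 step_sigma_additive.

Let step_sigma_finite : sigma_finite setT lebesgue_rV_step.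
Proof.
have /sigma_finiteP[F [TF ndF Foo]] := sigma_finiteT (@lebesgue_measure R).
have /sigma_finiteP[G [TG ndG Goo]] := sigma_finiteT mu.
exists (fun k => @rV_uncons n @^-1` (F k `*` G k)) => [|k].
  rewrite -preimage_bigcup -(@preimage_setT _ _ (@rV_uncons n)); congr (_ @^-1` _).
  rewrite -setXTT TF TG predeqE => -[x y]; split.
    move=> [/= [i _ Fix] [j _ Gjy]]; exists (maxn i j) => //; split.
    - by move: x Fix; exact/subsetPset/ndF/leq_maxl.
    - by move: y Gjy; exact/subsetPset/ndG/leq_maxr.
  by move=> [i _ []/= ? ?]; split; exists i.
have [mF Fk] := Foo k; have [mG Gk] := Goo k; split.
  rewrite -[X in measurable X]setTI; apply: measurable_rV_uncons => //.
  exact: measurableX.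
rewrite /lebesgue_rV_step /pushforward -comp_preimage.
rewrite (_ : _ \o _ = id) ?preimage_id; last by apply/funext => xy; exact: rV_consK.
by rewrite product_measure1E// lte_mul_pinfty// ge0_fin_numE.
Qed.

HB.instance Definition _ := Measure_isSigmaFinite.Build _ _ _ lebesgue_rV_step
  step_sigma_finite.

End step.

(* Iterated product measure, on Borel sets; lebesgue_rV_box gives the volume of
   boxes. *)
Fixpoint lebesgue_rV n : {sigma_finite_measure set 'rV[R]_n -> \bar R} :=
  match n with
  | 0 => dirac (0 : 'rV[R]_0)
  | m.+1 => lebesgue_rV_step (lebesgue_rV m)
  end.

Lemma measurable_rV_box n (A : 'I_n -> set R) :
  (forall i, measurable (A i : set (measurableTypeR R))) ->
  measurable [set v : 'rV[R]_n | forall i, A i (v ord0 i)].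
Proof.
move=> mA; rewrite [X in measurable X](_ : _ =
    \bigcap_(i in [set: 'I_n]) ((fun v : 'rV[R]_n => v ord0 i) @^-1` A i)).
  apply: fin_bigcap_measurable => // i _.
  by rewrite -[X in measurable X]setTI; exact: measurable_coord.
by apply/seteqP; split=> v /= vA i; [move=> _|]; exact: vA.
Qed.

Lemma lebesgue_rV_box n (A : 'I_n -> set R) :
  (forall i, measurable (A i : set (measurableTypeR R))) ->
  lebesgue_rV n [set v | forall i, A i (v ord0 i)] =
  (\prod_(i < n) @lebesgue_measure R (A i))%E.
Proof.
elim: n => [|n IH] in A * => mA.
  by rewrite big_ord0 /= diracE mem_set// => -[].
rewrite big_ord_recl -IH//= /lebesgue_rV_step /pushforward.
rewrite [X in (_ \x _)%E X](_ : _ = A ord0 `*`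
    [set v : 'rV[R]_n | forall i, A (lift ord0 i) (v ord0 i)]).
  rewrite product_measure1E//.
  by apply: (@measurable_rV_box n (fun i => A (lift ord0 i))) => i; exact: mA.
apply/seteqP; split=> -[x v] /= H.
- split=> [|i]; first by have := H ord0; rewrite mxE unlift_none.
  by have := H (lift ord0 i); rewrite mxE liftK.
- by move=> i; rewrite mxE; case: unliftP => [j|] -> /=; [exact: H.2|exact: H.1].
Qed.

End lebesgue_rV.

(* R^n with the sigma-algebra of Lebesgue (not only Borel) measurable sets,
   and the complete Lebesgue measure on it. *)
Notation lebesgue_space R n := (caratheodory_type (mu_ext (@lebesgue_rV R n))).

Section JN.
Variables (R : realType) (n : nat).
Implicit Types (X Q E : set 'rV[R]_n) (f : 'rV[R]_n -> R).

Definition leb : {measure set (lebesgue_space R n) -> \bar R} :=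
  @completed_measure_extension _ _ R (@lebesgue_rV R n).

(* A product of intervals of common length l, each of them open or closed at
   each end. *)
Definition is_cube Q := exists (a : 'rV[R]_n) (l : R) (b c : 'I_n -> bool),
  0 < l /\ Q = [set x | forall i, x ord0 i \in
    Interval (BSide (b i) (a ord0 i)) (BSide (c i) (a ord0 i + l))].

Definition vol Q : R := fine (leb Q).

Definition Lqloc X (q : R) f :=
  measurable_fun (X : set (lebesgue_space R n)) f /\
  forall E, measurable (E : set (lebesgue_space R n)) -> bounded_set E ->
    E `<=` X -> (\int[leb]_(x in X) (`|f x * \1_E x| `^ q)%:E < +oo)%E.

Definition is_polyproj (s : nat) Q f (P : mpoly.mpoly n R) :=
  (mpoly.msize P <= s.+1)%N /\
  forall g : mpoly.multinom n, (mpoly.mdeg g <= s)%N ->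
    (\int[leb]_(x in Q)
       ((f x - mpoly.meval (x ord0) P) * \prod_(i < n) x ord0 i ^+ g i)%:E = 0)%E.

(* For f integrable on Q there is exactly one such polynomial. *)
Definition polyproj (s : nat) Q f : 'rV[R]_n -> R :=
  fun x => mpoly.meval (x ord0) (xget 0 [set P | is_polyproj s Q f P]).

(* The projection is that of |f|, not of f. *)
Definition osc (q : R) (s : nat) (alpha : R) f Q : \bar R :=
  ((vol Q `^ (- alpha))%:E *
   ((vol Q)^-1%:E *
    \int[leb]_(x in Q) (`|f x - polyproj s Q (fun y => `|f y|) x| `^ q)%:E)
   `^ q^-1)%E.

(* Cubes with disjoint interiors are distinct, so a family of such cubes is the
   same as a set of them. *)
Definition packing X (C : set (set 'rV[R]_n)) :=
  (forall Q, C Q -> is_cube Q /\ Q `<=` X) /\ trivIset C (fun Q => Q°).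

(* Functions on X are represented by functions on R^n; only their values on X
   matter. The value at p = -oo is irrelevant. *)
Definition tJN_norm X (p : \bar R) (q : R) (s : nat) (alpha : R) f : \bar R :=
  match p with
  | r%:E => (ereal_sup
      [set \esum_(Q in C) ((vol Q)%:E * osc q s alpha f Q `^ r)%E
      | C in packing X] `^ r^-1)%E
  | +oo%E => ereal_sup [set osc q s alpha f Q | Q in
      [set Q | is_cube Q /\ Q `<=` X]]
  | -oo%E => 0%E
  end.

Definition tJN X (p : \bar R) (q : R) (s : nat) (alpha : R)
    : set ('rV[R]_n -> R) :=
  [set f | Lqloc X q f /\ (tJN_norm X p q s alpha f < +oo)%E].

End JN.

(* Main.v *)
(* Fix a cube Q, let h = |f - P_Q(|f|)|, and stop at the maximal dyadic subcubes
   Q' of Q on which the mean of h exceeds twice its mean over Q. They occupy at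
   most half of Q, and off them h is at most twice its mean. On Q', the polynomials
   P_Q(|f|) and P_Q'(|f|) differ by at most a constant times the sum of the mean
   over Q' of ||f| - P_Q(|f|)| <= h + (|f| - f), where that of h is controlled by
   maximality and that of |f| - f by the mean of |f - P_Q'(|f|)|, since
   |f| - P_Q'(|f|) has mean zero. So the mean of min(h, M)^q over Q is bounded by
   the norm with exponent 1, localized to Q, plus the sum of the same quantities
   over the Q'. Hoelder's inequality for the exponents q < p and the volume bound
   |Q|/2 make the latter smaller by the factor 2^(q/p - 1), so the estimate can be
   iterated, M is sent to infinity, and the local estimates are summed over a
   packing. For p = oo, the localized norm has to be replaced by a multiple of the
   volume and p by q + 1. *)
Require Import Defs.
From mathcomp Require Import all_boot all_order all_algebra.
From mathcomp Require mpoly.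
Import -(notations) mpoly.
From mathcomp Require Import all_classical all_reals all_analysis.
From mathcomp Require Import measurable_realfun ring lra zify.
Import Order.TTheory GRing.Theory Num.Theory.
Import numFieldNormedType.Exports.
Local Open Scope classical_set_scope.
Local Open Scope ring_scope.

Set Implicit Arguments.
Unset Strict Implicit.
Unset Printing Implicit Defensive.

(** * Cubes and Lebesgue measure *)

(** The integral of h^q is not known to be finite, so the recursive term cannot simply be absorbed
    on the left. Truncation at M makes everything finite, and J iterations leave an error of w^-J
    M^q |Q| for some w > 1, which vanishes for fixed M. For the iteration to contract, the power of
    the sum of the deviation on Q' and a constant must be split with a coefficient close to 1 on the
    deviation; the large coefficient falls on the constant, which is not iterated. That h is at most
    twice its mean off the stopping cubes is a differentiation statement. It is obtained by
    approximating measurable sets by finite unions of dyadic cubes. Three kinds of cubes occur: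
    half-open ones, which dyadic subdivision partitions exactly; open ones, which stay disjoint in a
    packing; and arbitrary ones, which differ from these by null sets. The sign of alpha enters when
    the weight is frozen: |Q'|^alpha <= |Q|^alpha for Q' inside Q. What remains of the localized
    norm, to the power p, is superadditive over disjoint sets, which is all that the iteration
    uses. *)

Section Cubes.
Context {R : realType} {n : nat}.
Implicit Types (A Q : set 'rV[R]_n) (c : 'rV[R]_n * R).

Lemma measurable_leb A : measurable A -> measurable (A : set (lebesgue_space R n)).
Proof. exact: caratheodory_measurable_mu_ext. Qed.

Lemma lebE A : measurable A -> leb R n A = lebesgue_rV R n A.
Proof. exact: measurable_mu_extE. Qed.

(** [leb] is the outer measure on arbitrary sets, so exceptional sets can be compared before they
    are known to be measurable. *)
Lemma le_leb A B : A `<=` B -> (leb R n A <= leb R n B)%E.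
Proof. exact: le_mu_ext. Qed.

Lemma measurable_leb_null A : leb R n A = 0%E -> measurable (A : set (lebesgue_space R n)).
Proof.
move=> A0; apply: le_caratheodory_measurable => X.
apply: (@le_trans _ _ (0 + leb R n X)%E); last by rewrite add0e.
apply: leeD; last by apply: le_leb; exact: subIsetl.
by rewrite -A0; apply: le_leb; exact: subIsetr.
Qed.

Lemma measurable_fun_leb d (T : measurableType d) (f : 'rV[R]_n -> T) :
  measurable_fun setT f -> measurable_fun (setT : set (lebesgue_space R n)) f.
Proof. by move=> mf _ Y mY; apply: measurable_leb; exact: mf. Qed.

(** The identity pushes the completed measure forward to the Borel one. This carries bounds proved
    by Tonelli, for the iterated product measure, over to [leb]. *)
Lemma ge0_integral_leb A (f : 'rV[R]_n -> \bar R) :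
  measurable A -> measurable_fun setT f -> (forall x, 0 <= f x)%E ->
  (\int[leb R n]_(x in A) f x = \int[lebesgue_rV R n]_(x in A) f x)%E.
Proof.
move=> mA mf f0.
have mid : measurable_fun setT (idfun : lebesgue_space R n -> 'rV[R]_n).
  by move=> _ Y mY; rewrite setTI preimage_id; exact: measurable_leb.
rewrite -(@eq_measure_integral _ _ _ A (lebesgue_rV R n)
   (pushforward (leb R n) (idfun : lebesgue_space R n -> 'rV[R]_n))).
  rewrite ge0_integral_pushforward//; first exact: (measurable_funS measurableT).
by move=> B mB _; exact: lebE.
Qed.

Definition gcube (b e : 'I_n -> bool) c : set 'rV[R]_n :=
  [set x | forall i, x ord0 i \in
    Interval (BSide (b i) (c.1 ord0 i)) (BSide (e i) (c.1 ord0 i + c.2))].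

Lemma measurable_gcube b e c : measurable (gcube b e c).
Proof.
apply: (@measurable_rV_box R n (fun i => [set` Interval
  (BSide (b i) (c.1 ord0 i)) (BSide (e i) (c.1 ord0 i + c.2))])) => i.
exact: measurable_itv.
Qed.

Lemma leb_gcube b e c : 0 < c.2 -> leb R n (gcube b e c) = (c.2 ^+ n)%:E.
Proof.
move=> c0; rewrite lebE; last exact: measurable_gcube.
rewrite (@lebesgue_rV_box R n (fun i => [set` Interval
  (BSide (b i) (c.1 ord0 i)) (BSide (e i) (c.1 ord0 i + c.2))])); last first.
  by move=> i; exact: measurable_itv.
transitivity (\prod_(i < n) c.2%:E)%E; last first.
  by rewrite prodEFin prodr_const card_ord.
apply: eq_bigr => i _; rewrite lebesgue_measure_itv/=.
by rewrite lte_fin ltrDl c0 EFinD addeAC subee ?add0e.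
Qed.

(** The flag [true] includes a lower endpoint but excludes an upper one: [hcube] is a product of
    intervals [a, a + l), and [ocube] one of intervals (a, a + l). *)
Definition hcube c := gcube (fun=> true) (fun=> true) c.
Definition ocube c := gcube (fun=> false) (fun=> true) c.

Lemma ocube_sub b e c : ocube c `<=` gcube b e c.
Proof.
move=> x xQ i; move: (xQ i); rewrite !itv_boundlr /= !bnd_simp.
move=> /andP[h1 h2]; apply/andP; split.
  by case: (b i); rewrite bnd_simp//; exact: ltW.
by case: (e i); rewrite bnd_simp//; exact: ltW.
Qed.

Lemma is_cubeP Q : is_cube Q <-> exists b e c, 0 < c.2 /\ Q = gcube b e c.
Proof.
split=> [[a [l [b [e [l0 ->]]]]]|[b [e [[a l] [/= l0 ->]]]]].
  by exists b, e, (a, l).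
by exists a, l, b, e.
Qed.

End Cubes.

Lemma integral_setD_null d (T : measurableType d) (R : realType)
    (mu : {measure set T -> \bar R}) (A B : set T) (f : T -> \bar R) :
  measurable A -> measurable B -> B `<=` A -> mu (A `\` B) = 0%E ->
  measurable_fun A f -> (\int[mu]_(x in A) f x = \int[mu]_(x in B) f x)%E.
Proof.
move=> mA mB BA AB0 mf.
have mN : measurable (A `\` B) by exact: measurableD.
have BE : B = A `\` (A `\` B) by rewrite setDD; apply/esym/setIidr.
have H g : measurable_fun A g -> (forall x, 0 <= g x)%E ->
    (\int[mu]_(x in A) g x = \int[mu]_(x in B) g x)%E.
  move=> mg g0; rewrite [in RHS]BE; apply: ge0_negligible_integral => //.
rewrite integralE [RHS]integralE; congr (_ - _)%E; apply: H => //.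
  exact: measurable_funepos.
exact: measurable_funeneg.
Qed.

(** * Approximation of measurable sets by an algebra of sets *)

Section Approximation.
Context d (T : measurableType d) (R : realType) (mu : {measure set T -> \bar R}).
Variable G : set (set T).
Hypotheses (Gm : G `<=` measurable) (G0 : G set0).
Hypotheses (GC : forall A, G A -> G (~` A)).
Hypotheses (GU : forall A B, G A -> G B -> G (A `|` B)).
Hypothesis muT : (mu setT < +oo)%E.

Definition approximable (A : set T) := measurable A /\ forall e : R, 0 < e ->
  exists E, [/\ G E, (mu (A `\` E) < e%:E)%E & (mu (E `\` A) < e%:E)%E].

Lemma approximable_set A : G A -> approximable A.
Proof.
move=> GA; split; first exact: Gm.
by move=> e e0; exists A; rewrite setDv measure0 lte_fin.
Qed.

Lemma approximableC A : approximable A -> approximable (~` A).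
Proof.
move=> [mA aA]; split; first exact: measurableC.
move=> e /aA[E [GE AE EA]]; exists (~` E); split; first exact: GC.
- by rewrite setDE setCK setIC -setDE.
- by rewrite setDE setCK setIC -setDE.
Qed.

Lemma approximableU A B : approximable A -> approximable B -> approximable (A `|` B).
Proof.
move=> [mA aA] [mB aB]; split; first exact: measurableU.
move=> e e0; have e20 : 0 < e / 2 by rewrite divr_gt0.
have [E [GE AE EA]] := aA _ e20; have [F [GF BF FB]] := aB _ e20.
have mE := Gm GE; have mF := Gm GF.
exists (E `|` F); split; first exact: GU.
- rewrite (splitr e) EFinD.
  apply: (@le_lt_trans _ _ (mu (A `\` E) + mu (B `\` F))%E); last first.
    by apply: lteD.
  have h : (A `|` B) `\` (E `|` F) `<=` (A `\` E) `|` (B `\` F).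
    by move=> x [[Ax|Bx] /not_orP[nE nF]]; [left|right].
  apply: (@le_trans _ _ (mu ((A `\` E) `|` (B `\` F)))).
    by apply: le_measure => //; rewrite inE; do ?[exact: measurableD|exact: measurableU];
      [apply: measurableD; exact: measurableU|apply: measurableU; exact: measurableD].
  by apply: measureU2; exact: measurableD.
- rewrite (splitr e) EFinD.
  apply: (@le_lt_trans _ _ (mu (E `\` A) + mu (F `\` B))%E); last first.
    by apply: lteD.
  have h : (E `|` F) `\` (A `|` B) `<=` (E `\` A) `|` (F `\` B).
    by move=> x [[Ax|Bx] /not_orP[nE nF]]; [left|right].
  apply: (@le_trans _ _ (mu ((E `\` A) `|` (F `\` B)))).
    by apply: le_measure => //; rewrite inE;
      [apply: measurableD; exact: measurableU|apply: measurableU; exact: measurableD].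
  by apply: measureU2; exact: measurableD.
Qed.

(** By continuity from above, where the finite total measure enters, a finite union [S N] misses at
    most [e / 2] of the countable one; the other half of [e] pays for approximating [S N]. *)
Lemma approximable_bigcup (F : (set T)^nat) :
  (forall k, approximable (F k)) -> approximable (\bigcup_k F k).
Proof.
move=> aF; have mF k : measurable (F k) by have [] := aF k.
have mUF : measurable (\bigcup_k F k) by exact: bigcup_measurable.
split=> // e e0; have e20 : 0 < e / 2 by rewrite divr_gt0.
pose S k := \big[setU/set0]_(i < k) F i.
have aS k : approximable (S k).
  rewrite /S; elim: k => [|k IH]; first by rewrite big_ord0; exact: approximable_set.
  by rewrite big_ord_recr/=; exact: approximableU.
have mS k : measurable (S k) by have [] := aS k.
have cS : (mu \o (fun k => (\bigcup_i F i) `\` S k)) @ \oo --> mu set0.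
  have -> : set0 = \bigcap_k ((\bigcup_i F i) `\` S k).
    apply/seteqP; split=> // x H.
    have [[i _ Fix] _] := H 0%N I; have [_] := H i.+1 I; apply.
    by rewrite /S big_ord_recr/=; right.
  apply: nonincreasing_cvg_mu.
  - apply: le_lt_trans muT; apply: le_measure; rewrite ?inE//.
    exact: measurableD.
  - by move=> k; exact: measurableD.
  - by apply: bigcapT_measurable => k; exact: measurableD.
  - move=> i j ij; apply/subsetPset => x [Ux Sx]; split=> // Sx'; apply: Sx.
    move: Sx'; rewrite /S -!bigcup_mkord => -[k /= ki Fkx]; exists k => //=.
    exact: leq_trans ij.
rewrite measure0 in cS.
have [N HN] : exists N, (mu ((\bigcup_i F i) `\` S N) < (e / 2)%:E)%E.
  apply: contrapT => /forallNP H.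
  have /= : ((e / 2)%:E <= 0)%E.
    by apply: (cvge_to_ge cS); apply: nearW => k /=; rewrite leNgt; apply/negP/H.
  by rewrite lee_fin leNgt e20.
have [E [GE SE ES]] := (aS N).2 _ e20; have mE := Gm GE.
have SU : S N `<=` \bigcup_i F i.
  by move=> x; rewrite /S -bigcup_mkord => -[k _ Fkx]; exists k.
exists E; split=> //; last first.
  apply: (@le_lt_trans _ _ (mu (E `\` S N))).
    apply: le_measure; rewrite ?inE; [exact: measurableD|exact: measurableD|].
    exact: setDS.
  by apply: (lt_trans ES); rewrite lte_fin ltr_pdivrMr// ltr_pMr// ltr1n.
rewrite (splitr e) EFinD.
apply: (@le_lt_trans _ _ (mu (\bigcup_i F i `\` S N) + mu (S N `\` E))%E).
  apply: (@le_trans _ _ (mu ((\bigcup_i F i `\` S N) `|` (S N `\` E)))).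
    apply: le_measure; rewrite ?inE.
    - exact: measurableD.
    - by apply: measurableU; exact: measurableD.
    - by move=> x [Ux nEx]; have [Sx|nSx] := pselect (S N x); [right|left].
  by apply: measureU2; exact: measurableD.
by apply: lteD.
Qed.

Lemma approximable_sigma_algebra : sigma_algebra setT approximable.
Proof.
split.
- exact: approximable_set.
- by move=> A /approximableC; rewrite setTD.
- exact: approximable_bigcup.
Qed.

End Approximation.

(** * Dyadic cubes *)

Section Dyadic.
Context {R : realType} {n : nat}.
Local Notation dir := {ffun 'I_n -> bool}.
Implicit Types (c : 'rV[R]_n * R) (e : dir) (w : seq dir).

Lemma hcubeP c x :
  hcube c x <-> forall i, c.1 ord0 i <= x ord0 i < c.1 ord0 i + c.2.
Proof. by split=> H i; have := H i; rewrite ?in_itv. Qed.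

Definition child c e : 'rV[R]_n * R :=
  (c.1 + (c.2 / 2) *: \row_i (e i)%:R, c.2 / 2).

(** A dyadic subcube is addressed by the directions taken from the root, so that inclusion of dyadic
    cubes becomes the prefix order on words. *)
Definition node c w := foldl child c w.

Lemma node_cat c u v : node c (u ++ v) = node (node c u) v.
Proof. exact: foldl_cat. Qed.

Lemma node_rcons c u e : node c (rcons u e) = child (node c u) e.
Proof. by rewrite /node foldl_rcons. Qed.

Lemma node_side c w : (node c w).2 = c.2 / 2 ^+ size w.
Proof.
elim/last_ind: w => [|w e IH]; first by rewrite expr0 divr1.
by rewrite node_rcons /= IH size_rcons exprSr invfM mulrA.
Qed.

Lemma node_side_gt0 c w : 0 < c.2 -> 0 < (node c w).2.
Proof. by move=> c0; rewrite node_side divr_gt0// exprn_gt0. Qed.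

Lemma child_sub c e : 0 < c.2 -> hcube (child c e) `<=` hcube c.
Proof.
move=> c0 x /hcubeP H; apply/hcubeP => i; move: (H i); rewrite !mxE /=.
by case: (e i) => /=; rewrite ?mulr1 ?mulr0 => /andP[h1 h2]; apply/andP; split; lra.
Qed.

Lemma child_cover c x : hcube c x -> exists e, hcube (child c e) x.
Proof.
move=> /hcubeP H.
exists [ffun i => c.1 ord0 i + c.2 / 2 <= x ord0 i].
apply/hcubeP => i; move: (H i); rewrite !mxE ffunE /=.
by have [h|h] := leP (c.1 ord0 i + c.2 / 2) (x ord0 i); rewrite ?mulr1 ?mulr0
  => /andP[h1 h2]; apply/andP; split; lra.
Qed.

Lemma child_inj c e e' x : 0 < c.2 ->
  hcube (child c e) x -> hcube (child c e') x -> e = e'.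
Proof.
move=> c0 /hcubeP H /hcubeP H'; apply/ffunP => i.
move: (H i) (H' i); rewrite !mxE /=.
by case: (e i); case: (e' i) => //=; rewrite ?mulr1 ?mulr0 => /andP[h1 h2] /andP[h3 h4];
  exfalso; lra.
Qed.

Lemma node_sub c w : 0 < c.2 -> hcube (node c w) `<=` hcube c.
Proof.
move=> c0; elim/last_ind: w => // w e IH; rewrite node_rcons.
by apply: subset_trans IH; apply: child_sub; exact: node_side_gt0.
Qed.

Lemma node_sub_prefix c u v : 0 < c.2 -> hcube (node c (u ++ v)) `<=` hcube (node c u).
Proof. by move=> c0; rewrite node_cat; apply: node_sub; exact: node_side_gt0. Qed.

Lemma node_cover c k x : hcube c x -> exists w, size w = k /\ hcube (node c w) x.
Proof.
move=> cx; elim: k => [|k [w [sw wx]]]; first by exists [::].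
have [e ex] := child_cover wx; exists (rcons w e).
by rewrite size_rcons sw node_rcons.
Qed.

Lemma node_prefix c w w' x : 0 < c.2 -> (size w <= size w')%N ->
  hcube (node c w) x -> hcube (node c w') x -> prefix w w'.
Proof.
elim: w c w' => [|e w IH] c [|e' w']//= c0 sw wx wx'.
have ee' : e = e'.
  apply: (@child_inj c _ _ x) => //.
    by apply: (@node_sub _ w) => //=; rewrite divr_gt0.
  by apply: (@node_sub _ w') => //=; rewrite divr_gt0.
rewrite -ee' in wx' *; rewrite eqxx /=; apply: IH wx wx' => //=.
by rewrite divr_gt0.
Qed.

Lemma node_inj c w w' x : 0 < c.2 -> size w = size w' ->
  hcube (node c w) x -> hcube (node c w') x -> w = w'.
Proof.
move=> c0 sw wx wx'; have := node_prefix c0 (eq_leq sw) wx wx'.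
by rewrite prefixE sw take_size => /eqP.
Qed.

(** Inside [hcube c], such a set is a union of dyadic cubes of generation [k]. As a dichotomy, the
    condition is symmetric under complement and leaves the set free outside the cube. *)
Definition level c k (A : set 'rV[R]_n) := forall w, size w = k ->
  hcube (node c w) `<=` A \/ hcube (node c w) `<=` ~` A.

Lemma level_le c k k' A : 0 < c.2 -> (k <= k')%N -> level c k A -> level c k' A.
Proof.
move=> c0 kk' lA w sw; have := lA (take k w).
rewrite size_takel ?sw// => /(_ erefl).
have sub : hcube (node c w) `<=` hcube (node c (take k w)).
  by rewrite -{1}(cat_take_drop k w); exact: node_sub_prefix.
by move=> [H|H]; [left|right]; exact: subset_trans H.
Qed.

Lemma levelC c k A : level c k A -> level c k (~` A).
Proof. by move=> lA w /lA[H|H]; [right; rewrite setCK|left]. Qed.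

Lemma levelU c k A B : level c k A -> level c k B -> level c k (A `|` B).
Proof.
move=> lA lB w sw; have [HA|HA] := lA w sw; first by left => x /HA; left.
have [HB|HB] := lB w sw; first by left => x /HB; right.
by right => x wx [/(HA _ wx)|/(HB _ wx)].
Qed.

Lemma level_node c w : 0 < c.2 -> level c (size w) (hcube (node c w)).
Proof.
move=> c0 w' sw'; have [->|/eqP ww'] := eqVneq w' w; [by left|right => x w'x wx].
by apply: ww'; exact: node_inj w'x wx.
Qed.

Definition dyadic_set c (A : set (lebesgue_space R n)) :=
  measurable A /\ exists k, level c k A.

Lemma mcube c : measurable (hcube c : set (lebesgue_space R n)).
Proof. by apply: measurable_leb; exact: measurable_gcube. Qed.

Lemma mrestr_hcube_lty c : 0 < c.2 -> (mrestr (leb R n) (mcube c) setT < +oo)%E.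
Proof. by move=> c0; rewrite /mrestr setTI leb_gcube// ltry. Qed.

Lemma dyadic_sigma c : 0 < c.2 ->
  sigma_algebra setT (approximable (mrestr (leb R n) (mcube c)) (dyadic_set c)).
Proof.
move=> c0; apply: approximable_sigma_algebra.
- by move=> A [].
- by split; [exact: measurable0|exists 0%N => w _; right => x _].
- by move=> A [mA [k kA]]; split; [exact: measurableC|exists k; exact: levelC].
- move=> A B [mA [k kA]] [mB [l lB]]; split; first exact: measurableU.
  exists (maxn k l); apply: levelU; [apply: level_le kA|apply: level_le lB] => //.
    exact: leq_maxl.
  exact: leq_maxr.
- exact: mrestr_hcube_lty.
Qed.

Lemma small_node c (e : R) x : 0 < c.2 -> 0 < e -> hcube c x ->
  exists w, (node c w).2 < e /\ hcube (node c w) x.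
Proof.
move=> c0 e0 cx.
have [k Hk] : exists k, c.2 / e < 2 ^+ k.
  exists (Num.truncn (c.2 / e)).+1.
  apply: (@lt_le_trans _ _ (Num.truncn (c.2 / e)).+1%:R); first exact: truncnS_gt.
  by rewrite -natrX ler_nat ltnW// ltn_expl.
have [w [sw wx]] := node_cover k cx; exists w; split=> //.
by rewrite node_side sw ltr_pdivrMr ?exprn_gt0// mulrC -ltr_pdivrMr.
Qed.

(** The half-space is open, hence inside the cube it is the countable union of the dyadic cubes that
    it contains; [F] lists these by the codes of their words. *)
Lemma dyadic_halfspace c i (r : R) : 0 < c.2 ->
  approximable (mrestr (leb R n) (mcube c)) (dyadic_set c) [set x : 'rV[R]_n | x ord0 i < r].
Proof.
move=> c0; have [a0 aC aU] := dyadic_sigma c0.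
pose F k := if (unpickle k : option (seq dir)) is Some w then
  if `[< hcube (node c w) `<=` [set x : 'rV[R]_n | x ord0 i < r] >] then hcube (node c w) else set0
  else set0.
have aF k : approximable (mrestr (leb R n) (mcube c)) (dyadic_set c) (F k).
  rewrite /F; case: unpickle => [w|//]; case: ifPn => // _.
  apply: approximable_set; first by move=> A [].
  by split; [exact: mcube|exists (size w); exact: level_node].
have mH : measurable ([set x : 'rV[R]_n | x ord0 i < r] : set (lebesgue_space R n)).
  apply: measurable_leb.
  have -> : [set x : 'rV[R]_n | x ord0 i < r] = setT `&` (fun x => x ord0 i) @^-1` `]-oo, r[.
    by rewrite setTI; apply/seteqP; split=> x /=; rewrite in_itv.
  exact: (@measurable_coord R n i measurableT _ (measurable_itv `]-oo, r[)).
have mc := mcube c.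
split=> // e e0; have [_ /(_ e e0)[E [GE h1 h2]]] := aU _ aF.
have sub : \bigcup_k F k `<=` [set x : 'rV[R]_n | x ord0 i < r].
  move=> x [k _]; rewrite /F; case: unpickle => // w.
  by case: ifPn => // /asboolP; exact.
have sup : [set x : 'rV[R]_n | x ord0 i < r] `&` hcube c `<=` \bigcup_k F k.
  move=> x [xr cx]; have rx : 0 < r - x ord0 i by rewrite subr_gt0.
  have [w [sw wx]] := small_node c0 rx cx.
  exists (pickle w) => //; rewrite /F pickleK ifT//; apply/asboolP => y wy /=.
  move/hcubeP : wx => /(_ i)/andP[wx1 wx2]; move/hcubeP : wy => /(_ i)/andP[wy1 wy2].
  apply: (lt_le_trans wy2); rewrite -lerBrDl.
  by rewrite (le_trans (ltW sw))// lerB.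
have mE : measurable E by case: GE.
exists E; split=> //.
  apply: le_lt_trans h1; rewrite /mrestr; apply: le_leb => x [[xr nE] cx].
  by split=> //; split=> //; exact: sup.
apply: le_lt_trans h2; rewrite /mrestr; apply: le_leb => x [[Ex xr] cx].
by split=> //; split=> //; move/sub.
Qed.

(** The approximable sets form a sigma-algebra that contains the coordinate half-spaces, so the
    identity from it to the Borel space is measurable. *)
Lemma borel_approximable c (A : set 'rV[R]_n) : 0 < c.2 -> measurable A ->
  approximable (mrestr (leb R n) (mcube c)) (dyadic_set c) A.
Proof.
move=> c0 mA; set S := approximable _ _.
have sS := dyadic_sigma c0.
have mid : measurable_fun setT (idfun : g_sigma_algebraType S -> 'rV[R]_n).
  apply: measurable_rVP => i.
  apply: (measurability _ (RGenInftyO.measurableE R)) => //= _ [_ [r ->]] <-.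
  rewrite setTI; apply: sub_sigma_algebra.
  have -> : (fun x : 'rV[R]_n => x ord0 i) @^-1` `]-oo, r[ = [set x : 'rV[R]_n | x ord0 i < r].
    by apply/seteqP; split=> x /=; rewrite in_itv.
  exact: dyadic_halfspace.
by have := mid measurableT _ mA; rewrite setTI /measurable /= sigma_algebra_id.
Qed.

End Dyadic.

(** * Differentiation of integrals along dyadic cubes *)

Section DyadicDomination.
Context {R : realType} {n : nat}.
Local Notation L := (lebesgue_space R n).
Local Notation mu := (leb R n).
Local Notation dir := {ffun 'I_n -> bool}.
Implicit Types (c : 'rV[R]_n * R) (w : seq dir).

Lemma borel_cover (A : set 'rV[R]_n) (e : R) : (mu A < +oo)%E -> 0 < e ->
  exists B : set 'rV[R]_n, [/\ measurable B, A `<=` B & (mu B < mu A + e%:E)%E].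
Proof.
move=> Aoo e0.
have Afin : mu A \is a fin_num by rewrite ge0_fin_numE//; exact: mu_ext_ge0.
have [_ [F [mF AF] <-] FA] := lb_ereal_inf_adherent e0 Afin.
have mUF : measurable (\bigcup_k F k) by exact: bigcup_measurable.
exists (\bigcup_k F k); split=> //; apply: le_lt_trans FA.
by rewrite lebE//; apply: measure_sigma_subadditive.
Qed.

Lemma ge0_integral_children c (A : set L) (f : L -> \bar R) : 0 < c.2 ->
  measurable A -> measurable_fun setT f -> (forall x, 0 <= f x)%E ->
  (\int[mu]_(x in A `&` hcube c) f x =
   \sum_(e : dir) \int[mu]_(x in A `&` hcube (child c e)) f x)%E.
Proof.
move=> c0 mA mf f0.
have -> : A `&` hcube c = \big[setU/set0]_(e : dir) (A `&` hcube (child c e)).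
  rewrite -bigcup_seq; apply/seteqP; split=> x.
    by move=> [Ax /child_cover[e ex]]; exists e => //=; rewrite mem_index_enum.
  by move=> [e _ [Ax ex]]; split=> //; exact: child_sub ex.
rewrite ge0_integral_bigsetU//.
- by move=> e; apply: measurableI => //; exact: mcube.
- exact: index_enum_uniq.
- move=> e e' _ _ [x [[_ ex] [_ ex']]]; exact: child_inj ex ex'.
- exact: (measurable_funS measurableT).
Qed.

Section domination.
Variables (h : L -> R) (lam : R).
Hypotheses (mh : measurable_fun setT h) (h0 : forall x, 0 <= h x) (lam0 : 0 <= lam).

Let mEh : measurable_fun setT (EFin \o h).
Proof. exact/measurable_EFinP. Qed.

Let hE0 x : (0 <= (h x)%:E)%E.
Proof. by rewrite lee_fin. Qed.

Lemma level_domination c k (A : set L) : 0 < c.2 ->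
  (forall w, \int[mu]_(x in hcube (node c w)) (h x)%:E
             <= \int[mu]_(x in hcube (node c w)) lam%:E)%E ->
  measurable A -> level c k A ->
  (\int[mu]_(x in A `&` hcube c) (h x)%:E <= \int[mu]_(x in A `&` hcube c) lam%:E)%E.
Proof.
move=> + + mA; elim: k c => [|k IH] c c0 hc lA.
  have [cA|cA] := lA [::] erefl.
    by rewrite setIC setIidl//; exact: hc [::].
  by rewrite setIC (_ : _ `&` _ = set0) ?integral_set0// -subset0 => x [/cA].
rewrite !ge0_integral_children//; apply: lee_sum => e _; apply: IH.
- by rewrite /= divr_gt0.
- by move=> w; exact: (hc (e :: w)).
- by move=> w sw; apply: (lA (e :: w)); rewrite /= sw.
Qed.

(** The bound passes by summation to sets made of dyadic cubes of one generation. A measurable set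
    is close to such a set, and the discrepancy is controlled by absolute continuity of the integral
    of [h]. *)
Lemma dyadic_domination c (A : set L) : 0 < c.2 ->
  (forall w, \int[mu]_(x in hcube (node c w)) (h x)%:E
             <= \int[mu]_(x in hcube (node c w)) lam%:E)%E ->
  measurable A -> A `<=` hcube c ->
  (\int[mu]_(x in A) (h x)%:E <= \int[mu]_(x in A) lam%:E)%E.
Proof.
move=> c0 hc mA Ac; have mc := @mcube R n c.
have cE : mu (hcube c) = (c.2 ^+ n)%:E by exact: leb_gcube.
pose g := h \_ (hcube c).
have ihc : mu.-integrable (hcube c) (EFin \o h).
  apply/integrableP; split; first exact: (measurable_funS measurableT).
  under eq_integral do rewrite /= ger0_norm//.
  by apply: (le_lt_trans (hc [::])); rewrite integral_cst//= cE ltry.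
have ig : mu.-integrable setT (EFin \o g).
  by rewrite -restrict_EFin; apply: (proj1 (integrable_mkcond _ mc)).
have gh x : hcube c x -> `|g x| = h x.
  by move=> cx; rewrite /g patchE mem_set// ger0_norm.
apply/lee_addgt0Pr => e e0.
(* Two measure errors, each weighted by [lam], and one integral error add up to
   [e' * (lam *+ 2 + 1)]. *)
pose e' := e / (lam *+ 2 + 1).
have l20 : 0 < lam *+ 2 + 1 by rewrite ltr_wpDl// mulrn_wge0.
have e'0 : 0 < e' by rewrite divr_gt0.
have [d [d0 Hd]] := integral_normr_continuous ig e'0.
pose dd := Num.min d e'.
have dd0 : 0 < dd by rewrite lt_min d0 e'0.
have Aoo : (mu A < +oo)%E.
  by apply: (@le_lt_trans _ _ (mu (hcube c))); [exact: le_leb|rewrite cE ltry].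
have Afin : mu A \is a fin_num by rewrite ge0_fin_numE.
(* [A] is only Lebesgue measurable, while dyadic approximation is available for Borel sets; hence
   the detour through a Borel cover [B]. *)
have [B [mB AB BA]] := borel_cover Aoo dd0.
have [_ /(_ _ dd0)[E [[mE [k kE]] BE EB]]] := borel_approximable c0 mB.
have mB' := measurable_leb mB.
have mEc : measurable (E `&` hcube c) by exact: measurableI.
have sub : A `<=` (E `&` hcube c) `|` (A `\` E).
  move=> x Ax; have [Ex|nEx] := pselect (E x); last by right.
  by left; split=> //; exact: Ac.
have mAE : measurable (A `\` E) by exact: measurableD.
have IAE : (\int[mu]_(x in A `\` E) (h x)%:E <= e'%:E)%E.
  have lt : (mu (A `\` E) < d%:E)%E.
    apply: (@le_lt_trans _ _ (mu ((B `\` E) `&` hcube c))).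
      apply: le_leb => x [Ax Ex]; split; last exact: Ac.
      by split=> //; exact: AB.
    by apply: (lt_le_trans BE); rewrite lee_fin ge_min lexx.
  have iAE : mu.-integrable (A `\` E) (EFin \o g) by exact: (integrableS measurableT).
  have := Hd _ mAE lt; rewrite -lte_fin /Rintegral fineK; last first.
    by apply: integrable_fin_num => //; exact: (integrable_norm iAE).
  move=> /ltW; apply: le_trans; apply: ge0_le_integral.
  - exact: mAE.
  - by move=> x _; exact: hE0.
  - exact: measurable_funTS.
  - by have /measurable_int := integrable_norm iAE.
  - by move=> x [Ax _]; rewrite lee_fin gh//; exact: Ac.
have mEcle : (mu (E `&` hcube c) <= mu A + (e' *+ 2)%:E)%E.
  apply: (@le_trans _ _ (mu B + mu ((E `\` B) `&` hcube c))%E).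
    have mEB : measurable ((E `\` B) `&` hcube c).
      by apply: measurableI => //; exact: measurableD.
    apply: le_trans (measureU2 _ mB' mEB); apply: le_leb => x [Ex cx].
    by have [Bx|nBx] := pselect (B x); [left|right].
  rewrite mulr2n EFinD addeA; apply: leeD.
    apply: (le_trans (ltW BA)); apply: leeD2l.
    by rewrite lee_fin ge_min lexx orbT.
  by apply: (le_trans (ltW EB)); rewrite lee_fin ge_min lexx orbT.
apply: (@le_trans _ _ (\int[mu]_(x in (E `&` hcube c) `|` (A `\` E)) (h x)%:E)%E).
  apply: ge0_subset_integral sub.
  - exact: mA.
  - exact: measurableU.
  - exact: measurable_funTS.
  - by move=> x _; exact: hE0.
rewrite ge0_integral_setU; first last.
- by rewrite disj_set2E; apply/eqP/seteqP; split=> x // [[Ex _] [_]].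
- by move=> x _; exact: hE0.
- exact: measurable_funTS.
- exact: mAE.
- exact: mEc.
apply: (@le_trans _ _ (\int[mu]_(x in E `&` hcube c) lam%:E + e'%:E)%E).
  by apply: leeD => //; exact: level_domination kE.
rewrite !integral_cst//.
apply: (@le_trans _ _ (lam%:E * (mu A + (e' *+ 2)%:E) + e'%:E)%E).
  by apply: leeD2r; exact: lee_wpmul2l.
rewrite -(fineK Afin) -EFinD -EFinM -EFinD lee_fin.
have -> : e = e' * (lam *+ 2 + 1) :> R by rewrite /e' divfK// gt_eqF.
by rewrite (_ : _ + e' = lam * fine (mu A) + e' * (lam *+ 2 + 1))//; ring.
Qed.

(** Domination on the exceptional set itself shows that the integral of [h - lam] over it is at most
    0. As the integrand is positive there, the set is null. *)
Lemma dyadic_differentiation c : 0 < c.2 ->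
  (forall w, \int[mu]_(x in hcube (node c w)) (h x)%:E
             <= \int[mu]_(x in hcube (node c w)) lam%:E)%E ->
  mu [set x | hcube c x /\ lam < h x] = 0%E.
Proof.
move=> c0 hc; pose N : set L := [set x | hcube c x /\ lam < h x].
rewrite -[X in mu X]/N.
have mc := @mcube R n c.
have mN : measurable (N : set L).
  have -> : N = hcube c `&` (setT `&` h @^-1` `]lam, +oo[).
    rewrite setTI; apply/seteqP; split=> x [cx hx]; split=> //; move: hx.
      by rewrite /= in_itv/= andbT.
    by rewrite /= in_itv/= andbT.
  by apply: measurableI => //; exact: (mh measurableT (measurable_itv _)).
have Nc : N `<=` hcube c by move=> x [].
have muNoo : (mu N < +oo)%E.
  by apply: (@le_lt_trans _ _ (mu (hcube c))); [exact: le_leb|rewrite leb_gcube// ltry].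
have mg : measurable_fun N (fun x => (h x - lam)%:E).
  apply: measurable_funTS; apply/measurable_EFinP.
  exact: (measurable_funB mh (measurable_cst lam)).
have g0 x : N x -> 0 <= h x - lam by move=> [_ /ltW]; rewrite subr_ge0.
have H : (\int[mu]_(x in N) (h x - lam)%:E = 0)%E.
  apply/eqP; rewrite eq_le; apply/andP; split; last first.
    by apply: integral_ge0 => x /g0; rewrite lee_fin.
  have cfin : (\int[mu]_(x in N) lam%:E)%E \is a fin_num.
    by rewrite integral_cst// fin_numM// ge0_fin_numE.
  have := dyadic_domination c0 hc mN Nc.
  have -> : (\int[mu]_(x in N) (h x)%:E =
      \int[mu]_(x in N) (h x - lam)%:E + \int[mu]_(x in N) lam%:E)%E.
    by rewrite -ge0_integralD//; apply: eq_integral => x _; rewrite -EFinD subrK.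
  by rewrite -leeBrDr// subee.
have /(ae_eq_integral_abs mu mN mg)[Z [mZ Z0 NZ]] :
    (\int[mu]_(x in N) `|(h x - lam)%:E| = 0)%E.
  by rewrite -H; apply: eq_integral => x /[!inE] /g0 ?; rewrite gee0_abs ?lee_fin.
apply/eqP; rewrite eq_le measure_ge0 andbT -Z0; apply: le_leb => x Nx; apply: NZ => /=.
move=> /(_ Nx) [] /eqP; rewrite subr_eq0 => /eqP hl.
by case: Nx => _; rewrite hl ltxx.
Qed.

End domination.
End DyadicDomination.

(** * Calderon-Zygmund stopping cubes *)

Section CalderonZygmund.
Context {R : realType} {n : nat}.
Local Notation L := (lebesgue_space R n).
Local Notation mu := (leb R n).
Local Notation dir := {ffun 'I_n -> bool}.
Implicit Types (c : 'rV[R]_n * R) (w : seq dir).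

Lemma integral_cst_hcube c (r : R) : 0 < c.2 ->
  (\int[mu]_(x in hcube c) r%:E = (r * c.2 ^+ n)%:E)%E.
Proof.
by move=> c0; rewrite integral_cst ?leb_gcube//; exact: mcube.
Qed.

Lemma sum_integral_hcube_le (S : pred nat) (d : nat -> 'rV[R]_n * R) c (f : L -> \bar R) N :
  (forall k, S k -> hcube (d k) `<=` hcube c) -> trivIset [set k | S k] (hcube \o d) ->
  measurable_fun setT f -> (forall x, 0 <= f x)%E ->
  (\sum_(0 <= k < N | S k) \int[mu]_(x in hcube (d k)) f x <=
   \int[mu]_(x in hcube c) f x)%E.
Proof.
move=> dc td mf f0; rewrite -big_filter.
set s := [seq k <- _ | _].
have sS k : k \in s -> S k by rewrite mem_filter => /andP[].
rewrite -(@ge0_integral_bigsetU _ _ _ mu _ (hcube \o d)).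
- apply: ge0_subset_integral => //; try exact: mcube.
  + by apply: bigsetU_measurable => k _; exact: mcube.
  + exact: (measurable_funS measurableT).
  + by rewrite -bigcup_seq => x [k /= /sS Sk]; exact: dc.
- by move=> k; exact: mcube.
- by rewrite filter_uniq// iota_uniq.
- by apply: sub_trivIset td => k; exact: sS.
- exact: (measurable_funS measurableT).
- by [].
Qed.

(* The selected cubes are the maximal dyadic subcubes on which the mean of [h]
   exceeds [lam]. *)
Lemma calderon_zygmund c (h : L -> R) (lam : R) : 0 < c.2 -> 0 <= lam ->
  measurable_fun setT h -> (forall x, 0 <= h x) ->
  (\int[mu]_(x in hcube c) (h x)%:E <= (lam * c.2 ^+ n)%:E)%E ->
  exists (S : pred nat) (d : nat -> 'rV[R]_n * R),
    [/\ forall k, S k -> 0 < (d k).2 /\ hcube (d k) `<=` hcube c,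
        trivIset [set k | S k] (hcube \o d),
        forall k, S k -> ((lam * (d k).2 ^+ n)%:E < \int[mu]_(x in hcube (d k)) (h x)%:E)%E,
        forall k, S k ->
          (\int[mu]_(x in hcube (d k)) (h x)%:E <= (2 ^+ n * (lam * (d k).2 ^+ n))%:E)%E &
        mu [set x | [/\ hcube c x, forall k, S k -> ~ hcube (d k) x & lam < h x]] = 0%E].
Proof.
move=> c0 lam0 mh h0 hc.
have mEh : measurable_fun setT (EFin \o h) by exact/measurable_EFinP.
have hE0 x : (0 <= (h x)%:E)%E by rewrite lee_fin.
pose I w : \bar R := (\int[mu]_(x in hcube (node c w)) (h x)%:E)%E.
pose v w : R := lam * (node c w).2 ^+ n.
pose bad w := ((v w)%:E < I w)%E.
(* Prefixes are dyadic ancestors, so this is maximality among the bad cubes. *)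
pose sel w := bad w /\ forall u, prefix u w -> bad u -> u = w.
have first_bad w : bad w -> exists2 u, prefix u w & sel u.
  have [m] := ubnP (size w); elim: m w => // m IH w sw bw.
  have [selw|/not_andP[//|]] := pselect (sel w); first by exists w => //; exact: prefix_refl.
  move=> /existsNP[u] /not_implyP[uw] /not_implyP[bu uNw].
  have su : (size u < m)%N.
    have [v' wE] := prefixP uw; rewrite wE size_cat in sw uNw.
    case: v' wE sw uNw => [|e v'] wE sw uNw; first by rewrite cats0 in uNw.
    by move: sw; rewrite /= addnS ltnS; apply: leq_ltn_trans; exact: leq_addr.
  have [u' u'u selu'] := IH u su bu; exists u' => //; exact: prefix_trans uw.
(* [pickle_inv], unlike [unpickle], accepts only genuine codes: each word has a single index in [S],
   as disjointness of the family requires. Outside [S] the cube [d k] is a dummy. *)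
pose S k := if @pickle_inv (seq dir) k is Some w then `[< sel w >] else false.
pose d k := node c (odflt [::] (@pickle_inv (seq dir) k)).
have SP k : S k -> exists w, [/\ k = pickle w, d k = node c w & sel w].
  rewrite /S /d; case E: pickle_inv => [w|//] /asboolP ?; exists w; split=> //.
  by have := @pickle_invK (seq dir) k; rewrite E.
have sel_inj w w' x : sel w -> sel w' -> hcube (node c w) x -> hcube (node c w') x -> w = w'.
  wlog sww' : w w' / (size w <= size w')%N.
    move=> H sw sw' wx w'x; case/orP: (leq_total (size w) (size w')) => ?.
      exact: H.
    by apply/esym; exact: H.
  move=> [bw _] [_ sw'] wx w'x; apply: sw' => //; exact: node_prefix wx w'x.
exists S, d; split.
- by move=> k /SP[w [_ -> _]]; split; [exact: node_side_gt0|exact: node_sub].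
- move=> k k' /= /SP[w [wk dw sw]] /SP[w' [wk' dw' sw']] [x []]; rewrite /= dw dw' => wx w'x.
  have ww' := sel_inj _ _ _ sw sw' wx w'x.
  by rewrite wk wk' ww'.
- by move=> k /SP[w [_ -> []]].
- move=> k /SP[w [_ -> [bw sw]]].
  (* The root is not bad by hypothesis, so a selected cube has a parent. The parent is not bad by
     maximality, and its volume is [2 ^+ n] times larger. *)
  case/lastP: w bw sw => [|w e] bw sw; first by move: bw; rewrite /bad /I /= ltNge hc.
  have nbw : (I w <= (v w)%:E)%E.
    rewrite leNgt; apply/negP => bw'.
    have := sw w (prefix_rcons _ _) bw'; move/(congr1 size); rewrite size_rcons => /eqP.
    by rewrite ltn_eqF.
  have -> : 2 ^+ n * (lam * (node c (rcons w e)).2 ^+ n) = v w.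
    rewrite /v node_rcons /= mulrCA -exprMn.
    by rewrite (_ : 2 * ((node c w).2 / 2) = (node c w).2)//; field.
  apply: le_trans nbw; rewrite /I; apply: (ge0_subset_integral mu (mcube _) (mcube _)).
  - exact: (measurable_funS measurableT).
  - by move=> x _.
  - by rewrite node_rcons; apply: child_sub; exact: node_side_gt0.
- pose G := \bigcup_(k in [set k | S k]) hcube (d k).
  have mG : measurable (G : set L) by apply: bigcup_measurable => k _; exact: mcube.
  (* After [h] is cut to 0 on the selected cubes, every dyadic mean is at most [lam]: a cube that
     was bad lies inside a selected one, where [h'] vanishes. *)
  pose h' : L -> R := fun x => h x * \1_(~` G) x.
  have mh' : measurable_fun setT h'.
    by apply: (measurable_funM mh); apply: measurable_indic; exact: measurableC.
  have h'0 x : 0 <= h' x by rewrite mulr_ge0.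
  have h'E0 x : (0 <= (h' x)%:E)%E by rewrite lee_fin.
  have h'h x : h' x <= h x by rewrite ler_piMr// indicE; case: (_ \in _).
  have mEh' : measurable_fun setT (EFin \o h') by exact/measurable_EFinP.
  have G0 x : G x -> h' x = 0 by move=> Gx; rewrite /h' indicE memNset ?mulr0//=; apply.
  suff : mu [set x | hcube c x /\ lam < h' x] = 0%E.
    move=> H; apply/eqP; rewrite eq_le; apply/andP; split; last exact: mu_ext_ge0.
    rewrite -H; apply: le_leb => x [cx nS hx].
    by split=> //; rewrite /h' indicE mem_set ?mulr1// => -[k Sk /(nS _ Sk)].
  apply: (@dyadic_differentiation R n h' lam mh' h'0 lam0 c c0) => w.
  have c0' := node_side_gt0 w c0.
  rewrite integral_cst_hcube//.
  have [bw|nbw] := pselect (bad w); last first.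
    apply: (@le_trans _ _ (I w)); last by rewrite leNgt; exact/negP.
    apply: ge0_le_integral.
    - exact: mcube.
    - by move=> x _.
    - exact: (measurable_funS measurableT).
    - exact: (measurable_funS measurableT).
    - by move=> x _; rewrite lee_fin.
  have [u /prefixP[v' wE] selu] := first_bad _ bw.
  rewrite (eq_integral (cst 0%E)) ?integral0.
    by rewrite lee_fin mulr_ge0// exprn_ge0// ltW.
  move=> x; rewrite inE wE => /(node_sub_prefix c0) ux; rewrite G0//.
  exists (pickle u); rewrite /S /d /= pickleK_inv //=; exact/asboolP.
Qed.

End CalderonZygmund.

(** * Polynomials and their means on cubes *)

Section LagrangeBound.
Context {R : realType}.
Implicit Types p : {poly R}.

Lemma lagrange_interpolation (s : nat) (t : 'I_s.+1 -> R) p :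
  injective t -> (size p <= s.+1)%N ->
  p = \sum_i p.[t i] *: \prod_(j | j != i) ((t i - t j)^-1 *: ('X - (t j)%:P)).
Proof.
move=> tinj sp; apply/eqP; rewrite -subr_eq0; set q := _ - _.
have szq : (size q <= s.+1)%N.
  apply: (leq_trans (size_polyD _ _)); rewrite geq_max sp size_polyN.
  apply: (leq_trans (size_sum _ _ _)); apply/bigmax_leqP => i _.
  apply: (leq_trans (size_scale_leq _ _)); apply: (leq_trans (size_poly_prod_leq _ _)).
  rewrite leq_subLR addnS ltnS; apply: (@leq_trans (\sum_(j < s.+1 | j != i) 2)).
    apply: leq_sum => j _; apply: (leq_trans (size_scale_leq _ _)).
    by rewrite size_XsubC.
  rewrite sum_nat_const; have := cardC1 i; rewrite card_ord.
  have -> : #|predC1 i| = #|[pred j | j != i]| by apply: eq_card.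
  move=> ->; lia.
apply/negPn/negP => q0.
suff rts : all (root q) (map t (enum 'I_s.+1)).
  have := max_poly_roots q0 rts; rewrite map_inj_uniq// enum_uniq size_map size_enum_ord.
  by move=> /(_ isT); rewrite ltnNge szq.
apply/allP => _ /mapP[i _ ->]; rewrite /root /q hornerD hornerN horner_sum.
rewrite (bigD1 i)//= hornerZ horner_prod big1 ?mulr1; last first.
  move=> j ji; rewrite hornerZ hornerXsubC mulVf// subr_eq0.
  by apply: contraNneq ji => /tinj ->.
rewrite big1 ?addr0 ?subrr// => j ji; rewrite hornerZ horner_prod.
rewrite (bigD1 i) 1?eq_sym//= hornerZ hornerXsubC subrr mulr0 mul0r mulr0.
by [].
Qed.

(** Each Lagrange basis polynomial is a product of [s] factors, and each of these is at most
    [l / delta] in absolute value. *)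
Lemma lagrange_bound (s : nat) (t : 'I_s.+1 -> R) p x (delta l : R) :
  (size p <= s.+1)%N -> 0 < delta ->
  (forall i j, i != j -> delta <= `|t i - t j|) -> (forall i, `|x - t i| <= l) ->
  `|p.[x]| <= (l / delta) ^+ s * \sum_i `|p.[t i]|.
Proof.
move=> sp d0 td xt.
have tinj : injective t.
  move=> i j tij; apply/eqP; apply/negPn/negP => /td.
  by rewrite tij subrr normr0 leNgt d0.
rewrite {1}(lagrange_interpolation tinj sp) horner_sum.
apply: (le_trans (ler_norm_sum _ _ _)); rewrite mulr_sumr; apply: ler_sum => i _.
rewrite hornerZ normrM mulrC ler_wpM2r// horner_prod normr_prod.
have -> : (l / delta) ^+ s = \prod_(j < s.+1 | j != i) (l / delta).
  rewrite prodr_const; congr (_ ^+ _).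
  by rewrite (@eq_card _ _ (predC1 i))// cardC1 card_ord.
apply: ler_prod => j ji; rewrite normr_ge0/= hornerZ hornerXsubC normrM normfV mulrC.
have tij : delta <= `|t i - t j| by apply: td; rewrite eq_sym.
apply: ler_pM => //.
by rewrite lef_pV2// posrE// (lt_le_trans d0).
Qed.

(** The interval is cut into [2 * s.+1] equal pieces, and a node is chosen in every second piece at
    which the polynomial is not much larger than its mean there. The skipped pieces keep the nodes
    [l / N] apart, and interpolation bounds the polynomial everywhere. *)
Lemma poly_mean_bound (s : nat) : exists2 C : R, 0 < C &
  forall p (a l : R), (size p <= s.+1)%N -> 0 < l ->
  forall x, a <= x < a + l ->
  ((`|p.[x]| * l)%:E <=
   C%:E * \int[lebesgue_measure]_(t in `[a, (a + l)%R[%classic) (`|p.[t]|)%:E)%E.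
Proof.
pose N : R := (2 * s.+1)%:R.
have N0 : 0 < N by rewrite ltr0n.
(* [N ^+ s] bounds a basis polynomial, [s.+1] counts the nodes, and the last [N] comes from the
   length [l / N] of a piece. *)
exists (N ^+ s * s.+1%:R * N); first by rewrite !mulr_gt0// ?exprn_gt0// ltr0n.
move=> p a l sp l0 x /andP[ax xl].
set I := (\int[_]_(t in _) _)%E.
have mp : measurable_fun setT (fun t : R => `|p.[t]|%:E).
  apply/measurable_EFinP; apply: measurableT_comp => //.
  apply: continuous_measurable_fun => t; exact: continuous_horner.
have I0 : (0 <= I)%E by apply: integral_ge0 => t _; rewrite lee_fin.
have [Ifin|] := boolP (I \is a fin_num); last first.
  rewrite ge0_fin_numE// -leNgt leye_eq => /eqP ->.
  by rewrite gt0_muley ?leey// lte_fin !mulr_gt0// ?exprn_gt0// ltr0n.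
set r := fine I; have Ir : I = r%:E by rewrite fineK.
apply/lee_addgt0Pr => e e0.
pose e' : R := e / (N ^+ s * s.+1%:R * N).
have e'0 : 0 < e' by rewrite divr_gt0// !mulr_gt0// ?exprn_gt0// ltr0n.
pose J (i : 'I_s.+1) := `[a + (2 * i)%:R * (l / N), a + (2 * i).+1%:R * (l / N)[%classic.
have lN : 0 < l / N by rewrite divr_gt0.
have Jsub i : J i `<=` `[a, (a + l)[%classic.
  move=> t; rewrite /J /= !in_itv /= => /andP[h1 h2]; apply/andP; split.
    by apply: le_trans h1; rewrite lerDl mulr_ge0// ltW.
  apply: (lt_le_trans h2); rewrite lerD2l mulrCA ger_pMr// ler_pdivrMr// mul1r ler_nat.
  by rewrite ltn_pmul2l.
have Jmu i : lebesgue_measure (J i) = (l / N)%:E.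
  rewrite /J lebesgue_measure_itv /= lte_fin ltrD2l ltr_pM2r// ltr_nat ltnSn.
  by rewrite -EFinD; congr (_%:E); rewrite -(natr1 (2 * i)%N); ring.
(* The slack [e'] makes the contradiction strict: otherwise the integral over the piece alone would
   be at least [r + e']. *)
have ex_pt i : exists t, J i t /\ `|p.[t]| * (l / N) <= r + e'.
  apply: contrapT => /forallNP H.
  have H' t : J i t -> (r + e') / (l / N) <= `|p.[t]|.
    move=> Jt; rewrite ler_pdivrMr// leNgt; apply/negP => /ltW h; exact: (H t).
  have : (\int[lebesgue_measure]_(t in J i) ((r + e') / (l / N))%:E <= I)%E.
    apply: (@le_trans _ _ (\int[lebesgue_measure]_(t in J i) (`|p.[t]|)%:E)%E).
      apply: ge0_le_integral => //.
      - exact: measurable_itv.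
      - by move=> t _; rewrite lee_fin divr_ge0// ?addr_ge0// ?fine_ge0// ltW.
      - exact: (measurable_funS measurableT).
    apply: ge0_subset_integral => //; try exact: measurable_itv.
    exact: (measurable_funS measurableT).
  rewrite integral_cst; last exact: measurable_itv.
  by rewrite [X in (_ * X)%E](Jmu i) -EFinM Ir lee_fin divfK ?gt_eqF// gerDl leNgt e'0.
have [t tP] := choice ex_pt.
have td i j : i != j -> l / N <= `|t i - t j|.
  wlog ij : i j / (i < j)%N.
    move=> H ij; case/orP: (leq_total i j) => le.
      by apply: H => //; rewrite ltn_neqAle le andbT.
    rewrite eq_sym in ij; rewrite distrC; apply: H => //.
    by rewrite ltn_neqAle le andbT.
  move=> _; have [+ _] := tP i; have [+ _] := tP j; rewrite /J /= !in_itv/=.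
  move=> /andP[h1 h2] /andP[h3 h4]; rewrite distrC; apply: le_trans (ler_norm _).
  have : (2 * i).+2%:R * (l / N) <= (2 * j)%:R * (l / N).
    by apply: (ler_wpM2r (ltW lN)); rewrite ler_nat -[_.+2]/(2 + 2 * i)%N -mulnS leq_pmul2l.
  have aux (A C D u v : R) : a + C <= u -> v < a + A -> A + D <= C -> D <= u - v by lra.
  by rewrite -natr1 mulrDl mul1r; exact: aux h1 h4.
have xt i : `|x - t i| <= l.
  have [/Jsub + _] := tP i; rewrite /= in_itv/= => /andP[h1 h2].
  by rewrite ler_norml; apply/andP; split; lra.
have := lagrange_bound sp lN td xt.
have -> : l / (l / N) = N by field; rewrite !gt_eqF.
move=> pb; rewrite Ir -EFinM -EFinD lee_fin.
have : \sum_i `|p.[t i]| <= s.+1%:R * ((r + e') * (N / l)).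
  apply: (@le_trans _ _ (\sum_(i < s.+1) ((r + e') * (N / l)))).
    apply: ler_sum => i _; have [_ ] := tP i.
    by rewrite -ler_pdivlMr// invf_div.
  by rewrite sumr_const card_ord mulr_natl.
move=> ps; have : `|p.[x]| * l <= N ^+ s * (s.+1%:R * ((r + e') * (N / l))) * l.
  rewrite ler_pM2r//; apply: (le_trans pb); rewrite ler_pM2l// exprn_gt0//.
move/le_trans; apply; rewrite le_eqVlt; apply/orP; left; apply/eqP.
have -> : e = e' * (N ^+ s * s.+1%:R * N) :> R.
  by rewrite /e' divfK// gt_eqF// !mulr_gt0// ?exprn_gt0// ltr0n.
by field; rewrite gt_eqF.
Qed.

End LagrangeBound.

(** * Means of polynomials in several variables *)

Section PolynomialMean.
Context {R : realType}.

Definition ctail n (c : 'rV[R]_n.+1 * R) : 'rV[R]_n * R :=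
  (\row_j c.1 ord0 (lift ord0 j), c.2).

Lemma hcube_cons n (c : 'rV[R]_n.+1 * R) (t : R) (v : 'rV[R]_n) :
  hcube c (rV_cons (t, v)) <->
  c.1 ord0 ord0 <= t < c.1 ord0 ord0 + c.2 /\ hcube (ctail c) v.
Proof.
rewrite !hcubeP; split=> [H|[H1 H2] i].
  split=> [|i]; first by have := H ord0; rewrite mxE unlift_none.
  by have := H (lift ord0 i); rewrite !mxE liftK.
rewrite mxE; case: unliftP => [j|] -> //=.
by have := H2 j; rewrite mxE.
Qed.

Lemma rV_consE n (x : 'rV[R]_n.+1) :
  x = rV_cons (x ord0 ord0, \row_j x ord0 (lift ord0 j)).
Proof.
by apply/rowP => i; rewrite mxE; case: unliftP => [j|] -> //=; rewrite mxE.
Qed.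

Lemma integral_hcubeS n (c : 'rV[R]_n.+1 * R) (f : 'rV[R]_n.+1 -> \bar R) :
  measurable_fun setT f -> (forall x, 0 <= f x)%E ->
  (\int[lebesgue_rV R n.+1]_(x in hcube c) f x =
   \int[lebesgue_measure]_(t in `[c.1 ord0 ord0, (c.1 ord0 ord0 + c.2)%R[%classic)
     \int[lebesgue_rV R n]_(v in hcube (ctail c)) f (rV_cons (t, v)))%E.
Proof.
move=> mf f0; have mc : measurable (hcube c) by exact: measurable_gcube.
have mc' : measurable (hcube (ctail c)) by exact: measurable_gcube.
have mI : measurable (`[c.1 ord0 ord0, c.1 ord0 ord0 + c.2[%classic : set R).
  exact: measurable_itv.
rewrite integral_mkcond [RHS]integral_mkcond.
pose g : measurableTypeR R * 'rV[R]_n -> \bar R := (f \_ (hcube c)) \o @rV_cons R n.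
have mfc : measurable_fun setT (f \_ (hcube c)).
  by apply/(measurable_restrictT _ mc); exact: (measurable_funS measurableT).
have mg : measurable_fun setT g.
  by apply: measurableT_comp => //; exact: measurable_rV_cons.
have fc0 x : (0 <= (f \_ (hcube c)) x)%E by apply: erestrict_ge0.
have g0 x : (0 <= g x)%E by exact: fc0.
transitivity (\int[lebesgue_measure \x lebesgue_rV R n]_z g z)%E.
  by rewrite (@ge0_integral_pushforward _ _ _ _ _ _ (@measurable_rV_cons R n))//=.
rewrite fubini_tonelli1//; apply: eq_integral => t _; rewrite /fubini_F /g /= [RHS]patchE.
case: ifPn => [|]; rewrite ?inE ?notin_setE /= in_itv/= => It.
  rewrite [RHS]integral_mkcond; apply: eq_integral => v _; rewrite !patchE.
  case: ifPn; case: ifPn => //; rewrite ?inE ?notin_setE.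
    by move=> nv /hcube_cons[].
  by move=> nv; case; apply/hcube_cons.
rewrite integral0_eq// => v _; rewrite patchE memNset// => /hcube_cons[].
by move=> /It.
Qed.

(* Functions whose restriction to each line parallel to an axis is a polynomial
   of degree at most [s]. *)
Fixpoint seppoly s n : ('rV[R]_n -> R) -> Prop :=
  match n with
  | 0 => fun=> True
  | m.+1 => fun F =>
    (forall v, exists2 p : {poly R}, (size p <= s.+1)%N &
      forall t, F (rV_cons (t, v)) = p.[t]) /\
    forall t, seppoly s (fun v => F (rV_cons (t, v)))
  end.

Lemma seppolyD s n (F G : 'rV[R]_n -> R) :
  seppoly s F -> seppoly s G -> seppoly s (fun x => F x + G x).
Proof.
elim: n => [//|n IH] in F G * => -[F1 F2] [G1 G2].
split=> [v|t]; last exact: IH (F2 t) (G2 t).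
have [p sp pF] := F1 v; have [q sq qG] := G1 v; exists (p + q).
  by rewrite (leq_trans (size_polyD _ _))// geq_max sp.
by move=> t; rewrite hornerD pF qG.
Qed.

Lemma seppolyZ s n a (F : 'rV[R]_n -> R) : seppoly s F -> seppoly s (fun x => a * F x).
Proof.
elim: n => [//|n IH] in F * => -[F1 F2].
split=> [v|t]; last exact: IH (F2 t).
have [p sp pF] := F1 v; exists (a *: p).
  by rewrite (leq_trans (size_scale_leq _ _)).
by move=> t; rewrite hornerZ pF.
Qed.

Lemma seppoly0 s n : seppoly s (fun _ : 'rV[R]_n => 0).
Proof.
elim: n => [//|n IH]; split=> // v; exists 0; first by rewrite size_poly0.
by move=> t; rewrite horner0.
Qed.

Lemma seppoly_sum s n I (r : seq I) (F : I -> 'rV[R]_n -> R) :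
  (forall i, seppoly s (F i)) -> seppoly s (fun x => \sum_(i <- r) F i x).
Proof.
move=> sF; elim: r => [|i r IH].
  by under eq_fun do rewrite big_nil; exact: seppoly0.
by under eq_fun do rewrite big_cons; exact: seppolyD.
Qed.

Lemma seppoly_monomial s n (g : 'I_n -> nat) : (forall i, (g i <= s)%N) ->
  seppoly s (fun x : 'rV[R]_n => \prod_(i < n) x ord0 i ^+ g i).
Proof.
elim: n g => [//|n IH] g gs.
have E t v : \prod_(i < n.+1) (rV_cons (t, v) : 'rV[R]_n.+1) ord0 i ^+ g i =
    t ^+ g ord0 * \prod_(i < n) v ord0 i ^+ g (lift ord0 i).
  rewrite big_ord_recl mxE unlift_none /=; congr (_ * _).
  by apply: eq_bigr => i _; rewrite mxE liftK.
split=> [v|t].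
  exists ((\prod_(i < n) v ord0 i ^+ g (lift ord0 i)) *: 'X^(g ord0)).
    by rewrite (leq_trans (size_scale_leq _ _))// size_polyXn ltnS.
  by move=> t; rewrite E hornerZ hornerXn mulrC.
under eq_fun do rewrite E.
by apply: seppolyZ; apply: IH => i; exact: gs.
Qed.

(** Induction on the dimension: the one-variable bound in the first coordinate with the others
    frozen, then the induction hypothesis on each slice under the integral. Freezing coordinates
    stays inside the class [seppoly]. *)
Lemma seppoly_mean_bound s n : exists2 C : R, 0 < C &
  forall F : 'rV[R]_n -> R, seppoly s F -> measurable_fun setT F ->
  forall c, 0 < c.2 -> forall x, hcube c x ->
  ((`|F x| * c.2 ^+ n)%:E <=
   C%:E * \int[lebesgue_rV R n]_(y in hcube c) (`|F y|)%:E)%E.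
Proof.
elim: n => [|n [C C0 IH]].
  exists 1 => // F _ mF c c0 x cx; rewrite expr0 mulr1 mul1e.
  have -> : hcube c = setT by apply/seteqP; split=> // y _ [].
  rewrite integral_dirac// ?diracT ?mul1e.
    by rewrite lee_fin (_ : x = 0)//; apply/rowP => -[].
  by apply/measurable_EFinP; exact: measurableT_comp.
have [C1 C10 H1] := @poly_mean_bound R s.
exists (C1 * C); first by rewrite mulr_gt0.
move=> F [F1 F2] mF c c0 x; rewrite (rV_consE x).
set t := x _ _; set v := (X in rV_cons (t, X)) => /hcube_cons[ct cv].
have mnF : measurable_fun setT (fun x => (`|F x|)%:E).
  by apply/measurable_EFinP; exact: measurableT_comp.
rewrite integral_hcubeS//.
have mFc (u : R) : measurable_fun setT (fun w : 'rV[R]_n => F (rV_cons (u, w))).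
  apply: measurableT_comp => //.
  apply: (measurableT_comp (@measurable_rV_cons R n)); exact: pair1_measurable.
have H2 u : ((`|F (rV_cons (u, v))| * c.2 ^+ n)%:E <=
   C%:E * \int[lebesgue_rV R n]_(y in hcube (ctail c)) (`|F (rV_cons (u, y))|)%:E)%E.
  exact: (IH _ (F2 u) (mFc u) (ctail c)).
have [p sp pE] := F1 v.
have := H1 p (c.1 ord0 ord0) c.2 sp c0 t ct; rewrite -pE => Hp.
have cn0 : 0 < c.2 ^+ n by rewrite exprn_gt0.
have mI : measurable (`[c.1 ord0 ord0, c.1 ord0 ord0 + c.2[%classic : set R).
  exact: measurable_itv.
have mp : measurable_fun setT (fun t : R => `|p.[t]|%:E).
  apply/measurable_EFinP; apply: measurableT_comp => //.
  apply: continuous_measurable_fun => u; exact: continuous_horner.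
rewrite exprS mulrA EFinM.
apply: (@le_trans _ _ (C1%:E * (\int[lebesgue_measure]_(t0 in
   `[c.1 ord0 ord0, (c.1 ord0 ord0 + c.2)%R[%classic) `|p.[t0]|%:E) * (c.2 ^+ n)%:E)%E).
  by apply: lee_wpmul2r => //; rewrite lee_fin ltW.
rewrite EFinM -!muleA; apply: lee_wpmul2l; first by rewrite lee_fin ltW.
rewrite -ge0_integralZr//; last 2 first.
- exact: (measurable_funS measurableT).
- by rewrite lee_fin ltW.
(* Tonelli, applied to the restriction of |F| to the strip over [hcube (ctail c)], makes the inner
   integral measurable in [u]. *)
have mG : measurable_fun setT (fun u : R => \int[lebesgue_rV R n]_(w in hcube (ctail c))
   (`|F (rV_cons (u, w))|)%:E)%E.
  pose g (z : measurableTypeR R * 'rV[R]_n) : \bar R :=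
    ((fun z => `|F (rV_cons z)|%:E) \_ (setT `*` hcube (ctail c))) z.
  have mg : measurable_fun setT g.
    have mX : measurable ([set: measurableTypeR R] `*` hcube (ctail c)).
      by apply: measurableX; [exact: measurableT|exact: measurable_gcube].
    apply/(measurable_restrictT _ mX).
    apply: (measurable_funS measurableT) => //.
    exact: (measurableT_comp mnF (@measurable_rV_cons R n)).
  have g0 z : (0 <= g z)%E by apply: erestrict_ge0 => y _; rewrite lee_fin.
  rewrite (_ : (fun u => _) = fubini_F (lebesgue_rV R n) g).
    exact: measurable_fun_fubini_tonelli_F.
  apply/funext => u; rewrite /fubini_F /= [LHS]integral_mkcond.
  apply: eq_integral => w _.
  by rewrite /g !patchE /= in_setX mem_setT.
rewrite -ge0_integralZl//; last 3 first.
- exact: (measurable_funS measurableT).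
- by move=> u _; apply: integral_ge0.
- by rewrite lee_fin ltW.
apply: ge0_le_integral => //.
- by move=> u _; rewrite -EFinM lee_fin mulr_ge0// ltW.
- apply: (measurable_funS measurableT) => //; exact: emeasurable_funM.
- apply: (measurable_funS measurableT) => //; exact: emeasurable_funM.
- by move=> u _; rewrite -pE -EFinM.
Qed.

End PolynomialMean.

(** * Projections *)

Section BoundedIntegrable.
Context d (T : measurableType d) {R : realType} (mu : {measure set T -> \bar R}).
Variables (D : set T).
Hypotheses (mD : measurable D) (Doo : (mu D < +oo)%E).
Implicit Types (f u v : T -> R).

Definition bddmeas u := measurable_fun D u /\ exists M, forall x, D x -> `|u x| <= M.

Lemma bddmeas_bounded u : bddmeas u -> [bounded u x | x in D].
Proof.
move=> [_ [M uM]]; exists M; split; first exact: num_real.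
by move=> r Mr x Dx; apply: (le_trans (uM _ Dx)); exact: ltW.
Qed.

Lemma bddmeas_integrable u : bddmeas u -> mu.-integrable D (EFin \o u).
Proof.
move=> bu; apply: measurable_bounded_integrable => //; first by case: bu.
exact: bddmeas_bounded.
Qed.

Lemma bddmeasM u v : bddmeas u -> bddmeas v -> bddmeas (fun x => u x * v x).
Proof.
move=> [mu' [M uM]] [mv [N vN]]; split; first exact: measurable_funM.
exists (M * N) => x Dx; rewrite normrM; apply: ler_pM => //; [exact: uM|exact: vN].
Qed.

Lemma bddmeasD u v : bddmeas u -> bddmeas v -> bddmeas (fun x => u x + v x).
Proof.
move=> [mu' [M uM]] [mv [N vN]]; split; first exact: measurable_funD.
by exists (M + N) => x Dx; rewrite (le_trans (ler_normD _ _))// lerD ?uM ?vN.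
Qed.

Lemma bddmeas_cst (r : R) : bddmeas (fun=> r).
Proof. by split; [exact: measurable_cst|exists `|r|]. Qed.

Lemma bddmeas_sum I (s : seq I) (F : I -> T -> R) :
  (forall i, bddmeas (F i)) -> bddmeas (fun x => \sum_(i <- s) F i x).
Proof.
move=> bF; elim: s => [|i s IH].
  by under eq_fun do rewrite big_nil; exact: bddmeas_cst.
by under eq_fun do rewrite big_cons; exact: bddmeasD.
Qed.

Lemma bddmeas_prod I (s : seq I) (F : I -> T -> R) :
  (forall i, bddmeas (F i)) -> bddmeas (fun x => \prod_(i <- s) F i x).
Proof.
move=> bF; elim: s => [|i s IH].
  by under eq_fun do rewrite big_nil; exact: bddmeas_cst.
by under eq_fun do rewrite big_cons; exact: bddmeasM.
Qed.

Lemma integrable_bddM f u : mu.-integrable D (EFin \o f) -> bddmeas u ->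
  mu.-integrable D (EFin \o (fun x => f x * u x)).
Proof.
move=> fi bu; have := integrableMl mD fi bu.1 (bddmeas_bounded bu).
by apply: eq_integrable => // x _ /=; rewrite EFinM.
Qed.

Lemma Rintegral_sum I (s : seq I) (F : I -> T -> R) :
  (forall i, mu.-integrable D (EFin \o F i)) ->
  \int[mu]_(x in D) (\sum_(i <- s) F i x) = \sum_(i <- s) \int[mu]_(x in D) F i x.
Proof.
move=> iF; rewrite /Rintegral.
under eq_integral do rewrite -sumEFin.
rewrite (@integral_sum _ _ _ mu D mD _ (fun i => EFin \o F i) iF).
rewrite (eq_bigr (fun i => (\int[mu]_(x in D) F i x)%R%:E)); first by rewrite sumEFin.
by move=> i _; rewrite fineK//; exact: integrable_fin_num (iF i).
Qed.

(** The vanishing integral of the square forces [u] to be 0 almost everywhere on [D]. *)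
Lemma Rintegral0_eq f u : mu.-integrable D (EFin \o f) -> bddmeas u ->
  \int[mu]_(x in D) (u x * u x) = 0 -> \int[mu]_(x in D) (f x * u x) = 0.
Proof.
move=> fi bu u0; have buu := bddmeasM bu bu; have iuu := bddmeas_integrable buu.
have mfu : measurable_fun D (fun x => (f x * u x)%:E).
  exact: measurable_int (integrable_bddM fi bu).
have muu : measurable_fun D (fun x => (u x * u x)%:E) by exact: measurable_int iuu.
have H : (\int[mu]_(x in D) `|(u x * u x)%:E| = 0)%E.
  under eq_integral => x _ do rewrite gee0_abs ?lee_fin -?expr2 ?sqr_ge0//.
  by rewrite -[LHS]fineK ?[fine _]u0//; exact: integrable_fin_num.
have /(ae_eq_integral_abs mu mD muu)[Z [mZ Z0 DZ]] := H.
rewrite /Rintegral (@ae_eq_integral _ _ _ mu D (cst 0%E) (fun x => (f x * u x)%:E)) ?integral0//.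
exists Z; split=> // x nx; apply: DZ => /= H'; apply: nx => /= Dx.
have [/eqP] := H' Dx; rewrite mulf_eq0 orbb => /eqP ->.
by rewrite mulr0.
Qed.

(** The condition is the linear system [v *m G = b] with the Gram matrix [G], which may be singular.
    It is solvable because the kernel of [G] annihilates [b]: a kernel vector gives a combination
    [u] of the [e i] whose square has integral 0. *)
Lemma gram_solve N (e : 'I_N -> T -> R) f : (forall i, bddmeas (e i)) ->
  mu.-integrable D (EFin \o f) ->
  exists v : 'I_N -> R, forall j,
    \int[mu]_(x in D) ((f x - \sum_i v i * e i x) * e j x) = 0.
Proof.
move=> be fi.
pose G : 'M[R]_N := \matrix_(i, j) \int[mu]_(x in D) (e i x * e j x).
pose b : 'rV[R]_N := \row_j \int[mu]_(x in D) (f x * e j x).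
have key (c : 'cV[R]_N) : G *m c = 0 -> b *m c = 0.
  move=> Gc0; pose u x := \sum_i e i x * c i ord0.
  have bec i : bddmeas (fun x => e i x * c i ord0).
    by apply: bddmeasM => //; exact: bddmeas_cst.
  have bu : bddmeas u by exact: bddmeas_sum.
  have eu i : \int[mu]_(x in D) (e i x * u x) = 0.
    have -> : \int[mu]_(x in D) (e i x * u x) =
        \int[mu]_(x in D) (\sum_j (e i x * e j x * c j ord0)).
      by apply: eq_Rintegral => x _; rewrite /u mulr_sumr; apply: eq_bigr => j _; rewrite mulrA.
    rewrite Rintegral_sum; last first.
      move=> j; apply: bddmeas_integrable; apply: bddmeasM; last exact: bddmeas_cst.
      exact: bddmeasM.
    transitivity ((G *m c) i ord0); last by rewrite Gc0 mxE.
    rewrite mxE; apply: eq_bigr => j _; rewrite RintegralZr ?mxE//.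
    by apply: bddmeas_integrable; exact: bddmeasM.
  have uu : \int[mu]_(x in D) (u x * u x) = 0.
    have -> : \int[mu]_(x in D) (u x * u x) =
        \int[mu]_(x in D) (\sum_j (e j x * u x * c j ord0)).
      apply: eq_Rintegral => x _; rewrite {1}/u mulr_suml; apply: eq_bigr => j _.
      by rewrite mulrAC.
    rewrite Rintegral_sum; last first.
      move=> j; apply: bddmeas_integrable; apply: bddmeasM; last exact: bddmeas_cst.
      exact: bddmeasM.
    rewrite big1// => j _; rewrite RintegralZr// ?eu ?mul0r//.
    by apply: bddmeas_integrable; exact: bddmeasM.
  apply/matrixP => i k; rewrite !ord1 mxE [RHS]mxE -[RHS](Rintegral0_eq fi bu uu).
  have -> : \int[mu]_(x in D) (f x * u x) =
      \int[mu]_(x in D) (\sum_j (f x * e j x * c j ord0)).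
    by apply: eq_Rintegral => x _; rewrite /u mulr_sumr; apply: eq_bigr => j _; rewrite mulrA.
  rewrite Rintegral_sum; last first.
    move=> j; apply: (@integrable_bddM (fun x => f x * e j x)); last exact: bddmeas_cst.
    exact: integrable_bddM.
  apply: eq_bigr => j _; rewrite RintegralZr ?mxE//.
  exact: integrable_bddM.
(* The columns of [cokermx G] lie in the kernel of [G], and [b] is in the row space of [G] exactly
   when it annihilates them. *)
have bG : (b <= G)%MS.
  rewrite submxE; apply/eqP/matrixP => i k; rewrite !ord1 [RHS]mxE.
  have colM m (A : 'M[R]_(m, N)) : A *m col k (cokermx G) = col k (A *m cokermx G).
    by apply/matrixP => i' j'; rewrite !mxE; apply: eq_bigr => l _; rewrite mxE.
  have := key (col k (cokermx G)); rewrite !colM mulmx_coker.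
  have -> : col k (0 : 'M[R]_N) = 0 by apply/matrixP => i' j'; rewrite !mxE.
  by move=> /(_ erefl)/matrixP/(_ ord0 ord0); rewrite mxE => ->; rewrite mxE.
pose v := b *m pinvmx G; exists (fun i => v ord0 i) => j.
have vG : v *m G = b by exact: mulmxKpV.
have bs : bddmeas (fun x => \sum_i v ord0 i * e i x).
  by apply: bddmeas_sum => i; apply: bddmeasM => //; exact: bddmeas_cst.
under eq_Rintegral do rewrite mulrBl.
rewrite RintegralB//; last 2 first.
- exact: integrable_bddM.
- by apply: bddmeas_integrable; exact: bddmeasM.
have -> : \int[mu]_(x in D) (f x * e j x) = (v *m G) ord0 j by rewrite vG mxE.
apply/eqP; rewrite subr_eq0; apply/eqP.
under [RHS]eq_Rintegral do rewrite mulr_suml.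
rewrite Rintegral_sum; last first.
  by move=> i; apply: bddmeas_integrable; apply: bddmeasM => //; apply: bddmeasM => //; exact: bddmeas_cst.
rewrite mxE; apply: eq_bigr => i _; rewrite [G i j]mxE.
under [RHS]eq_Rintegral do rewrite -mulrA.
by rewrite RintegralZl//; apply: bddmeas_integrable; exact: bddmeasM.
Qed.

End BoundedIntegrable.

(** * Polynomial projections on half-open cubes *)

Section Projection.
Context {R : realType} {n : nat}.
Local Notation L := (lebesgue_space R n).
Local Notation mu := (leb R n).
Local Notation poly := (mpoly.mpoly n R).
Implicit Types (c : 'rV[R]_n * R) (P Q : poly) (f : 'rV[R]_n -> R).

Definition pev P (x : 'rV[R]_n) : R := meval (x ord0) P.

Lemma hcube_lty c : 0 < c.2 -> (mu (hcube c) < +oo)%E.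
Proof. by move=> c0; rewrite leb_gcube// ltry. Qed.

Lemma measurable_pev P : measurable_fun setT (pev P).
Proof.
rewrite /pev; under eq_fun do rewrite mevalE.
apply: measurable_sum => m; apply: measurable_funM; first exact: measurable_cst.
apply: measurable_prod => i _.
by apply: measurable_funX; exact: measurable_coord.
Qed.

Lemma bddmeas_coord c (i : 'I_n) : 0 < c.2 ->
  bddmeas (hcube c : set L) (fun x => x ord0 i).
Proof.
move=> c0; split.
  apply: (measurable_funTS (T1 := L)).
  exact: (@measurable_fun_leb _ _ _ _ (fun x => x ord0 i) (measurable_coord i)).
exists (`|c.1 ord0 i| + c.2) => x /hcubeP/(_ i)/andP[h1 h2].
rewrite -[x ord0 i](subrK (c.1 ord0 i)) addrC (le_trans (ler_normD _ _))// lerD2l.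
by rewrite ger0_norm ?subr_ge0//; lra.
Qed.

Lemma bddmeas_monomial c (g : 'I_n -> nat) : 0 < c.2 ->
  bddmeas (hcube c : set L) (fun x => \prod_(i < n) x ord0 i ^+ g i).
Proof.
move=> c0; apply: bddmeas_prod => i; elim: (g i) => [|k IH].
  by under eq_fun do rewrite expr0; exact: bddmeas_cst.
by under eq_fun do rewrite exprS; exact: (bddmeasM (bddmeas_coord i c0) IH).
Qed.

Lemma bddmeas_pev c P : 0 < c.2 -> bddmeas (hcube c : set L) (pev P).
Proof.
move=> c0; rewrite /pev; under eq_fun do rewrite mevalE.
apply: bddmeas_sum => m; apply: bddmeasM; first exact: bddmeas_cst.
exact: bddmeas_monomial.
Qed.

Lemma pevE s P : (msize P <= s.+1)%N -> pev P =
  (fun x => \sum_(m : bmultinom n s.+1) mcoeff m P * \prod_(i < n) x ord0 i ^+ (bmnm m : multinom n) i).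
Proof.
move=> sP; apply/funext => x; rewrite /pev {1}(mpolywE sP) raddf_sum /=.
by apply: eq_bigr => m _; rewrite mevalZ mevalX.
Qed.

Lemma seppoly_pev s P : (msize P <= s.+1)%N -> seppoly s (pev P).
Proof.
move=> sP; rewrite (pevE sP); apply: seppoly_sum => m; apply: seppolyZ.
apply: seppoly_monomial => i; have := bmdeg m; rewrite ltnS; apply: leq_trans.
by rewrite mdegE (bigD1 i)//= leq_addr.
Qed.

Lemma is_polyproj_exists s c f : 0 < c.2 -> mu.-integrable (hcube c) (EFin \o f) ->
  exists P, is_polyproj s (hcube c) f P.
Proof.
move=> c0 fi; have mc := @mcube R n c.
pose e (k : 'I_#|{: bmultinom n s.+1}|) (x : L) : R := \prod_(i < n) x ord0 i ^+ (bmnm (enum_val k) : multinom n) i.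
have be k : bddmeas (hcube c : set L) (e k) by exact: bddmeas_monomial.
have [v Hv] := gram_solve mc (hcube_lty c0) be fi.
pose P : poly := \sum_k v k *: mpolyX R (bmnm (enum_val k)).
have PE x : pev P x = \sum_k v k * e k x.
  by rewrite /pev raddf_sum /=; apply: eq_bigr => k _; rewrite mevalZ mevalX.
exists P; split.
  apply: (leq_trans (mmeasure_sum _ _ _ _)); apply/bigmax_leqP => k _.
  by apply: (leq_trans (mmeasureZ_le _ _ _)); rewrite mmeasureX; exact: bmdeg.
move=> g gs; have gs' : (mdeg g < s.+1)%N by rewrite ltnS.
have := Hv (enum_rank (BMultinom gs')).
have -> : (fun x : L => (f x - \sum_i v i * e i x) * e (enum_rank (BMultinom gs')) x) =
   (fun x => (f x - pev P x) * \prod_(i < n) x ord0 i ^+ g i).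
  by apply/funext => x; rewrite PE /e enum_rankK.
move=> H; rewrite -[LHS]fineK; first by rewrite -/(Rintegral _ _ _) H.
apply: integrable_fin_num => //.
apply: (@integrable_bddM _ _ _ mu _ mc (fun x => f x - pev P x)); last exact: bddmeas_monomial.
have := integrableB mc fi (bddmeas_integrable mc (hcube_lty c0) (bddmeas_pev P c0)).
by apply: eq_integrable => // x _ /=; rewrite EFinB.
Qed.

(** Chosen by the same [xget] as in [polyproj], so that equal sets of candidates yield the same
    polynomial. *)
Definition hproj s c f : poly := xget 0 [set P | is_polyproj s (hcube c) f P].

Lemma hprojP s c f : 0 < c.2 -> mu.-integrable (hcube c) (EFin \o f) ->
  is_polyproj s (hcube c) f (hproj s c f).
Proof. by move=> c0 fi; exact: xgetPex (is_polyproj_exists s c0 fi). Qed.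

Lemma integrable_subpev c f P : 0 < c.2 -> mu.-integrable (hcube c) (EFin \o f) ->
  mu.-integrable (hcube c) (EFin \o (fun x => f x - pev P x)).
Proof.
move=> c0 fi; have mc := @mcube R n c.
have := integrableB mc fi (bddmeas_integrable mc (hcube_lty c0) (bddmeas_pev P c0)).
by apply: eq_integrable => // x _ /=; rewrite EFinB.
Qed.

Lemma is_polyproj_orth s c f P Q : 0 < c.2 -> mu.-integrable (hcube c) (EFin \o f) ->
  is_polyproj s (hcube c) f P -> (msize Q <= s.+1)%N ->
  \int[mu]_(x in hcube c) ((f x - pev P x) * pev Q x) = 0.
Proof.
move=> c0 fi [sP oP] sQ; rewrite (pevE sQ).
have mc := @mcube R n c; have fP := integrable_subpev P c0 fi.
under eq_Rintegral do rewrite mulr_sumr.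
have bm (m : bmultinom n s.+1) : bddmeas (hcube c : set L)
    (fun x => \prod_(i < n) x ord0 i ^+ (bmnm m : multinom n) i).
  exact: bddmeas_monomial.
have im (m : bmultinom n s.+1) : mu.-integrable (hcube c) (EFin \o
    (fun x => (f x - pev P x) * \prod_(i < n) x ord0 i ^+ (bmnm m : multinom n) i)).
  exact: (integrable_bddM mc fP).
rewrite Rintegral_sum//; last first.
  move=> m; apply: (integrable_bddM mc fP); apply: bddmeasM; last exact: bm.
  exact: bddmeas_cst.
rewrite big1// => m _; under eq_Rintegral do rewrite mulrCA.
by rewrite RintegralZl// /Rintegral oP ?mulr0// -ltnS bmdeg.
Qed.

Lemma Rintegral_sub_proj s c f P : 0 < c.2 -> mu.-integrable (hcube c) (EFin \o f) ->
  is_polyproj s (hcube c) f P -> \int[mu]_(x in hcube c) (f x - pev P x) = 0.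
Proof.
move=> c0 fi pP; rewrite -[RHS](is_polyproj_orth c0 fi pP (_ : (msize (1 : poly) <= s.+1)%N)).
  by apply: eq_Rintegral => x _; rewrite /pev meval1 mulr1.
by rewrite msize1.
Qed.

Lemma pev_mean_bound s : exists2 C : R, 0 < C & forall c P, 0 < c.2 ->
  (msize P <= s.+1)%N -> forall x, hcube c x ->
  `|pev P x| * c.2 ^+ n <= C * \int[mu]_(y in hcube c) `|pev P y|.
Proof.
have [C C0 H] := @seppoly_mean_bound R s n.
exists C => // c P c0 sP x cx.
have bP := bddmeas_pev P c0; have mc := @mcube R n c.
have iP := integrable_norm (bddmeas_integrable mc (hcube_lty c0) bP).
have := H _ (seppoly_pev sP) (measurable_pev P) c c0 x cx.
rewrite -ge0_integral_leb; last 3 first.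
- exact: measurable_gcube.
- by apply/measurable_EFinP; apply: measurableT_comp => //; exact: measurable_pev.
- by move=> y; rewrite lee_fin.
by rewrite -[X in (_ * X)%E]fineK -?EFinM ?lee_fin//; exact: integrable_fin_num iP.
Qed.

(* With [h = f - pev P], orthogonality gives [int D^2 = int h D] for
   [D = pev P' - pev P]; bounding [D] by its mean on the right and from below by
   Cauchy-Schwarz on the left gives [int |D| <= C int |h|]. *)
Lemma proj_diff_bound s : exists2 C : R, 0 < C & forall c f P P', 0 < c.2 ->
  mu.-integrable (hcube c) (EFin \o f) -> (msize P <= s.+1)%N ->
  is_polyproj s (hcube c) f P' -> forall x, hcube c x ->
  `|pev P' x - pev P x| * c.2 ^+ n <= C * \int[mu]_(y in hcube c) `|f y - pev P y|.
Proof.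
have [C C0 H] := pev_mean_bound s.
exists (C * C) => [|c f P P' c0 fi sP pP' x cx]; first exact: mulr_gt0.
have mc := @mcube R n c; have [sP' _] := pP'.
pose D : poly := P' - P; pose h x := f x - pev P x.
have DE y : pev D y = pev P' y - pev P y by rewrite /pev /D mevalB.
have sD : (msize D <= s.+1)%N.
  by apply: (leq_trans (mmeasureD_le _ _ _)); rewrite geq_max mmeasureN sP' sP.
have hi : mu.-integrable (hcube c) (EFin \o h) by exact: integrable_subpev.
have nhi := integrable_norm hi.
have bD := bddmeas_pev D c0.
have Di := bddmeas_integrable mc (hcube_lty c0) bD.
have nDi := integrable_norm Di.
have DDi := bddmeas_integrable mc (hcube_lty c0) (bddmeasM bD bD).
have hDi := integrable_bddM mc hi bD.
have DD : \int[mu]_(x in hcube c) (pev D x * pev D x) =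
          \int[mu]_(x in hcube c) (h x * pev D x).
  apply/eqP; rewrite eq_sym -subr_eq0 -RintegralB//; apply/eqP.
  rewrite -[RHS](is_polyproj_orth c0 fi pP' sD); apply: eq_Rintegral => y _.
  by rewrite -mulrBl /h DE; congr (_ * _); ring.
set V := c.2 ^+ n; have V0 : 0 < V by rewrite exprn_gt0.
set A := \int[mu]_(y in hcube c) `|pev D y|.
set B := \int[mu]_(y in hcube c) `|h y|.
have A0 : 0 <= A by apply: Rintegral_ge0.
have B0 : 0 <= B by apply: Rintegral_ge0.
have Dx y : hcube c y -> `|pev D y| <= C * A / V.
  by move=> cy; rewrite ler_pdivlMr//; exact: H.
have up : \int[mu]_(x in hcube c) (h x * pev D x) <= C * A / V * B.
  rewrite -RintegralZl//; apply: le_Rintegral => //.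
    by have := integrableZl mc (C * A / V) nhi; apply: eq_integrable => // y _ /=; rewrite EFinM.
  move=> y cy; rewrite (le_trans (ler_norm _))// normrM mulrC ler_wpM2r//; exact: Dx.
pose m := A / V.
(* Cauchy-Schwarz in integrated form: (|D| - m)^2 >= 0 with [m] the mean of |D| gives 2 m A - m^2 V
   = m A as a lower bound. *)
have lo : m * A <= \int[mu]_(x in hcube c) (pev D x * pev D x).
  have mi : mu.-integrable (hcube c) (EFin \o (fun y => (m *+ 2) * `|pev D y|)).
    by have := integrableZl mc (m *+ 2) nDi; apply: eq_integrable => // y _ /=; rewrite EFinM.
  have ci : mu.-integrable (hcube c) (EFin \o (fun _ => m ^+ 2)).
    exact: (bddmeas_integrable mc (hcube_lty c0) (bddmeas_cst _ _)).
  have : \int[mu]_(y in hcube c) ((m *+ 2) * `|pev D y| - m ^+ 2) <=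
         \int[mu]_(x in hcube c) (pev D x * pev D x).
    apply: le_Rintegral => //.
      by have := integrableB mc mi ci; apply: eq_integrable => // y _ /=; rewrite EFinB.
    move=> y _; rewrite -expr2 -[leRHS]real_normK ?num_real//.
    have aux (a b : R) : (b *+ 2) * a - b ^+ 2 <= a ^+ 2.
      by rewrite -subr_ge0 (_ : _ - _ = (a - b) ^+ 2) ?sqr_ge0//; ring.
    exact: aux.
  rewrite RintegralB// RintegralZl// Rintegral_cst// -/A.
  apply: le_trans; rewrite [fine _](_ : _ = V) ?leb_gcube//.
  have -> : m ^+ 2 * V = m * A by rewrite /m; field; rewrite gt_eqF.
  by rewrite mulrnAl mulr2n addrK.
have AB : A <= C * B.
  have [A00|Apos] := eqVneq A 0; first by rewrite A00 mulr_ge0// ltW.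
  have Ap : 0 < A by rewrite lt_neqAle eq_sym Apos.
  have := le_trans lo (eq_ind_r (fun z => z <= _) up DD).
  rewrite /m -(ler_pM2r V0) (_ : A / V * A * V = A * A); last by field; rewrite gt_eqF.
  rewrite (_ : C * A / V * B * V = A * (C * B)); last by field; rewrite gt_eqF.
  by rewrite ler_pM2l.
by rewrite -DE (le_trans (H c D c0 sD x cx))// -mulrA ler_pM2l.
Qed.

End Projection.

(** * The self-improving estimate *)

Section RealPowers.
Context {R : realType}.
Implicit Types a b q p t x y : R.

Lemma le_powR q x y : 0 <= q -> 0 <= x -> x <= y -> x `^ q <= y `^ q.
Proof.
move=> q0 x0 xy; apply: ge0_ler_powR => //; rewrite nnegrE//.
exact: le_trans xy.
Qed.

Lemma powRV q x : 0 <= x -> x^-1 `^ q = (x `^ q)^-1.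
Proof. by move=> x0; rewrite -powR_inv1// powRAC powR_inv1// powR_ge0. Qed.

(** Either [b] is at most [eta * a], or [a] is less than [b / eta]; in each case one term alone
    bounds the sum. A small [eta] brings the coefficient of the power of [a] as close to 1 as
    desired. *)
Lemma powRD_split q eta a b : 0 <= q -> 0 < eta -> 0 <= a -> 0 <= b ->
  (a + b) `^ q <= (1 + eta) `^ q * a `^ q + (1 + eta^-1) `^ q * b `^ q.
Proof.
move=> q0 e0 a0 b0.
have e1 : 0 <= 1 + eta by rewrite addr_ge0// ltW.
have e2 : 0 <= 1 + eta^-1 by rewrite addr_ge0// invr_ge0 ltW.
have [h|h] := leP b (eta * a).
  apply: (@le_trans _ _ ((1 + eta) `^ q * a `^ q)); last first.
    by rewrite lerDl mulr_ge0// powR_ge0.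
  rewrite -powRM//; apply: le_powR => //; first exact: addr_ge0.
  by rewrite mulrDl mul1r lerD2l.
apply: (@le_trans _ _ ((1 + eta^-1) `^ q * b `^ q)); last first.
  by rewrite lerDr mulr_ge0// powR_ge0.
rewrite -powRM//; apply: le_powR => //; first exact: addr_ge0.
by rewrite mulrDl mul1r addrC lerD2l ler_pdivlMl// ltW.
Qed.

Lemma powRD_le q a b : 0 <= q -> 0 <= a -> 0 <= b ->
  (a + b) `^ q <= 2 `^ q * (a `^ q + b `^ q).
Proof.
move=> q0 a0 b0; have := powRD_split q0 ltr01 a0 b0.
by rewrite invr1 -[1 + 1]/2%:R mulrDr.
Qed.

Lemma weighted_AGM t x y : 0 < t < 1 -> 0 <= x -> 0 <= y ->
  x `^ (1 - t) * y `^ t <= (1 - t) * x + t * y.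
Proof.
move=> /andP[t0 t1] x0 y0; have t10 : 0 < 1 - t by rewrite subr_gt0.
have := @conjugate_powR R (x `^ (1 - t)) (y `^ t) (1 - t)^-1 t^-1
  (powR_ge0 _ _) (powR_ge0 _ _).
rewrite !invr_gt0 !invrK subrK => /(_ t10 t0 erefl).
rewrite -!powRrM !mulfV ?gt_eqF// !powRr1//.
by rewrite (mulrC x) (mulrC y).
Qed.

(** After division by [V] and [K] this is the weighted arithmetic-geometric inequality, summed term
    by term. For [K = 0] all the [k i] vanish, and with them the left side. *)
Lemma sum_powR_holder (I : Type) (r : seq I) (P : pred I) (v k : I -> R) t (V K : R) :
  0 < t < 1 -> 0 < V -> (forall i, P i -> 0 <= v i) -> (forall i, P i -> 0 <= k i) ->
  \sum_(i <- r | P i) v i <= V -> \sum_(i <- r | P i) k i <= K ->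
  \sum_(i <- r | P i) v i `^ (1 - t) * k i `^ t <= V `^ (1 - t) * K `^ t.
Proof.
move=> t01 V0 v0 k0 vV kK; have /andP[t0 t1] := t01.
have : 0 <= K by apply: le_trans kK; exact: sumr_ge0.
rewrite le_eqVlt => /orP[/eqP K0|K0].
  rewrite -K0 in kK *; rewrite powR0 ?gt_eqF// mulr0.
  elim: r kK {vV} => [|i r IH]; first by rewrite !big_nil.
  rewrite !big_cons; case: ifPn => // Pi h.
  have s0 : 0 <= \sum_(j <- r | P j) k j by exact: sumr_ge0.
  have ki : k i = 0 by apply/eqP; rewrite eq_le k0// andbT; lra.
  rewrite ki powR0 ?gt_eqF// mulr0 add0r; apply: IH.
  by move: h; rewrite ki add0r.
have VK : 0 < V `^ (1 - t) * K `^ t by rewrite mulr_gt0// powR_gt0.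
rewrite -[leRHS]mulr1 -ler_pdivrMl// mulr_sumr.
apply: (@le_trans _ _ (\sum_(i <- r | P i) ((1 - t) * (v i / V) + t * (k i / K)))).
  apply: ler_sum => i Pi; apply: le_trans (weighted_AGM t01 _ _).
  - have iV : 0 <= V^-1 by rewrite invr_ge0 ltW.
    have iK : 0 <= K^-1 by rewrite invr_ge0 ltW.
    rewrite !powRM ?v0 ?k0// !powRV ?(ltW V0) ?(ltW K0)// invfM.
    by rewrite le_eqVlt; apply/orP; left; apply/eqP; ring.
  - by rewrite divr_ge0 ?v0 ?ltW.
  - by rewrite divr_ge0 ?k0 ?ltW.
rewrite big_split/= -!mulr_sumr -!mulr_suml.
have h1 : (\sum_(i <- r | P i) v i) / V <= 1 by rewrite ler_pdivrMr// mul1r.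
have h2 : (\sum_(i <- r | P i) k i) / K <= 1 by rewrite ler_pdivrMr// mul1r.
have t10 : 0 <= 1 - t by rewrite subr_ge0 ltW.
have := ler_wpM2l t10 h1; have := ler_wpM2l (ltW t0) h2; lra.
Qed.

(** The left side equals V^(1 - t) (a^p V)^t. This brings the power of a mean into the form that
    [sum_powR_holder] can sum. *)
Lemma powR_interpolation p t a (V K : R) : 0 < t < 1 -> 0 <= a -> 0 < V ->
  a `^ p * V <= K -> a `^ (p * t) * V <= V `^ (1 - t) * K `^ t.
Proof.
move=> /andP[t0 t1] a0 V0 aK.
have -> : a `^ (p * t) * V = V `^ (1 - t) * (a `^ p * V) `^ t.
  rewrite powRrM powRM ?powR_ge0 ?(ltW V0)// mulrCA; congr (_ * _).
  by rewrite -powRD ?subrK ?powRr1 ?(ltW V0)// (gt_eqF V0) implybT.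
apply: ler_wpM2l; first exact: powR_ge0.
by apply: le_powR => //; [exact: ltW|rewrite mulr_ge0 ?powR_ge0// ltW].
Qed.

End RealPowers.

(** * Deviation of f from the projection of |f| *)

Section Deviation.
Context {R : realType} {n : nat}.
Local Notation L := (lebesgue_space R n).
Local Notation mu := (leb R n).
Implicit Types (c : 'rV[R]_n * R) (f : L -> R).

Definition hdev s f c (x : L) : R := `|f x - pev (hproj s c (fun y => `|f y|)) x|.

Definition hmean s f c : R := \int[mu]_(x in hcube c) hdev s f c x / c.2 ^+ n.

Lemma hdev_ge0 s f c x : 0 <= hdev s f c x. Proof. exact: normr_ge0. Qed.

Lemma measurable_hdev s f c : measurable_fun setT f -> measurable_fun setT (hdev s f c).
Proof.
move=> mf; apply: (measurableT_comp (@normr_measurable R setT)).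
exact: (measurable_funB mf (measurable_fun_leb (measurable_pev _))).
Qed.

Lemma integrable_hdev s f c : 0 < c.2 -> mu.-integrable (hcube c) (EFin \o f) ->
  mu.-integrable (hcube c) (EFin \o hdev s f c).
Proof.
by move=> c0 fi; exact: (integrable_norm (integrable_subpev _ c0 fi)).
Qed.

Lemma hmean_ge0 s f c : 0 < c.2 -> 0 <= hmean s f c.
Proof.
move=> c0; apply: divr_ge0; last by rewrite exprn_ge0// ltW.
by apply: Rintegral_ge0 => x _; exact: hdev_ge0.
Qed.

Lemma hmeanK s f c : 0 < c.2 ->
  \int[mu]_(x in hcube c) hdev s f c x = hmean s f c * c.2 ^+ n.
Proof. by move=> c0; rewrite /hmean divfK// expf_neq0// gt_eqF. Qed.

(* The mean of [|f| - f] is controlled by that of [hdev], because [|f|] and its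
   projection have the same mean. *)
Lemma mean_negative_part_le s f c : 0 < c.2 -> mu.-integrable (hcube c) (EFin \o f) ->
  \int[mu]_(x in hcube c) (`|f x| - f x) <= \int[mu]_(x in hcube c) hdev s f c x.
Proof.
move=> c0 fi; have mc := @mcube R n c; have nfi := integrable_norm fi.
set P := hproj s c (fun y => `|f y|).
have hP : is_polyproj s (hcube c) (fun y => `|f y|) P by exact: hprojP.
have Pi := bddmeas_integrable mc (hcube_lty c0) (bddmeas_pev P c0).
have i1 : mu.-integrable (hcube c) (EFin \o (fun y => `|f y| - pev P y)).
  exact: (integrable_subpev P c0 nfi).
have i2 : mu.-integrable (hcube c) (EFin \o (fun y => pev P y - f y)).
  by have := integrableB mc Pi fi; apply: eq_integrable => // y _ /=; rewrite EFinB.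
have -> : \int[mu]_(x in hcube c) (`|f x| - f x) =
    \int[mu]_(x in hcube c) ((`|f x| - pev P x) + (pev P x - f x)).
  by apply: eq_Rintegral => x _; rewrite addrA subrK.
rewrite RintegralD// (Rintegral_sub_proj c0 nfi hP) add0r.
apply: le_Rintegral => //; first exact: integrable_hdev.
by move=> x _; rewrite /hdev distrC ler_norm.
Qed.

(** The projection on the larger cube enters only as some polynomial of degree at most [s], to which
    [proj_diff_bound] compares the projection on [c']. *)
Lemma hdev_compare s : exists2 C : R, 0 < C & forall f c c',
  0 < c.2 -> 0 < c'.2 -> hcube c' `<=` hcube c ->
  mu.-integrable (hcube c) (EFin \o f) -> forall x, hcube c' x ->
  hdev s f c x <= hdev s f c' x +
    C * (\int[mu]_(y in hcube c') hdev s f c y / c'.2 ^+ n + hmean s f c').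
Proof.
have [C C0 H] := @proj_diff_bound R n s; exists C => // f c c' c0 c0' c'c fi x cx.
have mc := @mcube R n c; have mc' := @mcube R n c'.
have fi' : mu.-integrable (hcube c') (EFin \o f) by exact: (integrableS mc).
pose g (y : L) := `|f y|; pose P := hproj s c g; pose P' := hproj s c' g.
have gi : mu.-integrable (hcube c) (EFin \o g) by exact: integrable_norm.
have gi' : mu.-integrable (hcube c') (EFin \o g) by exact: integrable_norm.
have [sP _] : is_polyproj s (hcube c) g P by exact: hprojP.
have hP' : is_polyproj s (hcube c') g P' by exact: hprojP.
have V0 : 0 < c'.2 ^+ n by rewrite exprn_gt0.
have hi : mu.-integrable (hcube c') (EFin \o hdev s f c).
  by apply: (integrableS mc) => //; exact: integrable_hdev.
have gfi : mu.-integrable (hcube c') (EFin \o (fun y => g y - f y)).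
  by have := integrableB mc' gi' fi'; apply: eq_integrable => // y _ /=; rewrite EFinB.
have bd : `|pev P' x - pev P x| <=
    C * (\int[mu]_(y in hcube c') hdev s f c y / c'.2 ^+ n + hmean s f c').
  rewrite /hmean -mulrDl mulrA ler_pdivlMr//.
  apply: (le_trans (H c' g P P' c0' gi' sP hP' x cx)); rewrite ler_pM2l//.
  apply: (@le_trans _ _ (\int[mu]_(y in hcube c') (hdev s f c y + (g y - f y)))).
    apply: le_Rintegral => //.
    - by apply: integrable_norm; exact: (integrable_subpev P c0' gi').
    - by have := integrableD mc' hi gfi; apply: eq_integrable.
    - move=> y _; rewrite -[g y - f y]ger0_norm ?subr_ge0 ?ler_norm// /hdev -/g -/P.
      rewrite -(_ : (f y - pev P y) + (g y - f y) = g y - pev P y); first exact: ler_normD.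
      by ring.
  by rewrite RintegralD// lerD2l; exact: mean_negative_part_le.
apply: (le_trans (ler_distD (pev P' x) (f x) (pev P x))).
by apply: lerD; [exact: lexx|exact: bd].
Qed.

End Deviation.

(** * Iteration over stopping cubes *)

Section SelfImprovement.
Context {R : realType} {n : nat}.
Local Notation L := (lebesgue_space R n).
Local Notation mu := (leb R n).
Implicit Types (c : 'rV[R]_n * R) (f : L -> R).

Lemma min_leD (x y u M : R) : 0 <= u -> x <= y + u -> Num.min x M <= Num.min y M + u.
Proof.
move=> u0 xy; have [h|h] := leP y M; first by rewrite ge_min xy.
by rewrite ge_min lerDl u0 orbT.
Qed.

Lemma integral_le_family c (S : pred nat) (d : nat -> 'rV[R]_n * R)
    (phi : L -> \bar R) (b : nat -> R) (A B : R) :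
  (forall k, S k -> hcube (d k) `<=` hcube c) ->
  trivIset [set k | S k] (hcube \o d) ->
  measurable_fun setT phi -> (forall x, 0 <= phi x)%E ->
  (forall k, S k -> \int[mu]_(x in hcube (d k)) phi x <= (b k)%:E)%E ->
  (forall N, \sum_(0 <= k < N | S k) b k <= B) ->
  (\int[mu]_(x in hcube c `\` \bigcup_(k in [set k | S k]) hcube (d k)) phi x <= A%:E)%E ->
  (\int[mu]_(x in hcube c) phi x <= (A + B)%:E)%E.
Proof.
move=> dc td mphi phi0 ib bB iA.
pose F k : set L := if S k then hcube (d k) else set0.
have UF : \bigcup_(k in [set k | S k]) hcube (d k) = \bigcup_k F k.
  apply/seteqP; split=> x.
    by move=> [k /= Sk kx]; exists k => //; rewrite /F Sk.
  by move=> [k _]; rewrite /F; case: ifP => // Sk kx; exists k.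
rewrite UF in iA.
have mF k : measurable (F k) by rewrite /F; case: ifP => _; [exact: mcube|exact: measurable0].
have mU : measurable (\bigcup_k F k) by exact: bigcup_measurable.
have mc := @mcube R n c.
have Uc : \bigcup_k F k `<=` hcube c.
  by move=> x [k _]; rewrite /F; case: ifP => // Sk; exact: dc.
have -> : hcube c = (hcube c `\` \bigcup_k F k) `|` \bigcup_k F k.
  by rewrite setUC setDUK.
rewrite ge0_integral_setU; first last.
- by rewrite disj_set2E; apply/eqP/seteqP; split=> // x [[_]].
- by move=> x _; exact: phi0.
- exact: measurable_funTS.
- exact: mU.
- exact: measurableD.
rewrite EFinD; apply: leeD; first exact: iA.
rewrite (@ge0_integral_bigcup _ _ _ mu F phi mF); first last.
- move=> k k' _ _; rewrite /F; case: ifP => Sk; case: ifP => Sk' [x []] // kx k'x.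
  by apply: td => //; exists x.
- by move=> x _; exact: phi0.
- exact: measurable_funTS.
apply: lime_le.
  by apply: is_cvg_nneseries => k _ _; apply: integral_ge0 => x _; exact: phi0.
apply: nearW => N /=.
apply: (@le_trans _ _ (\sum_(0 <= k < N | S k) (b k)%:E)%E).
  rewrite [leRHS]big_mkcond; apply: lee_sum => k _; rewrite /F.
  by case: ifP => Sk; [exact: ib|rewrite integral_set0].
by rewrite sumEFin lee_fin.
Qed.

Lemma integral_ae_le (D : set L) (phi : L -> R) (r : R) (V : R) :
  measurable D -> (mu D <= V%:E)%E -> 0 <= r ->
  measurable_fun setT phi -> (forall x, 0 <= phi x) ->
  mu [set x | D x /\ r < phi x] = 0%E ->
  (\int[mu]_(x in D) (phi x)%:E <= (r * V)%:E)%E.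
Proof.
move=> mD DV r0 mphi phi0 N0; set N : set L := [set x | D x /\ r < phi x] in N0.
have mN : measurable N by exact: measurable_leb_null.
have mDN : measurable (D `\` N) by exact: measurableD.
have mE : measurable_fun setT (fun x => (phi x)%:E) by exact/measurable_EFinP.
rewrite (@integral_setD_null _ _ _ mu D (D `\` N)).
- apply: (@le_trans _ _ (\int[mu]_(x in D `\` N) r%:E)%E).
    apply: ge0_le_integral.
    + exact: mDN.
    + by move=> x _; rewrite lee_fin.
    + exact: measurable_funTS.
    + exact: measurable_cst.
    + by move=> x [Dx nN]; rewrite lee_fin leNgt; apply/negP => h; apply: nN.
  rewrite integral_cst// EFinM; apply: lee_wpmul2l; first by rewrite lee_fin.
  by apply: le_trans DV; apply: le_leb => x [].
- exact: mD.
- exact: mDN.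
- by move=> x [].
- apply/eqP; rewrite eq_le measure_ge0 andbT -N0; apply: le_leb => x [Dx].
  by move=> /not_andP[//|/contrapT].
- exact: measurable_funTS.
Qed.

(** [t] stands for q / p, so that [1 - t] and [t] are the Hoelder weights of the volumes and of the
    dominating quantities. *)
Variables (s : nat) (p t : R).
Hypotheses (t01 : 0 < t < 1) (q1 : 1 <= p * t).
Local Notation q := (p * t).

(* [K] plays the role of the p-th power of the norm localized to a cube. *)
Definition dominating f r (K : 'rV[R]_n * R -> R) :=
  [/\ forall c, 0 < c.2 -> hcube c `<=` hcube r -> 0 <= K c,
      forall c, 0 < c.2 -> hcube c `<=` hcube r -> hmean s f c `^ p * c.2 ^+ n <= K c &
      forall c (S : pred nat) (d : nat -> 'rV[R]_n * R) N,
        0 < c.2 -> hcube c `<=` hcube r ->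
        (forall k, S k -> 0 < (d k).2 /\ hcube (d k) `<=` hcube c) ->
        trivIset [set k | S k] (hcube \o d) ->
        \sum_(0 <= k < N | S k) K (d k) <= K c].

Let w : R := 2 `^ ((1 - t) / 2).

Let w1 : 1 < w.
Proof.
have /andP[t0 t1] := t01; rewrite /w -[ltLHS](powRr0 2) /powR !pnatr_eq0 /= ltr_expR.
by rewrite mul0r mulr_gt0 ?divr_gt0 ?subr_gt0// ln_gt0// ltr1n.
Qed.

Let ww : w * w = 2 `^ (1 - t).
Proof.
have E : (1 - t) / 2 + (1 - t) / 2 = 1 - t by rewrite -splitr.
by rewrite /w -powRD; [rewrite E|rewrite pnatr_eq0 implybT].
Qed.

Let ww2 : w * w <= 2.
Proof.
have /andP[t0 t1] := t01; rewrite ww -[leRHS]powRr1//; apply: ler_powR; last lra.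
by rewrite ler1n.
Qed.

Lemma truncated_bound : exists2 C : R, 0 < C & forall f r K,
  measurable_fun setT f -> mu.-integrable (hcube r) (EFin \o f) ->
  dominating f r K -> forall (M : R) (J : nat) c, 0 <= M -> 0 < c.2 ->
  hcube c `<=` hcube r ->
  (\int[mu]_(x in hcube c) ((Num.min (hdev s f c x) M) `^ q)%:E <=
   (C * ((c.2 ^+ n) `^ (1 - t) * K c `^ t) + w^-1 ^+ J * M `^ q * c.2 ^+ n)%:E)%E.
Proof.
have /andP[t0 t1] := t01; have q0 : 0 <= q by rewrite (le_trans _ q1).
have w0 : 0 < w by rewrite (lt_trans _ w1).
have [C0 C00 Hcmp] := @hdev_compare R n s.
(* Chosen so that (1 + eta)^q = w. *)
pose eta : R := w `^ q^-1 - 1.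
have qp : 0 < q by rewrite (lt_le_trans _ q1).
have eta0 : 0 < eta.
  rewrite subr_gt0 /powR gt_eqF// -[ltLHS]expR0 ltr_expR.
  by rewrite mulr_gt0 ?invr_gt0// ln_gt0.
have etaw : (1 + eta) `^ q = w.
  by rewrite /eta addrC subrK -powRrM mulVf ?gt_eqF// powRr1// ltW.
pose cw : R := (1 + eta^-1) `^ q.
pose c1 : R := cw * (C0 `^ q * (2 `^ q * (2 ^+ n * 2) `^ q)).
pose c2 : R := cw * (C0 `^ q * 2 `^ q).
have c10 : 0 <= c1 by rewrite !mulr_ge0// powR_ge0.
have c20 : 0 <= c2 by rewrite !mulr_ge0// powR_ge0.
have iw : 0 < 1 - w^-1 by rewrite subr_gt0 invf_lt1.
(* The fixed point of C = 2^q + c1 + c2 + C / w, whose last term is the recursive contribution. *)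
pose C : R := (2 `^ q + c1 + c2) / (1 - w^-1).
have C_gt0 : 0 < C by rewrite divr_gt0// ltr_wpDr// ltr_wpDr// powR_gt0.
exists C => // f r K mf fi [K0 Kmean Ksum] M J.
have mphi M' c : measurable_fun setT (fun x => (Num.min (hdev s f c x) M') `^ q).
  exact: (measurableT_comp (measurable_powR _)
    (measurable_minr (measurable_hdev s c mf) (measurable_cst M'))).
elim: J => [|J IH] c M0 c0 cr.
  rewrite expr0 mul1r.
  have V0 : 0 < c.2 ^+ n by rewrite exprn_gt0.
  apply: (@le_trans _ _ (M `^ q * c.2 ^+ n)%:E); last first.
    rewrite lee_fin lerDr; apply: mulr_ge0; first exact: ltW.
    by apply: mulr_ge0; exact: powR_ge0.
  apply: integral_ae_le.
  - exact: mcube.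
  - by rewrite leb_gcube.
  - exact: powR_ge0.
  - exact: mphi.
  - by move=> x; exact: powR_ge0.
  rewrite (_ : [set x | _] = set0) ?measure0// -subset0 => x [_].
  rewrite ltNge => /negP; apply; apply: le_powR => //.
    by rewrite le_min hdev_ge0.
  by rewrite ge_min lexx orbT.
set V := c.2 ^+ n; have V0 : 0 < V by rewrite exprn_gt0.
have fci : mu.-integrable (hcube c) (EFin \o f).
  exact: (integrableS (@mcube R n r) (@mcube R n c)).
set a := hmean s f c; have a0 : 0 <= a by exact: hmean_ge0.
have hdi := integrable_hdev s c0 fci.
have ia : (\int[mu]_(x in hcube c) (hdev s f c x)%:E = (a * V)%:E)%E.
  rewrite -(hmeanK s f c0) /Rintegral fineK//; apply: (integrable_fin_num _ hdi); exact: mcube.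
have l0 : 0 <= a *+ 2 by rewrite mulrn_wge0.
have mh := measurable_hdev s c mf.
have ha : (\int[mu]_(x in hcube c) (hdev s f c x)%:E <= (a *+ 2 * V)%:E)%E.
  by rewrite ia lee_fin ler_pM2r// mulr2n lerDl.
have [S [d [dsub dtriv dlow dup dnull]]] := calderon_zygmund c0 l0 mh (hdev_ge0 s f c) ha.
have dsub1 k : S k -> hcube (d k) `<=` hcube c by move=> /dsub[].
have dr k : S k -> hcube (d k) `<=` hcube r.
  by move=> Sk; exact: subset_trans (dsub1 _ Sk) cr.
have d0 k : S k -> 0 < (d k).2 by move=> /dsub[].
pose v k := (d k).2 ^+ n.
have v0 k : S k -> 0 < v k by move=> Sk; rewrite exprn_gt0// d0.
have E0 : 0 <= w^-1 ^+ J * M `^ q.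
  by apply: mulr_ge0; [rewrite exprn_ge0// invr_ge0 ltW|exact: powR_ge0].
set Z := V `^ (1 - t) * K c `^ t.
have aZ : a `^ q * V <= Z by apply: powR_interpolation => //; exact: Kmean.
have sumv N : \sum_(0 <= k < N | S k) v k <= V / 2.
  have mEh : measurable_fun setT (fun x => (hdev s f c x)%:E) by exact/measurable_EFinP.
  have hE0 x : (0 <= (hdev s f c x)%:E)%E by rewrite lee_fin hdev_ge0.
  have sle := @sum_integral_hcube_le R n S d c _ N dsub1 dtriv mEh hE0.
  rewrite ia in sle.
  have lower : \sum_(0 <= k < N | S k) (a *+ 2 * v k) <= a * V.
    rewrite -lee_fin -sumEFin; apply: le_trans sle; apply: lee_sum => k Sk.
    exact/ltW/dlow.
  have [a00|apos] := eqVneq a 0; last first.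
    have a20 : 0 < a *+ 2 by rewrite pmulrn_lgt0// lt_neqAle eq_sym apos.
    rewrite -(ler_pM2l a20) mulr_sumr (le_trans lower)//.
    by rewrite le_eqVlt; apply/orP; left; apply/eqP; field.
  (* If the mean [a] is 0, no cube is selected, because selection demands a strict excess. *)
  rewrite big_pred0 ?divr_ge0 ?ltW// => k; apply/negP => Sk.
  have := dlow k Sk; rewrite ltNge => /negP; apply.
  rewrite a00 mul0rn mul0r; apply: (@le_trans _ _ (a * V)%:E); last by rewrite a00 mul0r.
  rewrite -ia; apply: ge0_subset_integral.
  - exact: mcube.
  - exact: mcube.
  - exact: measurable_funTS.
  - by move=> x _.
  - exact: dsub1.
pose phi c' (x : L) := (Num.min (hdev s f c' x) M) `^ q.
(* The bound on one stopping cube: [w] times the induction hypothesis, plus the contribution of the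
   constant shift [u] below. [A] is the part off the stopping cubes, and [B] bounds the sums of the
   [b k]. *)
pose b k := w * (C * (v k `^ (1 - t) * K (d k) `^ t) + w^-1 ^+ J * M `^ q * v k) +
  (c1 * (a `^ q * v k) + c2 * (v k `^ (1 - t) * K (d k) `^ t)).
pose A := (2 * a) `^ q * V.
pose B := w * (C * ((V / 2) `^ (1 - t) * K c `^ t) + w^-1 ^+ J * M `^ q * (V / 2)) +
  (c1 * Z + c2 * Z).
apply: (@le_trans _ _ (A + B)%:E); last first.
  rewrite lee_fin.
  have AZ : A <= 2 `^ q * Z.
    by rewrite /A powRM// -mulrA ler_wpM2l// powR_ge0.
  rewrite /B; have -> : (V / 2) `^ (1 - t) * K c `^ t = Z / (w * w).
    by rewrite powRM ?invr_ge0 ?(ltW V0)// powRV// -ww /Z mulrAC.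
  have CE : C = 2 `^ q + c1 + c2 + C / w.
    rewrite /C; field; rewrite !gt_eqF//.
    by rewrite subr_gt0.
  (* The truncation error gains the full factor 1/2 from the volumes, and w / 2 <= 1 / w because w^2
     <= 2. *)
  have tau : w * (w^-1 ^+ J * M `^ q * (V / 2)) <= w^-1 ^+ J.+1 * M `^ q * V.
    rewrite exprS (_ : w * _ = (w^-1 ^+ J * M `^ q * V) * (w / 2)); last by field.
    rewrite (_ : w^-1 * _ * _ * V = (w^-1 ^+ J * M `^ q * V) * w^-1); last by ring.
    apply: ler_wpM2l.
      exact: mulr_ge0 E0 (ltW V0).
    by rewrite ler_pdivrMr// ler_pdivlMl; first exact: ww2.
  rewrite mulrDr [leRHS](_ : _ = (2 `^ q * Z + C / w * Z + c1 * Z + c2 * Z) +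
    w^-1 ^+ J.+1 * M `^ q * V); last by rewrite {1}CE; ring.
  have -> : w * (C * (Z / (w * w))) = C / w * Z by field; rewrite gt_eqF.
  by rewrite -!addrA; apply: lerD => //; rewrite lerD2l addrC -!addrA !lerD2l.
apply: (@integral_le_family c S d _ b).
- exact: dsub1.
- exact: dtriv.
- exact/measurable_EFinP/mphi.
- by move=> x; rewrite lee_fin powR_ge0.
- move=> k Sk; have dk0 := d0 k Sk.
  pose u := C0 * (2 ^+ n * (a *+ 2) + hmean s f (d k)).
  have hk0 := hmean_ge0 s f dk0.
  have l20 : 0 <= 2 ^+ n * (a *+ 2) by apply: mulr_ge0 l0; exact: exprn_ge0.
  have u0 : 0 <= u := mulr_ge0 (ltW C00) (addr_ge0 l20 hk0).
  have pt x : hcube (d k) x -> phi c x <= w * phi (d k) x + cw * u `^ q.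
    move=> kx; have := Hcmp f c (d k) c0 dk0 (dsub1 k Sk) fci x kx.
    have hfin : mu.-integrable (hcube (d k)) (EFin \o hdev s f c).
      exact: (integrableS (@mcube R n c) (@mcube R n (d k)) (dsub1 k Sk) hdi).
    have mean_le : \int[mu]_(y in hcube (d k)) hdev s f c y / (d k).2 ^+ n <= 2 ^+ n * (a *+ 2).
      rewrite ler_pdivrMr ?v0// -lee_fin /Rintegral fineK; last first.
        by apply: (integrable_fin_num _ hfin); exact: mcube.
      by rewrite -mulrA; exact: dup k Sk.
    move=> cmp; have {}cmp : hdev s f c x <= hdev s f (d k) x + u.
      by apply: (le_trans cmp); rewrite lerD2l ler_pM2l// lerD2r.
    rewrite /phi -etaw.
    apply: le_trans (powRD_split q0 eta0 _ u0); last by rewrite le_min hdev_ge0.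
    apply: le_powR => //; first by rewrite le_min hdev_ge0.
    exact: min_leD.
  have ub : cw * u `^ q <= c1 * a `^ q + c2 * hmean s f (d k) `^ q.
    rewrite /c1 /c2 -!mulrA -mulrDr; apply: ler_wpM2l; first exact: powR_ge0.
    rewrite /u powRM ?(ltW C00) ?(addr_ge0 l20 hk0)// -mulrDr.
    apply: ler_wpM2l; first exact: powR_ge0.
    have -> : 2 ^+ n * (a *+ 2) = (2 ^+ n * 2) * a by rewrite -mulr_natr; ring.
    have n20 : 0 <= 2 ^+ n * 2 :> R by rewrite mulr_ge0// exprn_ge0.
    apply: (le_trans (powRD_le q0 (mulr_ge0 n20 a0) hk0)).
    by rewrite (@powRM R _ _ _ n20 a0) mulrDr.
  have hZ : hmean s f (d k) `^ q * v k <= v k `^ (1 - t) * K (d k) `^ t.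
    apply: powR_interpolation => //; first exact: v0.
    by apply: Kmean => //; exact: dr.
  have mdk := @mcube R n (d k).
  apply: (@le_trans _ _ (\int[mu]_(x in hcube (d k)) ((w * phi (d k) x)%:E + (cw * u `^ q)%:E)%E)%E).
    apply: ge0_le_integral.
    + exact: mdk.
    + by move=> x _; rewrite lee_fin powR_ge0.
    + by apply: measurable_funTS; exact/measurable_EFinP/mphi.
    + apply: measurable_funTS; apply: emeasurable_funD.
        by apply/measurable_EFinP; apply: measurable_funM; [exact: measurable_cst|exact: mphi].
      exact: measurable_cst.
    + by move=> x kx; rewrite -EFinD lee_fin; exact: pt.
  rewrite ge0_integralD; first last.
  + exact: measurable_cst.
  + by move=> x _; rewrite lee_fin mulr_ge0// powR_ge0.
  + apply: measurable_funTS.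
    by apply/measurable_EFinP; apply: measurable_funM; [exact: measurable_cst|exact: mphi].
  + by move=> x _; rewrite lee_fin mulr_ge0 ?powR_ge0// ltW.
  + exact: mdk.
  rewrite /b EFinD; apply: leeD.
    under eq_integral do rewrite EFinM.
    rewrite ge0_integralZl; first last.
    + by rewrite lee_fin ltW.
    + by move=> x _; rewrite lee_fin powR_ge0.
    + by apply: measurable_funTS; exact/measurable_EFinP/mphi.
    + exact: mdk.
    rewrite EFinM; apply: lee_wpmul2l; first by rewrite lee_fin ltW.
    by apply: IH => //; exact: dr.
  rewrite integral_cst_hcube// lee_fin.
  apply: (@le_trans _ _ ((c1 * a `^ q + c2 * hmean s f (d k) `^ q) * v k)).
    by rewrite ler_pM2r ?v0.
  rewrite mulrDl -(mulrA c1) -(mulrA c2) lerD2l; exact: (ler_wpM2l c20 hZ).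
- move=> N; have V20 : 0 < V / 2 by rewrite divr_gt0.
  have hK : \sum_(0 <= k < N | S k) K (d k) <= K c by apply: Ksum.
  have K0' k : S k -> 0 <= K (d k) by move=> Sk; apply: K0; [exact: d0|exact: dr].
  have v0' k : S k -> 0 <= v k by move=> /v0/ltW.
  have h1 := sum_powR_holder t01 V20 v0' K0' (sumv N) hK.
  (* Only the recursive terms need the gain from [V / 2]; for the others the cruder bound by [V]
     suffices. *)
  have h2 : \sum_(0 <= k < N | S k) v k `^ (1 - t) * K (d k) `^ t <= Z.
    apply: sum_powR_holder => //; apply: (le_trans (sumv N)).
    by rewrite ler_pdivrMr// mulr2n mulrDr mulr1 lerDl ltW.
  have h3 : \sum_(0 <= k < N | S k) (a `^ q * v k) <= Z.
    rewrite -mulr_sumr; apply: le_trans aZ; apply: ler_wpM2l; first exact: powR_ge0.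
    by apply: (le_trans (sumv N)); rewrite ler_pdivrMr// mulr2n mulrDr mulr1 lerDl ltW.
  rewrite /b /B !big_split/= -!mulr_sumr big_split/= -!mulr_sumr.
  apply: lerD; first apply: ler_wpM2l; first exact: ltW.
    apply: lerD; first exact: (ler_wpM2l (ltW C_gt0)).
    exact: (ler_wpM2l E0).
  by apply: lerD; apply: ler_wpM2l => //; rewrite mulr_sumr in h3 *.
- rewrite /A; apply: integral_ae_le.
  + by apply: measurableD; [exact: mcube|apply: bigcup_measurable => k _; exact: mcube].
  + by rewrite -(leb_gcube (fun=> true) (fun=> true) c0); apply: le_leb => x [].
  + exact: powR_ge0.
  + exact: mphi.
  + by move=> x; exact: powR_ge0.
  apply/eqP; rewrite eq_le measure_ge0 andbT -dnull; apply: le_leb => x [[cx nU] hx].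
  split=> // [k Sk kx|]; first by apply: nU; exists k.
  rewrite ltNge; apply/negP => h; move: hx; rewrite ltNge => /negP; apply.
  apply: le_powR => //; first by rewrite le_min hdev_ge0.
  by rewrite ge_min (_ : 2 * a = a *+ 2) ?h// mulr_natl.
Qed.

End SelfImprovement.

Section LocalBound.
Context {R : realType} {n : nat}.
Local Notation L := (lebesgue_space R n).
Local Notation mu := (leb R n).

(** The order of the limits matters: for fixed [M] the error vanishes as [J] grows, and only then is
    [M] removed by monotone convergence. *)
Lemma local_bound (s : nat) (p t : R) : 0 < t < 1 -> 1 <= p * t ->
  exists2 C : R, 0 < C & forall (f : L -> R) r K,
  measurable_fun setT f -> 0 < r.2 -> mu.-integrable (hcube r) (EFin \o f) ->
  dominating s p f r K ->
  (\int[mu]_(x in hcube r) ((hdev s f r x) `^ (p * t))%:E <=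
   (C * ((r.2 ^+ n) `^ (1 - t) * K r `^ t))%:E)%E.
Proof.
move=> t01 q1; have [C C0 H] := @truncated_bound R n s p t t01 q1.
set q := p * t in q1 H *; have q0 : 0 <= q by rewrite (le_trans _ q1).
exists C => // f r K mf r0 fi dK; have mr := @mcube R n r.
set B := C * _.
have mphi M : measurable_fun setT (fun x : L => ((Num.min (hdev s f r x) M) `^ q)%:E).
  apply/measurable_EFinP; exact: (measurableT_comp (measurable_powR _)
    (measurable_minr (measurable_hdev s r mf) (measurable_cst M))).
have min0 M x : 0 <= M -> 0 <= Num.min (hdev s f r x) M.
  by move=> M0; rewrite le_min hdev_ge0.
have bM (M : R) : 0 <= M ->
    (\int[mu]_(x in hcube r) ((Num.min (hdev s f r x) M) `^ q)%:E <= B%:E)%E.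
  move=> M0; set I := (\int[_]_(_ in _) _)%E.
  have I0 : (0 <= I)%E by apply: integral_ge0 => x _; rewrite lee_fin powR_ge0.
  have HJ J := H f r K mf fi dK M J r M0 r0 (@subset_refl _ _).
  have Ifin : I \is a fin_num.
    by rewrite ge0_fin_numE//; apply: le_lt_trans (HJ 0%N) _; exact: ltry.
  rewrite -(fineK Ifin) lee_fin.
  set w : R := (2 `^ ((1 - t) / 2))^-1.
  have w1 : `|w| < 1.
    rewrite ger0_norm ?invr_ge0 ?powR_ge0// invf_lt1 ?powR_gt0//.
    have /andP[t0 t1] := t01; rewrite -[ltLHS](powRr0 2) /powR !pnatr_eq0 /= ltr_expR.
    by rewrite mul0r mulr_gt0 ?divr_gt0 ?subr_gt0// ln_gt0// ltr1n.
  have cv : (fun J => B + w ^+ J * (M `^ q * r.2 ^+ n)) @ \oo --> B.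
    rewrite -[X in _ --> X]addr0; apply: cvgD; first exact: cvg_cst.
    rewrite -(mul0r (M `^ q * r.2 ^+ n)); apply: cvgM; last exact: cvg_cst.
    exact: cvg_expr.
  apply: (cvgr_to_ge cv); apply: nearW => J.
  by rewrite mulrA -lee_fin fineK//; exact: HJ.
pose g (m : nat) (x : L) : \bar R := ((Num.min (hdev s f r x) m%:R) `^ q)%:E.
have -> : (\int[mu]_(x in hcube r) ((hdev s f r x) `^ q)%:E =
    \int[mu]_(x in hcube r) limn (g^~ x))%E.
  apply: eq_integral => x _; apply/esym/cvg_lim => //.
  apply: cvg_near_cst; exists (Num.truncn (hdev s f r x)).+1 => // m /= lm.
  rewrite /g min_l//; apply/ltW/(lt_le_trans (truncnS_gt _)).
  by rewrite ler_nat.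
have cv := @cvg_monotone_convergence _ _ _ mu (hcube r) mr g.
apply: (cvge_to_le (cv _ _ _)).
- by move=> m; apply: measurable_funTS; exact: mphi.
- by move=> m x _; rewrite lee_fin powR_ge0.
- move=> x _ m m' mm'; rewrite lee_fin; apply: le_powR => //; first exact: min0.
  by rewrite le_min !ge_min lexx /= ler_nat mm' orbT.
- by apply: nearW => m; exact: bM.
Qed.

End LocalBound.

(** * Packings *)

Section PackingSup.
Context {R : realType} {n : nat}.
Implicit Types (c : 'rV[R]_n * R) (a : set 'rV[R]_n -> \bar R) (Q X Y : set 'rV[R]_n).

Lemma ocube_center c : 0 < c.2 -> exists x, ocube c x.
Proof.
move=> c0; exists (\row_i (c.1 ord0 i + c.2 / 2)) => i.
by rewrite mxE in_itv /=; apply/andP; split; lra.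
Qed.

Lemma is_cube_nonempty Q : is_cube Q -> exists x, Q x.
Proof.
move=> /is_cubeP[b [e [c [c0 ->]]]]; have [x cx] := ocube_center c0.
by exists x; exact: ocube_sub.
Qed.

Lemma is_cube_ocube c : 0 < c.2 -> is_cube (ocube c).
Proof. by move=> c0; apply/is_cubeP; exists (fun=> false), (fun=> true), c. Qed.

Lemma ocube_interior b e c : ocube c `<=` (gcube b e c)°.
Proof.
move=> x cx; exists (fun i j => [set` `]c.1 i j, (c.1 i j + c.2)[]).
  move=> i j; rewrite ord1; have := cx j; rewrite /= => xj.
  exact: (@near_in_itvoo R _ _ _ xj).
move=> y /= yc; apply: ocube_sub => i; exact: yc.
Qed.

(** Testing the inclusion at the lower corner of [c'] and at points tending to its excluded upper
    corner compares the endpoints. *)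
Lemma ocube_subset c c' : 0 < c'.2 -> hcube c' `<=` hcube c -> ocube c' `<=` ocube c.
Proof.
move=> c0' sub x xc' i.
have := xc' i; rewrite !in_itv/= => /andP[h1 h2].
have /hcubeP/(_ i)/andP[l1 _] : hcube c c'.1.
  by apply: sub; apply/hcubeP => j; rewrite lexx ltrDl.
rewrite (le_lt_trans l1 h1) /=; apply: (lt_le_trans h2).
apply/ler_addgt0Pr => e e0.
have m0 : 0 < Num.min e c'.2 by rewrite lt_min e0.
(* A point of [hcube c'] within [e] of the upper corner; the minimum with the side keeps it in the
   cube when [e] is large. *)
have /hcubeP/(_ i)/andP[_ l2] : hcube c (c'.1 + const_mx (c'.2 - Num.min e c'.2)).
  apply: sub; apply/hcubeP => j; rewrite !mxE lerDl subr_ge0 ge_min lexx orbT /=.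
  by rewrite ltrD2l ltrBlDr ltrDl.
rewrite !mxE in l2; have me : Num.min e c'.2 <= e by rewrite ge_min lexx.
lra.
Qed.

(** For [a] the [pksup_term] below, this is the p-th power of the norm, regarded as a function of
    the set [X]. *)
Definition pksup a X := ereal_sup [set \esum_(Q in C) a Q | C in packing X].

Variable a : set 'rV[R]_n -> \bar R.
Hypothesis a0 : forall Q, (0 <= a Q)%E.

Lemma packing0 X : packing X set0.
Proof. by split=> [Q []|Q Q' []]. Qed.

Lemma pksup_ge0 X : (0 <= pksup a X)%E.
Proof.
apply: ereal_sup_ubound; exists set0; first exact: packing0.
by rewrite esum_set0.
Qed.

Lemma packingS X Y C : X `<=` Y -> packing X C -> packing Y C.
Proof.
by move=> XY [cC tC]; split=> // Q /cC[cQ QX]; split=> //; exact: subset_trans XY.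
Qed.

Lemma pksupS X Y : X `<=` Y -> (pksup a X <= pksup a Y)%E.
Proof.
move=> XY; apply: ge_ereal_sup => _ [C pC <-]; apply: ereal_sup_ubound.
by exists C => //; exact: packingS pC.
Qed.

Lemma pksup_cube Q X : is_cube Q -> Q `<=` X -> (a Q <= pksup a X)%E.
Proof.
move=> cQ QX; apply: ereal_sup_ubound; exists [set Q]; last by rewrite esum_set1.
by split=> [_ ->//|Q1 Q2 -> ->].
Qed.

(** A packing of [X] and one of [Y] together form a packing of the union. They share no member,
    since cubes are nonempty. *)
Lemma pksupU X Y : X `&` Y = set0 -> (pksup a X + pksup a Y <= pksup a (X `|` Y))%E.
Proof.
move=> XY0; set S := pksup a (_ `|` _).
have key C D : packing X C -> packing Y D ->
    (\esum_(Q in C) a Q + \esum_(Q in D) a Q <= S)%E.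
  move=> [cC tC] [cD tD].
  have CD : C `&` D = set0.
    apply/seteqP; split=> // Q [CQ DQ]; have [cQ QX] := cC Q CQ; have [_ QY] := cD Q DQ.
    have [x Qx] := is_cube_nonempty cQ; have : (X `&` Y) x by split; [exact: QX|exact: QY].
    by rewrite XY0.
  apply: ereal_sup_ubound; exists (C `|` D).
    split=> [Q [/cC[cQ QX]|/cD[cQ QY]]|].
    - by split=> //; apply: subset_trans QX _; left.
    - by split=> //; apply: subset_trans QY _; right.
    have dis Q Q' : C Q -> D Q' -> Q° `&` Q'° !=set0 -> False.
      move=> /cC[_ QX] /cD[_ QY] [x [/interior_subset/QX Xx /interior_subset/QY Yx]].
      by have : (X `&` Y) x by []; rewrite XY0.
    move=> Q Q' [CQ|DQ] [CQ'|DQ'] QQ'; [exact: tC| | |exact: tD].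
      by have := dis _ _ CQ DQ' QQ'.
    by rewrite setIC in QQ'; have := dis _ _ CQ' DQ QQ'.
  rewrite (esumID C)//; congr (_ + _)%E; congr (\esum_(_ in _) _).
    by apply/seteqP; split=> [Q [//]|Q CQ]; split=> //; left.
  by rewrite setIUl setICr set0U; apply/setIidPl => Q DQ CQ; have : (C `&` D) Q by []; rewrite CD.
(* The two suprema are taken one after the other by moving terms across the inequality, which
   requires them to be finite. *)
have := leey S; rewrite le_eqVlt => /orP[/eqP ->|Soo]; first exact: leey.
have fin Z : Z `<=` X `|` Y -> pksup a Z \is a fin_num.
  by move=> ZS; rewrite ge0_fin_numE ?pksup_ge0//; apply: le_lt_trans Soo; exact: pksupS.
have finX : pksup a X \is a fin_num by apply: fin; left.
have finY : pksup a Y \is a fin_num by apply: fin => x; right.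
rewrite -leeBrDr//; apply: ge_ereal_sup => _ [C pC <-].
have fC : \esum_(Q in C) a Q \is a fin_num.
  rewrite ge0_fin_numE ?esum_ge0//; apply: le_lt_trans Soo.
  by have := key C set0 pC (packing0 Y); rewrite esum_set0 adde0.
rewrite leeBrDr// addeC -leeBrDr//; apply: ge_ereal_sup => _ [D pD <-].
by rewrite leeBrDr// addeC; exact: key.
Qed.

Lemma pksup_sum (I : eqType) (r : seq I) (Y : I -> set 'rV[R]_n) X :
  uniq r -> (forall i, i \in r -> Y i `<=` X) ->
  (forall i j, i \in r -> j \in r -> i != j -> Y i `&` Y j = set0) ->
  (\sum_(i <- r) pksup a (Y i) <= pksup a X)%E.
Proof.
move=> ur YX tY; apply: (@le_trans _ _ (pksup a (\bigcup_(i in [set` r]) Y i))); last first.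
  by apply: pksupS => x [i /= ir]; exact: YX.
elim: r ur tY {YX} => [|i r IH] /=; first by rewrite big_nil pksup_ge0.
move=> /andP[ir ur] tY; rewrite big_cons.
have -> : \bigcup_(j in [set` i :: r]) Y j = Y i `|` \bigcup_(j in [set` r]) Y j.
  apply/seteqP; split=> x.
    move=> [j]; rewrite /= inE => /orP[/eqP ->|jr]; first by left.
    by right; exists j.
  move=> [Yx|[j /= jr Yx]]; [exists i => //=|exists j => //=]; rewrite inE ?eqxx//.
  by rewrite jr orbT.
apply: le_trans (pksupU _); last first.
  apply/seteqP; split=> // x [Yx [j /= jr Yjx]].
  have : (Y i `&` Y j) x by [].
  rewrite tY ?mem_head// ?inE ?jr ?orbT//.
  by apply: contraNneq ir => ->.
apply: leeD2l; apply: IH => // j k jr kr; apply: tY; by rewrite inE ?jr ?kr orbT.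
Qed.

(** Superadditivity needs disjoint sets, whereas cubes of a packing may meet along their boundaries;
    hence the interiors. *)
Lemma pksup_esum X C : packing X C -> (\esum_(Q in C) pksup a Q° <= pksup a X)%E.
Proof.
move=> [cC tC]; apply: ge_ereal_sup => _ [F [finF FC] <-].
rewrite fsbig_finite//=; apply: pksup_sum.
- exact: finmap.fset_uniq.
- move=> Q; rewrite in_fset_set// inE => /FC/cC[_ QX].
  exact: subset_trans (@interior_subset _ _) QX.
- move=> Q Q'; rewrite !in_fset_set// !inE => /FC CQ /FC CQ' /eqP QQ'.
  apply/seteqP; split=> // x xQQ'; apply: QQ'; apply: tC => //.
  by exists x.
Qed.

End PackingSup.

(** * Oscillation on arbitrary cubes *)

Section Oscillation.
Context {R : realType} {n : nat}.
Local Notation L := (lebesgue_space R n).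
Local Notation mu := (leb R n).
Implicit Types (c r : 'rV[R]_n * R) (f : L -> R).

(** Each variant contains the open cube and has the same volume. [phi] may change sign, as it does
    in the moment conditions of [is_polyproj]. *)
Lemma integral_gcube b e c (phi : L -> \bar R) : 0 < c.2 ->
  measurable_fun setT phi ->
  (\int[mu]_(x in gcube b e c) phi x = \int[mu]_(x in hcube c) phi x)%E.
Proof.
move=> c0 mphi.
have mg b' e' : measurable (gcube b' e' c : set L).
  by apply: measurable_leb; exact: measurable_gcube.
have H b' e' : (\int[mu]_(x in gcube b' e' c) phi x = \int[mu]_(x in ocube c) phi x)%E.
  apply: integral_setD_null => //.
  - exact: mg.
  - exact: ocube_sub.
  - rewrite measureD.
    + rewrite setIidr; last exact: ocube_sub.
      rewrite [X in (X - _)%E](leb_gcube b' e' c0).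
      by rewrite [X in (_ - X)%E](leb_gcube _ _ c0) subee.
    + exact: mg.
    + exact: mg.
    + by rewrite [X in (X < _)%E](leb_gcube b' e' c0) ltry.
  - exact: measurable_funTS.
by rewrite !H.
Qed.

Lemma vol_gcube b e c : 0 < c.2 -> vol (gcube b e c) = c.2 ^+ n.
Proof. by move=> c0; rewrite /vol leb_gcube. Qed.

Lemma polyproj_gcube s b e c f : 0 < c.2 -> measurable_fun setT f ->
  polyproj s (gcube b e c) f = pev (hproj s c f).
Proof.
move=> c0 mf; apply/funext => x; rewrite /polyproj /hproj /pev.
suff -> : [set P | is_polyproj s (gcube b e c) f P] =
          [set P | is_polyproj s (hcube c) f P] by [].
have E P g : (\int[mu]_(x in gcube b e c) ((f x - mpoly.meval (x ord0) P) *
      \prod_(i < n) x ord0 i ^+ (g : mpoly.multinom n) i)%:E =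
    \int[mu]_(x in hcube c) ((f x - mpoly.meval (x ord0) P) *
      \prod_(i < n) x ord0 i ^+ (g : mpoly.multinom n) i)%:E)%E.
  apply: (integral_gcube b e c0); apply/measurable_EFinP; apply: measurable_funM.
    apply: (measurable_funB mf).
    by apply: (@measurable_fun_leb R n _ _ (pev P)); exact: measurable_pev.
  apply: (@measurable_fun_leb R n _ _ (fun x => \prod_(i < n) x ord0 i ^+ (g : mpoly.multinom n) i)).
  by apply: measurable_prod => i _; apply: measurable_funX; exact: measurable_coord.
by apply/seteqP; split=> P [sP oP]; split=> // g /oP; rewrite E.
Qed.

Lemma osc_gcube q s alpha f b e c : 0 < c.2 -> measurable_fun setT f ->
  osc q s alpha f (gcube b e c) =
  (((c.2 ^+ n) `^ (- alpha))%:E * ((c.2 ^+ n)^-1%:E *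
    \int[mu]_(x in hcube c) (hdev s f c x `^ q)%:E) `^ q^-1)%E.
Proof.
move=> c0 mf; have mnf : measurable_fun setT (fun y => `|f y|).
  exact: (measurableT_comp (@normr_measurable R setT) mf).
have mh : measurable_fun setT (fun x : L => (hdev s f c x `^ q)%:E).
  apply/measurable_EFinP.
  exact: (measurableT_comp (measurable_powR _) (measurable_hdev s c mf)).
by rewrite -(integral_gcube b e c0 mh) /osc (vol_gcube b e c0) (polyproj_gcube s b e c0 mnf).
Qed.

Lemma osc1_gcube s alpha f b e c : 0 < c.2 -> measurable_fun setT f ->
  mu.-integrable (hcube c) (EFin \o f) ->
  osc 1 s alpha f (gcube b e c) = ((c.2 ^+ n) `^ (- alpha) * hmean s f c)%:E.
Proof.
move=> c0 mf fi; rewrite osc_gcube// invr1 poweRe1; last first.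
  rewrite mule_ge0// ?lee_fin ?invr_ge0 ?exprn_ge0 ?(ltW c0)//.
  by apply: integral_ge0 => x _; rewrite lee_fin powR_ge0.
rewrite EFinM; congr (_ * _)%E.
under eq_integral do rewrite powRr1 ?hdev_ge0//.
rewrite /hmean mulrC EFinM; congr (_ * _)%E.
by rewrite /Rintegral fineK//; apply: (integrable_fin_num _ (integrable_hdev s c0 fi)); exact: mcube.
Qed.

Lemma osc_ge0 q s alpha f Q : (0 <= osc q s alpha f Q)%E.
Proof. by apply: mule_ge0; rewrite ?lee_fin ?powR_ge0// poweR_ge0. Qed.

Lemma vol_ge0 (Q : set 'rV[R]_n) : 0 <= vol Q.
Proof. by rewrite /vol fine_ge0// mu_ext_ge0. Qed.

Definition pksup_term q s alpha (p : R) f (Q : set 'rV[R]_n) : \bar R :=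
  ((vol Q)%:E * osc q s alpha f Q `^ p)%E.

Lemma pksup_term_ge0 q s alpha p f Q : (0 <= pksup_term q s alpha p f Q)%E.
Proof. by apply: mule_ge0; [rewrite lee_fin vol_ge0|exact: poweR_ge0]. Qed.

(** For [c] inside [r] the weight |c|^(alpha p) is at most |r|^(alpha p). Freezing it at [r] keeps
    the superadditivity of [pksup]. Open cubes are used because they fit into the interiors of the
    cubes of a packing. *)
Lemma dominating_pksup s alpha p f r : 0 <= alpha -> 0 <= p ->
  measurable_fun setT f -> 0 < r.2 -> mu.-integrable (hcube r) (EFin \o f) ->
  (pksup (pksup_term 1 s alpha p f) (ocube r) < +oo)%E ->
  dominating s p f r (fun c => (r.2 ^+ n) `^ (alpha * p) *
    fine (pksup (pksup_term 1 s alpha p f) (ocube c))).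
Proof.
move=> al0 p0 mf r0 fi koo; set k := pksup _ in koo *.
have k0 Y : (0 <= k Y)%E by apply: pksup_ge0; exact: pksup_term_ge0.
have W0 := powR_ge0 (r.2 ^+ n) (alpha * p).
have kfin c : 0 < c.2 -> hcube c `<=` hcube r -> k (ocube c) \is a fin_num.
  move=> c0 cr; rewrite ge0_fin_numE//; apply: le_lt_trans koo.
  by apply: pksupS; exact: ocube_subset.
split.
- by move=> c c0 cr; rewrite mulr_ge0// fine_ge0.
- move=> c c0 cr.
  have V0 : 0 < c.2 ^+ n by rewrite exprn_gt0.
  have fic : mu.-integrable (hcube c) (EFin \o f).
    exact: (integrableS (@mcube R n r) (@mcube R n c)).
  have m0 := hmean_ge0 s f c0.
  have Vr : c.2 ^+ n <= r.2 ^+ n.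
    by rewrite -lee_fin -(leb_gcube (fun=> true) (fun=> true) c0)
      -(leb_gcube (fun=> true) (fun=> true) r0); exact: le_leb.
  have : (pksup_term 1 s alpha p f (ocube c) <= k (ocube c))%E.
    by apply: pksup_cube => //; [exact: pksup_term_ge0|exact: is_cube_ocube].
  rewrite /pksup_term vol_gcube// osc1_gcube// poweR_EFin -EFinM -(fineK (kfin c c0 cr)) lee_fin.
  rewrite powRM ?powR_ge0// -powRrM mulNr powRN => h.
  apply: (@le_trans _ _ ((c.2 ^+ n) `^ (alpha * p) * fine (k (ocube c)))); last first.
    apply: ler_wpM2r; first exact: fine_ge0.
    by apply: le_powR => //; [exact: mulr_ge0|exact: ltW].
  apply: le_trans (ler_wpM2l (powR_ge0 _ _) h).
  rewrite le_eqVlt; apply/orP; left; apply/eqP; field.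
  by rewrite gt_eqF// powR_gt0.
- move=> c S d N c0 cr dsub dtriv; rewrite -mulr_sumr; apply: ler_wpM2l => //.
  have dr k' : S k' -> hcube (d k') `<=` hcube r.
    by move=> /dsub[_ h]; exact: subset_trans cr.
  rewrite -lee_fin -sumEFin fineK ?kfin//.
  rewrite (eq_bigr (fun i => k (ocube (d i)))); last first.
    by move=> i Si; rewrite fineK// kfin//; [have [] := dsub i Si|exact: dr].
  rewrite -big_filter; apply: pksup_sum; first exact: pksup_term_ge0.
  + by rewrite filter_uniq// iota_uniq.
  + move=> i; rewrite mem_filter => /andP[Si _]; have [di0 dic] := dsub i Si.
    exact: ocube_subset.
  + move=> i j; rewrite !mem_filter => /andP[Si _] /andP[Sj _] /eqP ij.
    apply/seteqP; split=> // x [xi xj]; apply: ij; apply: dtriv => //.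
    by exists x; split; exact: ocube_sub.
Qed.

(** With the weight frozen at [r], all means are bounded by one constant, and a multiple of the
    volume is superadditive. *)
Lemma dominating_sup s alpha p f r (S : R) : 0 <= alpha -> 0 <= p -> 0 <= S ->
  measurable_fun setT f -> 0 < r.2 -> mu.-integrable (hcube r) (EFin \o f) ->
  (forall c, 0 < c.2 -> hcube c `<=` hcube r -> (osc 1 s alpha f (ocube c) <= S%:E)%E) ->
  dominating s p f r (fun c => (S * (r.2 ^+ n) `^ alpha) `^ p * c.2 ^+ n).
Proof.
move=> al0 p0 S0 mf r0 fi oS.
have W0 := powR_ge0 (S * (r.2 ^+ n) `^ alpha) p.
split.
- by move=> c c0 _; rewrite mulr_ge0// exprn_ge0// ltW.
- move=> c c0 cr; have V0 : 0 < c.2 ^+ n by rewrite exprn_gt0.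
  have fic : mu.-integrable (hcube c) (EFin \o f).
    exact: (integrableS (@mcube R n r) (@mcube R n c)).
  have m0 := hmean_ge0 s f c0.
  have Vr : c.2 ^+ n <= r.2 ^+ n.
    by rewrite -lee_fin -(leb_gcube (fun=> true) (fun=> true) c0)
      -(leb_gcube (fun=> true) (fun=> true) r0); exact: le_leb.
  rewrite ler_pM2r//; apply: le_powR => //.
  have := oS c c0 cr; rewrite osc1_gcube// lee_fin powRN ler_pdivrMl ?powR_gt0//.
  rewrite mulrC => h; apply: (le_trans h); apply: ler_wpM2l => //.
  by apply: le_powR => //; exact: ltW.
- move=> c T d N c0 cr dsub dtriv; rewrite -mulr_sumr; apply: ler_wpM2l => //.
  have dc k : T k -> hcube (d k) `<=` hcube c by move=> /dsub[].
  have := @sum_integral_hcube_le R n T d c (cst 1%E) N dc dtriv (measurable_cst _) (fun=> lee01).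
  rewrite integral_cst_hcube// mul1r (eq_bigr (fun k => ((d k).2 ^+ n)%:E)).
    by rewrite sumEFin lee_fin.
  by move=> k /dsub[dk0 _]; rewrite integral_cst_hcube// mul1r.
Qed.

(** Dividing [local_bound] by the volume V leaves (K / V)^t with t = q / p, and the q-th root turns
    the exponent into 1 / p. *)
Lemma osc_local s (q p : R) : 1 <= q -> q < p -> exists2 C : R, 0 < C &
  forall alpha f r K b e, measurable_fun setT f -> 0 < r.2 ->
  mu.-integrable (hcube r) (EFin \o f) -> dominating s p f r K ->
  (osc q s alpha f (gcube b e r) <=
   (C * ((r.2 ^+ n) `^ (- alpha) * (K r / r.2 ^+ n) `^ p^-1))%:E)%E.
Proof.
move=> q1 qp; have q0 : 0 < q by rewrite (lt_le_trans _ q1).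
have p0 : 0 < p := lt_trans q0 qp.
pose t := q / p; have t01 : 0 < t < 1 by rewrite divr_gt0//= ltr_pdivrMr// mul1r.
have /andP[t0 t1] := t01.
have ptq : p * t = q by rewrite /t mulrC divfK// gt_eqF.
have pt1 : 1 <= p * t by rewrite ptq.
have [C C0 H] := @local_bound R n s p t t01 pt1; rewrite ptq in H.
exists (C `^ q^-1); first exact: powR_gt0.
move=> alpha f r K b e mf r0 fi dK; rewrite osc_gcube//.
have [K0 _ _] := dK; have Kr0 : 0 <= K r by exact: K0.
set V := r.2 ^+ n; have V0 : 0 < V by rewrite exprn_gt0.
rewrite mulrCA EFinM; apply: lee_wpmul2l; first by rewrite lee_fin powR_ge0.
have -> : (C `^ q^-1 * (K r / V) `^ p^-1)%:E = ((C * (K r / V) `^ t)%:E `^ q^-1)%E.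
  rewrite poweR_EFin (@powRM R C) ?powR_ge0 ?(ltW C0)// -powRrM; congr (_ * _ `^ _)%:E.
  by rewrite /t mulrAC mulfV ?mul1r// gt_eqF.
apply: gt0_ler_poweR; first by rewrite invr_ge0 ltW.
- rewrite in_itv/= leey andbT mule_ge0// ?lee_fin ?invr_ge0 ?(ltW V0)//.
  by apply: integral_ge0 => x _; rewrite lee_fin powR_ge0.
- by rewrite in_itv/= leey andbT lee_fin mulr_ge0 ?powR_ge0// ltW.
have := H f r K mf r0 fi dK; rewrite -/V => h.
have iV : (0 <= V^-1%:E)%E by rewrite lee_fin invr_ge0 ltW.
apply: (le_trans (lee_wpmul2l iV h)); rewrite -EFinM lee_fin.
rewrite le_eqVlt; apply/orP; left; apply/eqP.
rewrite powRM ?invr_ge0 ?(ltW V0)// powRV ?(ltW V0)//.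
rewrite powRB ?powRr1 ?(ltW V0)//; last by rewrite (gt_eqF V0) implybT.
by field; rewrite !gt_eqF// powR_gt0.
Qed.

Lemma osc_pksup s (q p : R) : 1 <= q -> q < p -> exists2 C : R, 0 < C &
  forall alpha f r b e, 0 <= alpha -> measurable_fun setT f -> 0 < r.2 ->
  mu.-integrable (hcube r) (EFin \o f) ->
  (pksup (pksup_term 1 s alpha p f) (ocube r) < +oo)%E ->
  ((vol (gcube b e r))%:E * osc q s alpha f (gcube b e r) `^ p <=
   C%:E * pksup (pksup_term 1 s alpha p f) (ocube r))%E.
Proof.
move=> q1 qp; have p0 : 0 < p by rewrite (lt_trans _ qp)// (lt_le_trans _ q1).
have [C C0 H] := osc_local s q1 qp.
exists (C `^ p); first exact: powR_gt0.
move=> alpha f r b e al0 mf r0 fi koo.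
have dK := dominating_pksup al0 (ltW p0) mf r0 fi koo.
have := H alpha f r _ b e mf r0 fi dK.
set k := pksup _ in koo *; set V := r.2 ^+ n; have V0 : 0 < V by rewrite exprn_gt0.
have k0 : (0 <= k (ocube r))%E by apply: pksup_ge0; exact: pksup_term_ge0.
have kfin : k (ocube r) \is a fin_num by rewrite ge0_fin_numE.
set kr := fine (k (ocube r)); have kr0 : 0 <= kr by exact: fine_ge0.
(* The weight frozen at [r] cancels the factor of [osc], so the constant does not depend on
   [alpha]. *)
have -> : V `^ (- alpha) * (V `^ (alpha * p) * kr / V) `^ p^-1 = (kr / V) `^ p^-1.
  rewrite -mulrA powRM ?powR_ge0 ?divr_ge0 ?(ltW V0)// -powRrM mulfK ?gt_eqF//.
  by rewrite mulrA -powRD ?addNr ?powRr0 ?mul1r// (gt_eqF V0) implybT.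
move=> h; rewrite vol_gcube// -/V.
apply: (@le_trans _ _ (V%:E * (C * (kr / V) `^ p^-1)%:E `^ p)%E).
  apply: lee_wpmul2l; first by rewrite lee_fin ltW.
  apply: gt0_ler_poweR => //; first exact: ltW.
  - by rewrite in_itv/= leey andbT osc_ge0.
  - by rewrite in_itv/= leey andbT lee_fin mulr_ge0 ?powR_ge0// ltW.
rewrite poweR_EFin -(fineK kfin) -!EFinM lee_fin -/kr.
rewrite (@powRM R C) ?powR_ge0 ?(ltW C0)// -powRrM mulVf ?gt_eqF// powRr1 ?divr_ge0 ?(ltW V0)//.
by rewrite le_eqVlt; apply/orP; left; apply/eqP; field; rewrite gt_eqF.
Qed.

Lemma osc_sup s (q : R) : 1 <= q -> exists2 C : R, 0 < C &
  forall alpha f r b e (S : R), 0 <= alpha -> 0 <= S -> measurable_fun setT f -> 0 < r.2 ->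
  mu.-integrable (hcube r) (EFin \o f) ->
  (forall c, 0 < c.2 -> hcube c `<=` hcube r -> (osc 1 s alpha f (ocube c) <= S%:E)%E) ->
  (osc q s alpha f (gcube b e r) <= (C * S)%:E)%E.
Proof.
move=> q1; pose p := q + 1; have qp : q < p by rewrite ltrDl.
have p0 : 0 < p by rewrite (lt_trans _ qp)// (lt_le_trans _ q1).
have [C C0 H] := osc_local s q1 qp; exists C => //.
move=> alpha f r b e S al0 S0 mf r0 fi oS.
have dK := dominating_sup al0 (ltW p0) S0 mf r0 fi oS.
apply: (le_trans (H alpha f r _ b e mf r0 fi dK)).
set V := r.2 ^+ n; have V0 : 0 < V by rewrite exprn_gt0.
rewrite lee_fin le_eqVlt; apply/orP; left; apply/eqP; congr (_ * _).
rewrite mulfK ?gt_eqF// -powRrM mulfV ?gt_eqF// powRr1 ?mulr_ge0 ?powR_ge0//.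
by rewrite mulrCA -powRD ?addNr ?powRr0 ?mulr1// (gt_eqF V0) implybT.
Qed.

End Oscillation.

(** * Comparison of the norms *)

Lemma eq_ereal_sup_image (R : realType) (T : Type) (D : set T) (a b : T -> \bar R) :
  (forall i, D i -> a i = b i) ->
  ereal_sup [set a i | i in D] = ereal_sup [set b i | i in D].
Proof.
move=> ab; congr ereal_sup; apply/seteqP.
by split=> _ [i Di <-]; exists i => //; rewrite ab.
Qed.

Lemma eq_pksup (R : realType) n (a b : set 'rV[R]_n -> \bar R) (X : set 'rV[R]_n) :
  (forall Q, is_cube Q -> Q `<=` X -> a Q = b Q) -> pksup a X = pksup b X.
Proof.
move=> ab; apply: eq_ereal_sup_image => C pC.
by apply: eq_esum => Q /(proj1 pC)[cQ QX]; exact: ab.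
Qed.

Section NormComparison.
Context {R : realType} {n : nat}.
Local Notation L := (lebesgue_space R n).
Local Notation mu := (leb R n).
Implicit Types (c : 'rV[R]_n * R) (f : L -> R) (X Q : set 'rV[R]_n).

Lemma le_mx_norm (x : 'rV[R]_n) i : `|x ord0 i| <= `|x|.
Proof.
rewrite [leRHS]mx_normrE.
exact: (@le_bigmax _ R _ 0 (fun ij : 'I_1 * 'I_n => `|x ij.1 ij.2|) (ord0, i)).
Qed.

Lemma mx_norm_le (x : 'rV[R]_n) (r : R) : 0 <= r -> (forall i, `|x ord0 i| <= r) -> `|x| <= r.
Proof.
move=> r0 H; rewrite [leLHS]mx_normrE; apply: bigmax_le => // -[i j] _ /=.
by rewrite ord1.
Qed.

Lemma bounded_gcube b e c : 0 < c.2 -> bounded_set (gcube b e c).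
Proof.
move=> c0; exists (`|c.1| + c.2); split; first exact: num_real.
move=> M hM x xc; apply: mx_norm_le.
  by apply/ltW/(le_lt_trans _ hM); rewrite addr_ge0// ltW.
move=> i; apply/ltW/(le_lt_trans _ hM); have := le_mx_norm c.1 i.
have := xc i; case: (b i); case: (e i); rewrite in_itv /= => /andP[h1 h2];
  rewrite ler_norml => /andP[h3 h4]; rewrite ler_norml; apply/andP; split; lra.
Qed.

Lemma bounded_sub_hcube (E : set 'rV[R]_n) : bounded_set E ->
  exists c, 0 < c.2 /\ E `<=` hcube c.
Proof.
move=> [M [_ HM]]; pose r := `|M| + 1; have r0 : 0 < r by rewrite ltr_wpDl.
have Mr : M < r by rewrite (le_lt_trans (ler_norm M))// ltrDl.
exists (const_mx (- r), r *+ 3); split; first by rewrite pmulrn_lgt0.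
move=> x Ex; apply/hcubeP => i; rewrite mxE /=.
have := le_trans (le_mx_norm x i) (HM r Mr x Ex); rewrite ler_norml => /andP[h1 h2].
by rewrite h1 /= mulrS mulr2n; lra.
Qed.

Lemma osc_eq q s alpha f (g : L -> R) Q : (forall x, Q x -> f x = g x) ->
  osc q s alpha f Q = osc q s alpha g Q.
Proof.
move=> fg; have E : polyproj s Q (fun y => `|f y|) = polyproj s Q (fun y => `|g y|).
  apply/funext => x; rewrite /polyproj.
  suff -> : [set P | is_polyproj s Q (fun y => `|f y|) P] =
            [set P | is_polyproj s Q (fun y => `|g y|) P] by [].
  apply/seteqP; split=> P [sP oP]; split=> // k ks; rewrite -[RHS](oP k ks);
    by apply: eq_integral => y; rewrite inE => Qy; rewrite fg.
suff I : (\int[mu]_(x in Q) (`|f x - polyproj s Q (fun y => `|g y|) x| `^ q)%:E =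
    \int[mu]_(x in Q) (`|g x - polyproj s Q (fun y => `|g y|) x| `^ q)%:E)%E.
  by rewrite /osc E I.
by apply: eq_integral => y; rewrite inE => Qy; rewrite fg.
Qed.

Lemma tJN_norm_fin X p q s alpha f :
  tJN_norm X p%:E q s alpha f = (pksup (pksup_term q s alpha p f) X `^ p^-1)%E.
Proof. by []. Qed.

Lemma tJN_norm_eq X p q s alpha f (g : L -> R) : (forall x, X x -> f x = g x) ->
  tJN_norm X p q s alpha f = tJN_norm X p q s alpha g.
Proof.
move=> fg; have E Q : Q `<=` X -> osc q s alpha f Q = osc q s alpha g Q.
  by move=> QX; apply: osc_eq => x /QX; exact: fg.
case: p => [p| |]; last by [].
- have kE : pksup (pksup_term q s alpha p f) X = pksup (pksup_term q s alpha p g) X.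
    by apply: eq_pksup => Q _ QX; rewrite /pksup_term (E Q QX).
  exact: (congr1 (fun z : \bar R => (z `^ p^-1)%E) kE).
- by rewrite /tJN_norm; apply: eq_ereal_sup_image => Q [_ QX]; exact: E.
Qed.

Lemma esum_le_scale (C : set (set 'rV[R]_n)) (k : R) (a b : set 'rV[R]_n -> \bar R) :
  0 <= k -> (forall Q, 0 <= b Q)%E -> (forall Q, C Q -> a Q <= k%:E * b Q)%E ->
  (\esum_(Q in C) a Q <= k%:E * \esum_(Q in C) b Q)%E.
Proof.
move=> k0 b0 ab; apply: ge_ereal_sup => _ [F [finF FC] <-].
apply: (@le_trans _ _ (\sum_(Q \in F) (k%:E * b Q))%E).
  rewrite !fsbig_finite//= big_seq [leRHS]big_seq; apply: lee_sum => Q.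
  by rewrite in_fset_set// inE => /FC; exact: ab.
rewrite -ge0_mule_fsumr; last by [].
apply: lee_wpmul2l; first by rewrite lee_fin.
by apply: ereal_sup_ubound; exists F.
Qed.

Lemma poweR_le_scale (p k : R) (x y : \bar R) : 0 < p -> 0 <= k -> (0 <= x)%E -> (0 <= y)%E ->
  (x <= k%:E * y)%E -> (x `^ p^-1 <= (k `^ p^-1)%:E * y `^ p^-1)%E.
Proof.
move=> p0 k0 x0 y0 xy; rewrite -poweR_EFin -poweRM ?lee_fin//.
have ky : (0 <= k%:E * y)%E by rewrite mule_ge0.
by apply: gt0_ler_poweR => //; [rewrite invr_ge0 ltW|rewrite in_itv/= x0 leey|rewrite in_itv/= ky leey].
Qed.

Lemma tJN_norm1_le (k q p : R) s alpha f X : 0 <= k -> 0 < p ->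
  (forall Q, is_cube Q -> Q `<=` X -> osc 1 s alpha f Q <= k%:E * osc q s alpha f Q)%E ->
  (tJN_norm X p%:E 1 s alpha f <= k%:E * tJN_norm X p%:E q s alpha f)%E.
Proof.
move=> k0 p0 H; rewrite !tJN_norm_fin.
have -> : k%:E = ((k `^ p) `^ p^-1)%:E by rewrite -powRrM mulfV ?gt_eqF// powRr1.
apply: poweR_le_scale => //; first exact: powR_ge0.
- by apply: pksup_ge0; exact: pksup_term_ge0.
- by apply: pksup_ge0; exact: pksup_term_ge0.
apply: ge_ereal_sup => _ [C pC <-].
apply: (@le_trans _ _ ((k `^ p)%:E * \esum_(Q in C) pksup_term q s alpha p f Q)%E); last first.
  apply: lee_wpmul2l; first by rewrite lee_fin powR_ge0.
  by apply: ereal_sup_ubound; exists C.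
apply: esum_le_scale; [exact: powR_ge0|exact: pksup_term_ge0|].
move=> Q /(proj1 pC)[cQ QX]; rewrite /pksup_term muleCA.
apply: lee_wpmul2l; first by rewrite lee_fin vol_ge0.
rewrite -poweR_EFin -poweRM ?osc_ge0 ?lee_fin//; apply: gt0_ler_poweR; first exact: ltW.
- by rewrite in_itv/= leey osc_ge0.
- by rewrite in_itv/= leey mule_ge0 ?osc_ge0.
- exact: H.
Qed.

(** Pointwise h <= B + B^(1 - q) h^q for B > 0, by comparing h with B. With B just above the q-mean
    of h, both terms have mean at most B; this is the origin of the constant 2. *)
Lemma osc1_le (q : R) s alpha f Q : 1 <= q -> is_cube Q -> measurable_fun setT f ->
  (osc 1 s alpha f Q <= 2%:E * osc q s alpha f Q)%E.
Proof.
move=> q1 /is_cubeP[b [e [c [c0 ->]]]] mf; rewrite !osc_gcube// invr1.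
have q0 : 0 < q by rewrite (lt_le_trans _ q1).
set V := c.2 ^+ n; have V0 : 0 < V by rewrite exprn_gt0.
rewrite muleCA; apply: lee_wpmul2l; first by rewrite lee_fin powR_ge0.
have mh := measurable_hdev s c mf.
have mhq : measurable_fun setT (fun x : L => (hdev s f c x `^ q)%:E).
  by apply/measurable_EFinP; exact: (measurableT_comp (measurable_powR _) mh).
have mh1 : measurable_fun setT (fun x : L => (hdev s f c x `^ 1)%:E).
  by apply/measurable_EFinP; exact: (measurableT_comp (measurable_powR _) mh).
have iV : (0 <= V^-1%:E :> \bar R)%E by rewrite lee_fin invr_ge0 ltW.
set I := (\int[mu]_(x in _) (_ `^ q)%:E)%E.
have I0 : (0 <= I)%E by apply: integral_ge0 => x _; rewrite lee_fin powR_ge0.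
rewrite poweRe1; last first.
  by apply: (mule_ge0 iV); apply: integral_ge0 => x _; rewrite lee_fin powR_ge0.
have := leey I; rewrite le_eqVlt => /orP[/eqP ->|Ioo].
  rewrite gt0_muley ?lte_fin ?invr_gt0// poweRyr ?invr_neq0 ?gt_eqF//.
  by rewrite gt0_muley ?leey// lte_fin.
have Ifin : I \is a fin_num by rewrite ge0_fin_numE.
pose m := fine I / V; have m0 : 0 <= m by rewrite divr_ge0 ?fine_ge0// ltW.
have -> : (V^-1%:E * I = m%:E)%E by rewrite -(fineK Ifin) -EFinM mulrC.
rewrite poweR_EFin; set A := m `^ q^-1; have A0 : 0 <= A by exact: powR_ge0.
apply/lee_addgt0Pr => d d0.
(* The added [d / 2] keeps [B] positive when [A] is 0, and the resulting bound [2 * B] is exactly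
   [2 * A + d]. *)
pose B := A + d / 2; have B0 : 0 < B by rewrite ltr_wpDl// divr_gt0.
have pt x : hdev s f c x `^ 1 <= B + B `^ (1 - q) * hdev s f c x `^ q.
  rewrite powRr1 ?hdev_ge0//; have [h|h] := leP (hdev s f c x) B.
    by rewrite (le_trans h)// lerDl mulr_ge0// powR_ge0.
  have h0 : 0 < hdev s f c x := lt_trans B0 h.
  apply: (@le_trans _ _ (B `^ (1 - q) * hdev s f c x `^ q)); last by rewrite lerDr ltW.
  rewrite -[leLHS]powRr1 ?(ltW h0)// -{1}(subrK q 1) powRD; last by rewrite (gt_eqF h0) implybT.
  apply: ler_wpM2r; first exact: powR_ge0.
  rewrite -(opprB q 1) !powRN lef_pV2 ?posrE ?powR_gt0//.
  by apply: le_powR; rewrite ?subr_ge0 ?(ltW B0) ?(ltW h).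
have up : (\int[mu]_(x in hcube c) (hdev s f c x `^ 1)%:E <=
    (B * V + B `^ (1 - q) * fine I)%:E)%E.
  apply: (@le_trans _ _ (\int[mu]_(x in hcube c) (B%:E + (B `^ (1 - q))%:E * (hdev s f c x `^ q)%:E)%E)%E).
    apply: ge0_le_integral.
    - exact: mcube.
    - by move=> x _; rewrite lee_fin powR_ge0.
    - exact: measurable_funTS.
    - apply: measurable_funTS; apply: emeasurable_funD; first exact: measurable_cst.
      exact: (emeasurable_funM (measurable_cst _) mhq).
    - by move=> x _; rewrite -EFinM -EFinD lee_fin.
  rewrite ge0_integralD; first last.
  - apply: measurable_funTS; exact: (emeasurable_funM (measurable_cst _) mhq).
  - by move=> x _; rewrite -EFinM lee_fin mulr_ge0// powR_ge0.
  - exact: measurable_cst.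
  - by move=> x _; rewrite lee_fin ltW.
  - exact: mcube.
  rewrite ge0_integralZl; first last.
  - by rewrite lee_fin powR_ge0.
  - by move=> x _; rewrite lee_fin powR_ge0.
  - exact: measurable_funTS.
  - exact: mcube.
  by rewrite integral_cst_hcube// -/I -(fineK Ifin) EFinD EFinM.
apply: (le_trans (lee_wpmul2l iV up)); rewrite -!EFinM -EFinD lee_fin.
have -> : V^-1 * (B * V + B `^ (1 - q) * fine I) = B + B `^ (1 - q) * m.
  by rewrite /m; field; rewrite gt_eqF.
have mB : m <= B `^ q.
  have -> : m = A `^ q by rewrite /A -powRrM mulVf ?gt_eqF// powRr1.
  by apply: le_powR => //; [exact: ltW|rewrite lerDl divr_ge0// ltW].
have : B `^ (1 - q) * m <= B.
  apply: (le_trans (ler_wpM2l (powR_ge0 _ _) mB)).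
  by rewrite -powRD ?subrK ?powRr1// ?(ltW B0)// (gt_eqF B0) implybT.
move=> h; rewrite /B in h *; move: h; set z := _ * m; move=> h; lra.
Qed.

End NormComparison.

(** * Equality of the spaces and equivalence of the norms *)

Section Main.
Context {R : realType} {n : nat}.
Local Notation L := (lebesgue_space R n).
Local Notation mu := (leb R n).
Implicit Types (c : 'rV[R]_n * R) (f : L -> R) (X Q : set 'rV[R]_n).

(** The inclusion in [X] concerns the cube with its actual endpoints, the integral its half-open
    variant, which may protrude from [X] by a null set. *)
Definition cube_Lq X (q : R) f := forall b e c, 0 < c.2 -> gcube b e c `<=` X ->
  (\int[mu]_(x in hcube c) (`|f x| `^ q)%:E < +oo)%E.

Lemma measurable_cube_or_setT X : X = setT \/ is_cube X -> measurable (X : set L).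
Proof.
move=> [->|/is_cubeP[b [e [c [c0 ->]]]]]; first exact: measurableT.
by apply: measurable_leb; exact: measurable_gcube.
Qed.

Lemma measurable_norm_powR (q : R) f : measurable_fun setT f ->
  measurable_fun setT (fun x => (`|f x| `^ q)%:E).
Proof.
move=> mf; apply/measurable_EFinP.
exact: (measurableT_comp (measurable_powR _) (measurableT_comp (@normr_measurable R setT) mf)).
Qed.

(** Extension by 0 outside [X] makes the function measurable on the whole space, so that all
    variants of a cube give the same integrals. Bounded test sets can be replaced by cubes, as each
    of them lies in a cube inside [X]. *)
Lemma Lqloc_cubes X (q : R) f : X = setT \/ is_cube X -> 0 < q ->
  Lqloc X q f <-> measurable_fun (setT : set L) (f \_ X) /\ cube_Lq X q (f \_ X).
Proof.
move=> hX q0; have mX := measurable_cube_or_setT hX; split=> [[mf fi]|[mf fi]].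
  have mfX : measurable_fun (setT : set L) (f \_ X).
    exact: (proj1 (measurable_restrictT f mX) mf).
  split=> // b e c c0 QX.
  have mQ : measurable (gcube b e c : set L).
    by apply: measurable_leb; exact: measurable_gcube.
  rewrite -(integral_gcube b e c0 (measurable_norm_powR q mfX)).
  apply: le_lt_trans (fi (gcube b e c) mQ (bounded_gcube b e c0) QX).
  have -> : (\int[mu]_(x in gcube b e c) (`|(f \_ X) x| `^ q)%:E =
      \int[mu]_(x in gcube b e c) (`|f x * \1_(gcube b e c) x| `^ q)%:E)%E.
    apply: eq_integral => x xQ; rewrite patchE indicE xQ mulr1 mem_set//.
    by apply: QX; rewrite -inE.
  apply: (ge0_subset_integral mu mQ mX).
  - apply/measurable_EFinP; apply: (measurableT_comp (measurable_powR _)).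
    apply: (measurableT_comp (@normr_measurable R setT)).
    by apply: (measurable_funM mf); exact: measurable_indic.
  - by move=> x _; rewrite lee_fin powR_ge0.
  - exact: QX.
split=> [|E mE bE EX]; first exact: (proj2 (measurable_restrictT f mX) mf).
(* In the whole space a large half-open cube contains [E]; otherwise [X] itself is the cube. *)
have [b [e [c [c0 EQ QX]]]] : exists b e c, [/\ 0 < c.2, E `<=` gcube b e c & gcube b e c `<=` X].
  case: hX => [->|/is_cubeP[b [e [c [c0 XE]]]]].
    have [c [c0 Ec]] := bounded_sub_hcube bE.
    by exists (fun=> true), (fun=> true), c; split.
  by exists b, e, c; rewrite -XE; split.
have mQ : measurable (gcube b e c : set L).
  by apply: measurable_leb; exact: measurable_gcube.
apply: le_lt_trans (fi b e c c0 QX).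
rewrite -(integral_gcube b e c0 (measurable_norm_powR q mf)).
have -> : (\int[mu]_(x in X) (`|f x * \1_E x| `^ q)%:E =
    \int[mu]_(x in E) (`|(f \_ X) x| `^ q)%:E)%E.
  rewrite [RHS]integral_mkcond [LHS]integral_mkcond; apply: eq_integral => x _.
  rewrite !patchE indicE; have [xE|xE] := boolP (x \in E).
    have xX : x \in X by rewrite inE; apply: EX; rewrite -inE.
    by rewrite xX mulr1.
  by rewrite mulr0 normr0 powR0 ?gt_eqF//; case: ifP.
apply: (ge0_subset_integral mu mE mQ).
- by apply: measurable_funTS; exact: measurable_norm_powR.
- by move=> x _; rewrite lee_fin powR_ge0.
- exact: EQ.
Qed.

Lemma cube_Lq_integrable X f b e c : measurable_fun setT f -> cube_Lq X 1 f ->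
  0 < c.2 -> gcube b e c `<=` X -> mu.-integrable (hcube c) (EFin \o f).
Proof.
move=> mf fi c0 QX; apply/integrableP; split.
  by apply: measurable_funTS; exact/measurable_EFinP.
apply: le_lt_trans (fi b e c c0 QX); rewrite le_eqVlt; apply/orP; left; apply/eqP.
by apply: eq_integral => x _; rewrite powRr1.
Qed.

Lemma cube_Lq1 X (q : R) f : 1 <= q -> measurable_fun setT f -> cube_Lq X q f ->
  cube_Lq X 1 f.
Proof.
move=> q1 mf fi b e c c0 QX; have mq := measurable_norm_powR q mf.
have q0 : 0 <= q by rewrite (le_trans _ q1).
apply: (@le_lt_trans _ _ (\int[mu]_(x in hcube c) (1%:E + (`|f x| `^ q)%:E)%E)%E).
  apply: ge0_le_integral.
  - exact: mcube.
  - by move=> x _; rewrite lee_fin powR_ge0.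
  - by apply: measurable_funTS; exact: measurable_norm_powR.
  - by apply: measurable_funTS; exact: (emeasurable_funD (measurable_cst _) mq).
  - move=> x _; rewrite -EFinD lee_fin powRr1//; have [h|h] := leP `|f x| 1.
      by rewrite (le_trans h)// lerDl powR_ge0.
    rewrite (le_trans (le1r_powR (ltW h) q1))// lerDr//.
rewrite ge0_integralD; first last.
- exact: measurable_funTS.
- by move=> x _; rewrite lee_fin powR_ge0.
- exact: measurable_cst.
- by move=> x _; rewrite lee_fin.
- exact: mcube.
by rewrite integral_cst_hcube// lte_add_pinfty ?ltry//; exact: fi QX.
Qed.

(** The projection is bounded on the cube, so a finite q-integral of the deviation passes to [f].
    This supplies the local condition for the exponent q in the inclusion that starts from exponent
    1. *)
Lemma osc_lty_integral (q : R) s alpha f b e c : 0 < q -> 0 < c.2 ->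
  measurable_fun setT f -> (osc q s alpha f (gcube b e c) < +oo)%E ->
  (\int[mu]_(x in hcube c) (`|f x| `^ q)%:E < +oo)%E.
Proof.
move=> q0 c0 mf; rewrite osc_gcube//; set I := (\int[mu]_(x in _) _)%E => oI.
have V0 : 0 < c.2 ^+ n by rewrite exprn_gt0.
have I0 : (0 <= I)%E by apply: integral_ge0 => x _; rewrite lee_fin powR_ge0.
have Ioo : (I < +oo)%E.
  rewrite ltey; apply/eqP => Iy; move: oI; rewrite Iy.
  rewrite gt0_muley ?lte_fin ?invr_gt0// poweRyr ?invr_neq0 ?gt_eqF//.
  by rewrite gt0_muley// lte_fin powR_gt0.
pose P := hproj s c (fun y : L => `|f y|).
have [_ [M PM]] := bddmeas_pev P c0.
pose M' := Num.max M 0; have M'0 : 0 <= M' by rewrite le_max lexx orbT.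
have mh : measurable_fun setT (fun x : L => (hdev s f c x `^ q)%:E).
  by apply/measurable_EFinP; exact: (measurableT_comp (measurable_powR _) (measurable_hdev s c mf)).
apply: (@le_lt_trans _ _ (\int[mu]_(x in hcube c) ((2 `^ q)%:E *
    ((hdev s f c x `^ q)%:E + (M' `^ q)%:E))%E)%E).
  apply: ge0_le_integral.
  - exact: mcube.
  - by move=> x _; rewrite lee_fin powR_ge0.
  - by apply: measurable_funTS; exact: measurable_norm_powR.
  - apply: measurable_funTS; apply: (emeasurable_funM (measurable_cst _)).
    exact: (emeasurable_funD mh (measurable_cst _)).
  - move=> x cx; rewrite -EFinD -EFinM lee_fin.
    apply: le_trans (powRD_le (ltW q0) (hdev_ge0 s f c x) M'0).
    apply: le_powR => //; first exact: ltW.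
    have := ler_normD (f x - pev P x) (pev P x); rewrite subrK => /le_trans; apply.
    by rewrite lerD2l le_max PM.
rewrite ge0_integralZl; first last.
- by rewrite lee_fin powR_ge0.
- by move=> x _; rewrite -EFinD lee_fin addr_ge0// powR_ge0.
- by apply: measurable_funTS; exact: (emeasurable_funD mh (measurable_cst _)).
- exact: mcube.
rewrite ge0_integralD; first last.
- exact: measurable_cst.
- by move=> x _; rewrite lee_fin powR_ge0.
- exact: measurable_funTS.
- by move=> x _; rewrite lee_fin powR_ge0.
- exact: mcube.
rewrite integral_cst_hcube// -/I lte_mul_pinfty ?lee_fin ?powR_ge0//.
by rewrite lte_add_pinfty ?ltry.
Qed.

Lemma tJN_norm_osc_lty X (p : \bar R) (q : R) s alpha f Q : (0 < p)%E ->
  is_cube Q -> Q `<=` X -> (tJN_norm X p q s alpha f < +oo)%E ->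
  (osc q s alpha f Q < +oo)%E.
Proof.
case: p => [p| |] // p0 cQ QX; last first.
  by apply: le_lt_trans; apply: ereal_sup_ubound; exists Q.
rewrite lte_fin in p0; rewrite tJN_norm_fin => /lty_poweRy => h.
have {}h := h (invr_neq0 (lt0r_neq0 p0)).
have : (pksup_term q s alpha p f Q < +oo)%E.
  by apply: le_lt_trans h; apply: pksup_cube => //; exact: pksup_term_ge0.
move: cQ => /is_cubeP[b [e [c [c0 ->]]]]; rewrite /pksup_term vol_gcube// => lt.
rewrite ltey; apply/eqP => oy; move: lt; rewrite oy poweRyr ?lt0r_neq0//.
by rewrite gt0_muley// lte_fin exprn_gt0.
Qed.

Lemma tJN_norm1_bound X (p : \bar R) (q : R) s alpha f : 1 <= q -> (q%:E < p)%E ->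
  measurable_fun setT f ->
  (tJN_norm X p 1 s alpha f <= 2%:E * tJN_norm X p q s alpha f)%E.
Proof.
move=> q1; case: p => [p| |] // qp mf.
  rewrite lte_fin in qp; apply: tJN_norm1_le => //.
    by rewrite (lt_trans _ qp)// (lt_le_trans _ q1).
  by move=> Q cQ _; exact: osc1_le.
apply: ge_ereal_sup => _ [Q [cQ QX] <-].
apply: (le_trans (osc1_le s alpha q1 cQ mf)); apply: lee_wpmul2l; first by rewrite lee_fin.
by apply: ereal_sup_ubound; exists Q.
Qed.

Lemma tJN_normq_bound (p : \bar R) (q : R) s : 1 <= q -> (q%:E < p)%E ->
  exists2 C : R, 0 < C & forall X alpha f, 0 <= alpha -> measurable_fun setT f ->
  cube_Lq X 1 f -> (tJN_norm X p 1 s alpha f < +oo)%E ->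
  (tJN_norm X p q s alpha f <= C%:E * tJN_norm X p 1 s alpha f)%E.
Proof.
move=> q1; case: p => [p| |] // qp.
  rewrite lte_fin in qp.
  have p0 : 0 < p by rewrite (lt_trans _ qp)// (lt_le_trans _ q1).
  have [C C0 H] := @osc_pksup R n s q p q1 qp.
  exists (C `^ p^-1); first exact: powR_gt0.
  move=> X alpha f al0 mf fi; rewrite tJN_norm_fin => /lty_poweRy => h.
  have {}h := h (invr_neq0 (lt0r_neq0 p0)).
  have g0 (A : set 'rV[R]_n) : (0 <= pksup (pksup_term 1 s alpha p f) A)%E.
    by apply: pksup_ge0; exact: pksup_term_ge0.
  apply: poweR_le_scale => //; first exact: ltW.
    by apply: pksup_ge0; exact: pksup_term_ge0.
  apply: ge_ereal_sup => _ [S pS <-].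
  (* The local bound on [Q] involves only packings inside the interior of [Q], so these
     contributions add up within a single supremum over [X]. *)
  apply: (@le_trans _ _ (C%:E * \esum_(Q in S) pksup (pksup_term 1 s alpha p f) Q°)%E).
    apply: esum_le_scale; [exact: ltW|by move=> Q; exact: g0|].
    move=> Q /(proj1 pS)[/is_cubeP[b [e [c [c0 ->]]]] QX].
    have oX : ocube c `<=` X by apply: subset_trans QX; exact: ocube_sub.
    have fic := cube_Lq_integrable mf fi c0 QX.
    apply: le_trans (H alpha f c b e al0 mf c0 fic _) _.
      by apply: le_lt_trans h; exact: pksupS.
    apply: lee_wpmul2l; first by rewrite lee_fin ltW.
    by apply: pksupS; exact: ocube_interior.
  apply: lee_wpmul2l; first by rewrite lee_fin ltW.
  by apply: pksup_esum => //; exact: pksup_term_ge0.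
have [C C0 H] := @osc_sup R n s q q1; exists C => // X alpha f al0 mf fi S1.
apply: ge_ereal_sup => _ [Q [/is_cubeP[b [e [c [c0 QE]]]] QX] <-].
rewrite QE in QX *; set S := tJN_norm _ _ _ _ _ _ in S1 *.
have leS Q' : is_cube Q' -> Q' `<=` X -> (osc 1 s alpha f Q' <= S)%E.
  by move=> cQ' QX'; apply: ereal_sup_ubound; exists Q'.
have oX : ocube c `<=` X by apply: subset_trans QX; exact: ocube_sub.
have S0 : (0 <= S)%E.
  by apply: le_trans (leS (ocube c) (is_cube_ocube c0) oX); exact: osc_ge0.
have Sfin : S \is a fin_num by rewrite ge0_fin_numE.
rewrite -(fineK Sfin) -EFinM; apply: H => //; first exact: fine_ge0.
  exact: cube_Lq_integrable fi c0 QX.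
move=> c' c'0 cc'; rewrite fineK//; apply: leS; first exact: is_cube_ocube.
by apply: subset_trans oX; exact: ocube_subset.
Qed.

End Main.

Theorem proposition3p5 (R : realType) (n : nat) (hn : (0 < n)%N)
  (q : R) (p : \bar R) (hq : 1 <= q) (hqp : (q%:E < p)%E)
  (s : nat) (alpha : R) (halpha : 0 <= alpha)
  (X : set 'rV[R]_n) (hX : X = setT \/ is_cube X) :
  tJN X p q s alpha = tJN X p 1 s alpha /\
  exists c1 c2 : R, 0 < c1 /\ 0 < c2 /\
    forall f : 'rV[R]_n -> R, tJN X p q s alpha f ->
      (c1%:E * tJN_norm X p 1 s alpha f <= tJN_norm X p q s alpha f)%E /\
      (tJN_norm X p q s alpha f <= c2%:E * tJN_norm X p 1 s alpha f)%E.
Proof.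
have q0 : 0 < q by rewrite (lt_le_trans _ hq).
have p0 : (0 < p)%E by apply: le_lt_trans hqp; rewrite lee_fin ltW.
have [C C0 H] := @tJN_normq_bound R n p q s hq hqp.
(* The norm sees only values on [X], so [f] can be traded for its extension by 0, which is
   measurable everywhere. *)
have nE q' (f : 'rV[R]_n -> R) : tJN_norm X p q' s alpha f =
    tJN_norm X p q' s alpha (f \_ X).
  by apply: tJN_norm_eq => x Xx; rewrite patchE mem_set.
have le1 f : Lqloc X q f ->
    (tJN_norm X p 1 s alpha f <= 2%:E * tJN_norm X p q s alpha f)%E.
  move=> /(Lqloc_cubes _ hX q0)[mf _]; rewrite (nE 1) (nE q).
  exact: tJN_norm1_bound.
have leq f : Lqloc X 1 f -> (tJN_norm X p 1 s alpha f < +oo)%E ->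
    (tJN_norm X p q s alpha f <= C%:E * tJN_norm X p 1 s alpha f)%E.
  move=> /(Lqloc_cubes _ hX ltr01)[mf fi]; rewrite (nE 1) (nE q).
  exact: H.
have sub1 f : tJN X p q s alpha f -> tJN X p 1 s alpha f.
  move=> [lf nf]; split; last first.
    by apply: le_lt_trans (le1 f lf) _; rewrite lte_mul_pinfty// lee_fin.
  move/(Lqloc_cubes _ hX q0) : lf => [mf fi].
  by apply/(Lqloc_cubes _ hX ltr01); split=> //; exact: cube_Lq1 fi.
split.
  apply/seteqP; split=> f; first exact: sub1.
  (* The norm with exponent q is meaningful as an extended real before local integrability is known.
     Its finiteness comes first, and the local condition is then read off from it. *)
  move=> [lf nf]; have nq : (tJN_norm X p q s alpha f < +oo)%E.
    by apply: le_lt_trans (leq f lf nf) _; rewrite lte_mul_pinfty// ?lee_fin ltW.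
  split; last exact: nq.
  move/(Lqloc_cubes _ hX ltr01) : lf => [mf fi].
  apply/(Lqloc_cubes _ hX q0); split=> // b e c c0 QX.
  apply: (@osc_lty_integral R n q s alpha _ b e c q0 c0 mf).
  apply: (tJN_norm_osc_lty p0 _ QX); last by rewrite -nE.
  by apply/is_cubeP; exists b, e, c.
exists 2^-1, C; split; first by rewrite invr_gt0.
split=> // f tf; have [lf nf] := tf; have [lf1 nf1] := sub1 f tf.
split; last exact: leq.
by rewrite muleC lee_pdivrMr// muleC; exact: le1.
Qed.
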